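(* Let $(\mathbf{T},h)$ be a cyclic commuting $d$-tuple on $\mathbb{C}^m$. Then the following are equivalent. (1) $\Lambda_{\mathbf{T},h}$ is a distribution (i.e., it is the restriction to $\mathbb{C}[z_1,\dots,z_d,\bar z_1,\dots,\bar z_d]$ of a compactly supported distribution on $\mathbb{C}^d$). (2) $\mathbf{T}$ is a (generalized) Jordan tuple. In this case, $\Lambda_{\mathbf{T},h}$ is supported at $\sigma(\mathbf{T})$, the joint Taylor spectrum of $\mathbf{T}$, which consists of finitely many points.
   Context: A cyclic commuting $d$-tuple $(\mathbf{T},h)$ on a Hilbert space $\mathcal{H}$ is a tuple $\mathbf{T}=(T_1,\dots,T_d)$ of pairwise commuting bounded operators on $\mathcal{H}$ with a vector $h\in\mathcal{H}$ such that $\{p(\mathbf{T})h: p\in\mathbb{C}[z_1,\dots,z_d]\}$ is dense in $\mathcal{H}$. Agler's linear functional $\Lambda_{\mathbf{T},h}$ on $\mathbb{C}[z_1,\dots,z_d,\bar z_1,\dots,\bar z_d]$ is the linear functional determined by $\Lambda_{\mathbf{T},h}(z^\alpha\bar z^\beta)=\langle\mathbf{T}^\alpha h,\mathbf{T}^\beta h\rangle$ for $\alpha,\beta\in\mathbb{N}_0^d$. The polynomials in $z,\bar z$ are dense in the Fréchet space $C^\infty(\mathbb{C}^d)$, whose dual is the space of compactly supported distributions on $\mathbb{C}^d=\mathbb{R}^{2d}$, so an extension of $\Lambda_{\mathbf{T},h}$ to a compactly supported distribution is unique if it exists; $\Lambda_{\mathbf{T},h}$ is identified with it. A commuting tuple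 $\mathbf{N}=(N_1,\dots,N_d)$ is nilpotent if for some $\mathbf{m}\in\mathbb{N}_0^d$, $N_i^{m_i}=0$ for all $i$. A commuting tuple of matrices $\mathbf{J}=(J_1,\dots,J_d)$ is a tuple of (generalized) Jordan blocks at $\lambda\in\mathbb{C}^d$ if there is a commuting tuple $\mathbf{N}$ of nilpotent matrices with $J_i=\lambda_iI+N_i$, $i=1,\dots,d$. A commuting tuple $\mathbf{T}$ of matrices is a (generalized) Jordan tuple if there is a unitary $U$ such that $(U^*T_1U,\dots,U^*T_dU)$ is a (finite, orthogonal) direct sum of tuples of (generalized) Jordan blocks. *)

(* Defs.v *)
From HB Require Import structures.
From mathcomp Require Import all_boot all_order all_algebra.
From mathcomp Require Import complex.
From mathcomp Require mpoly.
From mathcomp Require Import all_classical all_reals all_analysis.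

Set Implicit Arguments.
Unset Strict Implicit.
Unset Printing Implicit Defensive.

Import Order.TTheory GRing.Theory Num.Theory.
Import numFieldNormedType.Exports.

Local Open Scope complex_scope.
Local Open Scope classical_set_scope.
Local Open Scope ring_scope.

Section Tuples.
Context {R : realType}.
Local Notation C := R[i].

(* Linear in the first argument and conjugate-linear in the second. *)
Definition inner {m} (x y : 'cV[C]_m) : C :=
  \sum_(k < m) x k 0 * (y k 0)^*.

Definition commuting_tuple {d m} (T : 'I_d -> 'M[C]_m) : Prop :=
  forall i j, T i *m T j = T j *m T i.

Definition tuple_pow {d m} (T : 'I_d -> 'M[C]_m) (a : 'I_d -> nat) : 'M[C]_m :=
  \prod_(i < d) T i ^+ a i.

Definition tuple_poly {d m} (T : 'I_d -> 'M[C]_m) (p : mpoly.mpoly d C) :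
    'M[C]_m :=
  \sum_(mu <- mpoly.msupp p)
    mpoly.mcoeff mu p *: tuple_pow T (fun i => mpoly.fun_of_multinom mu i).

Definition cyclic_commuting_tuple {d m}
    (T : 'I_d -> 'M[C]_m) (h : 'cV[C]_m) : Prop :=
  commuting_tuple T /\
  dense ([set tuple_poly T p *m h | p in [set: mpoly.mpoly d C]]
    : set 'cV[(C : numFieldType)]_m).

(* C[z_1,..,z_d, conj z_1,..,conj z_d] is the polynomial ring in d + d
   variables: variable lshift d i is z_i and variable rshift d i is conj z_i. *)
Definition Lambda {d m} (T : 'I_d -> 'M[C]_m) (h : 'cV[C]_m)
    (p : mpoly.mpoly (d + d) C) : C :=
  \sum_(mu <- mpoly.msupp p) mpoly.mcoeff mu p *
    inner (tuple_pow T (fun i => mpoly.fun_of_multinom mu (lshift d i)) *m h)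
          (tuple_pow T (fun i => mpoly.fun_of_multinom mu (rshift d i)) *m h).

Definition nilpotent_tuple {d n} (N : 'I_d -> 'M[C]_n) : Prop :=
  commuting_tuple N /\ exists a : 'I_d -> nat, forall i, N i ^+ a i = 0.

Definition jordan_blocks_at {d n} (lam : 'rV[C]_d) (J : 'I_d -> 'M[C]_n) :
    Prop :=
  exists2 N : 'I_d -> 'M[C]_n,
    nilpotent_tuple N & forall i, J i = (lam 0 i)%:M + N i.

Definition jordan_tuple {d m} (T : 'I_d -> 'M[C]_m) : Prop :=
  exists (r : nat) (n : 'I_r -> nat) (e : (\sum_(k < r) n k)%N = m)
         (J : forall k : 'I_r, 'I_d -> 'M[C]_(n k)) (U : 'M[C]_m),
    [/\ forall k, exists lam : 'rV[C]_d, jordan_blocks_at lam (J k),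
        U \is unitarymx &
        forall i, (U^t*)%sesqui *m T i *m U =
                  castmx (e, e) (mxdiag (fun k : 'I_r => J k i))].

(* The Koszul differential sum_i E_i (x) T_i on the exterior algebra of C^d
   tensored with C^m, where E_i is the left exterior product by e_i.  The value
   x S is the coefficient of x at the basis element e_S (increasing order), and
   the sign is that of e_i /\ e_(S minus i) = +- e_S. *)
Definition koszul {d m} (T : 'I_d -> 'M[C]_m)
    (x : {ffun {set 'I_d} -> 'cV[C]_m}) : {ffun {set 'I_d} -> 'cV[C]_m} :=
  [ffun S : {set 'I_d} => \sum_(i in S)
     (-1) ^+ #|[set j in S | (j < i)%N]%SET| *: (T i *m x (S :\ i)%SET)].

Definition koszul_exact {d m} (T : 'I_d -> 'M[C]_m) : Prop :=
  forall x, koszul T x = 0 <-> exists y, x = koszul T y.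

Definition taylor_spectrum {d m} (T : 'I_d -> 'M[C]_m) : set 'rV[C]_d :=
  [set lam | ~ koszul_exact (fun i => T i - (lam 0 i)%:M)].

End Tuples.

Section Distributions.
Context {R : realType}.
Local Notation C := R[i].

Fixpoint partial {n} (f : 'rV[R]_n -> R) (s : seq 'I_n) : 'rV[R]_n -> R :=
  if s is i :: s' then 'D_('e_i) (partial f s') else f.

Definition smoothR {n} (f : 'rV[R]_n -> R) : Prop :=
  forall s : seq 'I_n, continuous (partial f s) /\
    forall (i : 'I_n) (x : 'rV[R]_n), derivable (partial f s) x 'e_i.

Definition smooth {n} (f : 'rV[R]_n -> C) : Prop :=
  smoothR (fun x => complex.Re (f x)) /\ smoothR (fun x => complex.Im (f x)).

Definition partialC {n} (f : 'rV[R]_n -> C) (s : seq 'I_n) (x : 'rV[R]_n) : C :=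
  partial (fun y => complex.Re (f y)) s x
    +i* partial (fun y => complex.Im (f y)) s x.

(* g lies in the basic neighbourhood of f, for the Frechet topology of
   C^oo(R^n), given by the compact set K, the order N and the radius r. *)
Definition smooth_near {n} (K : set 'rV[R]_n) (N : nat) (r : R)
    (f g : 'rV[R]_n -> C) : Prop :=
  forall s : seq 'I_n, (size s <= N)%N ->
    forall x, K x -> `|partialC g s x - partialC f s x| < r%:C.

(* The continuous linear functionals on the Frechet space C^oo(R^n); the values
   of u at functions that are not smooth are irrelevant. *)
Definition compact_distribution {n} (u : ('rV[R]_n -> C) -> C) : Prop :=
  (forall (a : C) f g, smooth f -> smooth g ->
     u (fun x => a * f x + g x) = a * u f + u g) /\
  (forall f, smooth f -> forall eps : R, 0 < eps ->
     exists (K : set 'rV[R]_n) (N : nat) (r : R),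
       [/\ compact K, 0 < r &
           forall g, smooth g -> smooth_near K N r f g ->
                     `|u g - u f| < eps%:C]).

Definition vanishes_on {n} (u : ('rV[R]_n -> C) -> C) (V : set 'rV[R]_n) :
    Prop :=
  forall phi : 'rV[R]_n -> C, smooth phi ->
    compact (closure [set x | phi x != 0]) ->
    closure [set x | phi x != 0] `<=` V -> u phi = 0.

Definition dsupport {n} (u : ('rV[R]_n -> C) -> C) : set 'rV[R]_n :=
  [set x | ~ exists V : set 'rV[R]_n, [/\ open V, V x & vanishes_on u V]].

(* The identification of R^(d + d) with C^d. *)
Definition toCd {d} (x : 'rV[R]_(d + d)) : 'rV[C]_d :=
  \row_(i < d) (x 0 (lshift d i) +i* x 0 (rshift d i)).

Definition zzbar_eval {d} (p : mpoly.mpoly (d + d) C) (x : 'rV[R]_(d + d)) : C :=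
  mpoly.meval (fun k => match fintype.split k with
                        | inl i => toCd x 0 i
                        | inr i => (toCd x 0 i)^*
                        end) p.

Definition distribution_extending {d}
    (L : mpoly.mpoly (d + d) C -> C) (u : ('rV[R]_(d + d) -> C) -> C) : Prop :=
  compact_distribution u /\ forall p, u (zzbar_eval p) = L p.

End Distributions.

(* Main.v *)
Require Import Defs.
From mathcomp Require Import all_boot all_order all_algebra.
From mathcomp Require Import complex.
From mathcomp Require Import -(notations) mpoly.
From mathcomp Require Import all_classical all_reals all_analysis.
From mathcomp Require Import ring lra.

(** Write L_(v,w)(z^a conj(z)^b) = <T^a v, T^b w>, so that the functional of the
    theorem is L_(h,h).  Multiplying a distribution by a coordinate function
    replaces v by T_i v or w by T_i w, and h is cyclic: if L_(h,h) is a
    distribution u, then so is every L_(v,w), by a distribution that vanishes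
    wherever u does ([localized_all]).

    (1) implies (2).  Let v and w be generalized eigenvectors of T_i for distinct
    eigenvalues x and y.  By induction on their orders, L_(v,w) multiplies as if
    z_i = x and conj(z_i) = conj(y); in the real coordinates of z_i this is
    evaluation at a non-real number.  Evaluation of the polynomials
    (1 - i s/k)^(k^2) at a non-real s grows exponentially in k, with the right
    sign, while their derivatives up to order N on a bounded interval are
    O(k^N): no distribution can do this unless <v, w> = 0 ([dist_real_point],
    [gen_eigen_orthogonal]).  The generalized eigenspaces of each T_i are thus
    orthogonal, and orthonormal bases of the joint ones assemble into the unitary
    matrix of a Jordan tuple ([commuting_projections], [orthogonal_jordan]).

    (2) implies (1).  A Jordan tuple splits h into orthogonal parts h_k that stay
    orthogonal under T, so L_(h,h) is the sum of the L_(h_k,h_k).  At the joint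
    eigenvalue of the k-th block such a functional kills a power of the maximal
    ideal, so it only sees a Taylor polynomial and is a combination of
    derivatives at that point ([point_distribution], [jordan_distribution]).

    Support.  Polynomials are dense among the compactly supported smooth
    functions ([dist_density]), so u is the distribution just constructed and
    vanishes off the joint eigenvalues.  Conversely, if v is a joint eigenvector
    at lam, then L_(v,v) is |v|^2 times evaluation at lam, which a bump function
    near lam detects.  Finally the Taylor spectrum is the set of joint
    eigenvalues: a joint eigenvector is a class of degree 0 in the Koszul
    complex, and if there is none then sum_i A_i B_i = 1 has a solution in the
    bicommutant, which makes the complex contractible ([koszul_contraction],
    [taylor_spectrumE]).

    The analysis is elementary: Bernstein operators, one coordinate at a time,
    give the Weierstrass theorem on a cube; derivatives are approximated by
    approximating a high mixed derivative and integrating back. *)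

Import Order.TTheory GRing.Theory Num.Theory.
Import numFieldNormedType.Exports.

Local Open Scope complex_scope.
Local Open Scope classical_set_scope.
Local Open Scope ring_scope.

Set Implicit Arguments.
Unset Strict Implicit.
Unset Printing Implicit Defensive.

(** * Partial derivatives of smooth functions *)

Section Calculus.
Context {R : realType} {n : nat}.
Local Notation V := 'rV[R]_n.
Implicit Types (f g : V -> R) (i j : 'I_n) (s t : seq 'I_n) (x : V).

(** Directional difference quotients are those of the restriction to a line,
    so one-variable results such as the mean value theorem apply. *)
Lemma line_quotient f x e (t : R) :
  (fun h : R => h^-1 *: (((fun r : R => f (x + r *: e)) \o shift t) (h *: 1) - f (x + t *: e)))
  = (fun h : R => h^-1 *: ((f \o shift (x + t *: e)) (h *: e) - f (x + t *: e))).
Proof.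
apply/funext => h /=; congr (_ *: (f _ - _)).
by rewrite /shift /= -[h%:A]/(h * 1) mulr1 scalerDl addrCA.
Qed.

Lemma derive_line f x e (t : R) :
  'D_1 (fun r : R => f (x + r *: e)) t = 'D_e f (x + t *: e).
Proof. by rewrite /derive line_quotient. Qed.

Lemma derivable_line f x e (t : R) :
  derivable (fun r : R => f (x + r *: e)) t 1 <-> derivable f (x + t *: e) e.
Proof. by rewrite /derivable line_quotient. Qed.

Lemma partial_cat f s t : partial f (s ++ t) = partial (partial f t) s.
Proof. by elim: s => //= i s ->. Qed.

Lemma smooth_partial f s : smoothR f -> smoothR (partial f s).
Proof. by move=> sf t; rewrite -partial_cat; apply: sf. Qed.

Lemma smooth_cont f : smoothR f -> continuous f.
Proof. by move=> /(_ [::]) []. Qed.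

Lemma smooth_derivable f x i : smoothR f -> derivable f x 'e_i.
Proof. by move=> /(_ [::]) [_]. Qed.

Lemma smooth_derive f i : smoothR f -> smoothR ('D_('e_i) f).
Proof. exact: (@smooth_partial f [:: i]). Qed.

(** Coinduction: [smoothR] quantifies over all words of derivatives, and a
    class of functions that is stable under one derivative is stable under all
    of them. *)
Lemma smooth_coind (S : set (V -> R)) :
  (forall f, S f -> continuous f /\
     forall i, (forall x, derivable f x 'e_i) /\ S ('D_('e_i) f)) ->
  forall f, S f -> smoothR f.
Proof.
move=> HS f Sf s.
have Sp : S (partial f s).
  by elim: s => //= i s /HS[_ /(_ i) [_]].
have [c d] := HS _ Sp; split=> // i x; exact: (d i).1.
Qed.

(** By the Leibniz rule this class is stable under derivatives; a product
    alone would not be. *)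
Inductive alg_smooth : (V -> R) -> Prop :=
 | alg_base f : smoothR f -> alg_smooth f
 | alg_add f g : alg_smooth f -> alg_smooth g -> alg_smooth (f + g)
 | alg_mul f g : alg_smooth f -> alg_smooth g -> alg_smooth (f * g).

Lemma alg_smoothP f : alg_smooth f -> smoothR f.
Proof.
apply: smooth_coind => {}f; elim=> {f}.
- move=> f sf; split; first exact: smooth_cont.
  move=> i; split; first by move=> x; apply: smooth_derivable.
  by apply: alg_base; apply: smooth_derive.
- move=> f g Af [cf df] Ag [cg dg]; split.
    by move=> x; apply: continuousD; [apply: cf|apply: cg].
  move=> i; have [df1 df2] := df i; have [dg1 dg2] := dg i; split.
    by move=> x; apply: derivableD.
  have -> : 'D_'e_i (f + g) = 'D_'e_i f + 'D_'e_i g.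
    by apply/funext => x; rewrite deriveD.
  exact: alg_add.
- move=> f g Af [cf df] Ag [cg dg]; split.
    by move=> x; apply: continuousM; [apply: cf|apply: cg].
  move=> i; have [df1 df2] := df i; have [dg1 dg2] := dg i; split.
    by move=> x; apply: derivableM.
  have -> : 'D_'e_i (f * g) = f * 'D_'e_i g + g * 'D_'e_i f.
    by apply/funext => x; rewrite deriveM.
  by apply: alg_add; apply: alg_mul.
Qed.

Lemma smoothD f g : smoothR f -> smoothR g -> smoothR (f + g).
Proof. by move=> sf sg; apply/alg_smoothP/alg_add; apply: alg_base. Qed.

Lemma smoothM f g : smoothR f -> smoothR g -> smoothR (f * g).
Proof. by move=> sf sg; apply/alg_smoothP/alg_mul; apply: alg_base. Qed.

Lemma smooth_cst c : smoothR (cst c : V -> R).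
Proof.
apply: (@smooth_coind [set g | exists c : R, g = cst c]); last by exists c.
move=> _ [{}c ->]; split; first by move=> x; apply: cst_continuous.
move=> i; split; first by move=> x; apply: derivable_cst.
by exists 0; apply/funext => x; rewrite derive_cst.
Qed.

Definition coordf j : V -> R := fun x => x 0 j.

Lemma line_coord x i j (r : R) : (x + r *: 'e_i) 0 j = x 0 j + r * (i == j)%:R.
Proof. by rewrite !mxE eqxx eq_sym. Qed.

Lemma scaler1E (a : R) : a *: (1 : R) = a. Proof. exact: mulr1. Qed.

Lemma is_derive_coord i j x : is_derive x 'e_i (coordf j) (i == j)%:R.
Proof.
have H : is_derive (0:R) 1 (fun r : R => coordf j (x + r *: 'e_i)) (i == j)%:R.
  have -> : (fun r : R => coordf j (x + r *: 'e_i))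
      = (cst (x 0 j) + (i == j)%:R *: id).
    by apply/funext => r; rewrite /coordf line_coord /= mulrC.
  split.
      by apply: derivableD; [apply: derivable_cst|apply: derivableZ; apply: derivable_id].
    by rewrite deriveD ?deriveZ ?derive_cst ?derive_id ?add0r ?scaler1E//.
case: H => H1 H2; split.
  by move/derivable_line : H1; rewrite scale0r addr0.
by move: H2; rewrite derive_line scale0r addr0.
Qed.

Lemma smooth_coord j : smoothR (coordf j).
Proof.
apply: (@smooth_coind [set g | g = coordf j \/ exists c : R, g = cst c]); last by left.
move=> _ [->|[c ->]]; split.
- by move=> x; apply: coord_continuous.
- move=> i; split; first by move=> x; have [] := is_derive_coord i j x.
  right; exists (i == j)%:R; apply/funext => x.
  by have [] := is_derive_coord i j x.
- by move=> x; apply: cst_continuous.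
- move=> i; split; first by move=> x; apply: derivable_cst.
  by right; exists 0; apply/funext => x; rewrite derive_cst.
Qed.

Lemma partialD f g s : smoothR f -> smoothR g ->
  partial (f + g) s = partial f s + partial g s.
Proof.
move=> sf sg; elim: s => //= i s ->; apply/funext => x.
by rewrite deriveD//; [apply: (sf s).2|apply: (sg s).2].
Qed.

Lemma partialZ c f s : smoothR f -> partial (c *: f) s = c *: partial f s.
Proof.
move=> sf; elim: s => //= i s ->; apply/funext => x.
by rewrite deriveZ//; apply: (sf s).2.
Qed.

Lemma smoothZ c f : smoothR f -> smoothR (c *: f).
Proof. by move=> sf; apply: (smoothM (smooth_cst c)). Qed.

Lemma partial_cst c s x : partial (cst c : V -> R) s x = if s is [::] then c else 0.
Proof.
case: s => //= i s.
have [k ->] : exists k, partial (cst c : V -> R) s = cst k.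
  elim: s => [|j s [k /= ->]]; first by exists c.
  by exists 0; apply/funext => y; rewrite derive_cst.
by rewrite derive_cst.
Qed.

(** Deleting one occurrence of [j] from a word in every possible way: the
    words of the extra terms of the Leibniz rule for the product by the
    coordinate [j]. *)
Fixpoint rems j s : seq (seq 'I_n) :=
  if s is i :: s' then
    (if i == j then [:: s'] else [::]) ++ [seq i :: t | t <- rems j s']
  else [::].

(** The second derivatives of a coordinate vanish, so only one letter of the
    word can fall on it; the others keep their order. *)
Lemma partial_coordM j f s : smoothR f ->
  partial (coordf j * f) s =
  coordf j * partial f s + \sum_(t <- rems j s) partial f t.
Proof.
move=> sf; elim: s => [|i s IH] /=; first by rewrite big_nil addr0.
rewrite {}IH.
have D1 x : derivable (coordf j * partial f s) x 'e_i.
  apply: derivableM; first by apply: smooth_derivable; apply: smooth_coord.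
  exact: (sf s).2.
have D2 (l : seq (seq 'I_n)) : forall x, derivable (\sum_(t <- l) partial f t) x 'e_i /\
    'D_('e_i) (\sum_(t <- l) partial f t) x = \sum_(t <- l) partial f (i :: t) x.
  move=> x; elim: l => [|t l [IH1 IH2]].
    rewrite !big_nil; split; first exact: derivable_cst.
    by rewrite derive_cst.
  rewrite !big_cons; have dt := (sf t).2 i x; split; first exact: derivableD.
  by rewrite deriveD// IH2.
apply/funext => x; rewrite deriveD//; last exact: (D2 _ x).1.
rewrite (D2 _ x).2 deriveM; last 2 first.
  by apply: smooth_derivable; apply: smooth_coord.
  exact: (sf s).2.
have [_ ->] := is_derive_coord i j x.
rewrite big_cat big_map /= !fctE -addrA; congr (_ + _).
have -> : (\sum_(j0 <- rems j s) 'D_'e_i (partial f j0)) x =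
          \sum_(j0 <- rems j s) 'D_'e_i (partial f j0) x.
  by elim: (rems j s) => [|a l IHl]; rewrite ?big_nil// !big_cons /= fctE IHl.
congr (_ + _).
case: eqP => _; rewrite ?big_nil ?big_seq1; first by rewrite /GRing.scale /= mulr1.
by rewrite scaler0.
Qed.

Lemma partial_eq0_open f (U : set V) s : open U -> (forall x, U x -> f x = 0) ->
  forall x, U x -> partial f s x = 0.
Proof.
move=> oU f0; elim: s => [|i s IH] x Ux /=; first exact: f0.
have -> : 'D_'e_i (partial f s) x = 'D_'e_i (cst 0 : V -> R) x; last by rewrite derive_cst.
apply: near_eq_derive; have : nbhs x U by apply: open_nbhs_nbhs.
by apply: filterS => y /IH.
Qed.

Lemma line_cont (x : V) (e : V) : continuous (fun r : R => x + r *: e).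
Proof.
move=> r; apply: cvgD; first exact: cvg_cst.
by apply: cvgZr_tmp; exact: cvg_id.
Qed.

Lemma mvt_line f i x (a b : R) : smoothR f -> a < b ->
  exists2 c, a < c < b &
   f (x + b *: 'e_i) - f (x + a *: 'e_i) = 'D_('e_i) f (x + c *: 'e_i) * (b - a).
Proof.
move=> sf ab.
have [||c] := @MVT R (fun r => f (x + r *: 'e_i)) (fun r => 'D_('e_i) f (x + r *: 'e_i)) a b ab.
- move=> r _; split.
    by apply/derivable_line; apply: smooth_derivable.
  by rewrite derive_line.
- apply: continuous_subspaceT => r.
  apply: (@continuous_comp _ _ _ (fun r : R => x + r *: 'e_i)); first exact: line_cont.
  exact: smooth_cont.
by rewrite in_itv /= => cab E; exists c.
Qed.

Lemma shift_line_derive f i j (h : R) : smoothR f ->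
  smoothR (fun y => f (y + h *: 'e_j)) /\
  'D_('e_i) (fun y => f (y + h *: 'e_j)) = (fun y => 'D_('e_i) f (y + h *: 'e_j)).
Proof.
have D (g : V -> R) k x :
   (fun r : R => r^-1 *: (((fun y => g (y + h *: 'e_j)) \o shift x) (r *: 'e_k) - g (x + h *: 'e_j))) =
   (fun r : R => r^-1 *: ((g \o shift (x + h *: 'e_j)) (r *: 'e_k) - g (x + h *: 'e_j))).
  by apply/funext => r /=; rewrite addrA.
move=> sf; split; last by apply/funext => x; rewrite /derive D.
apply: (@smooth_coind [set F | exists2 g, smoothR g & F = fun y => g (y + h *: 'e_j)]); last by exists f.
move=> _ [g sg ->]; split.
  move=> x; apply: (@continuous_comp _ _ _ (fun y : V => y + h *: 'e_j)); last exact: smooth_cont.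
  by move: (x); move=> z; apply: (@cvgD R V V (nbhs z) _ id (cst (h *: 'e_j)));
    [exact: cvg_id|exact: cvg_cst].
move=> k; split; first by move=> x; rewrite /derivable D; apply: smooth_derivable.
exists ('D_('e_k) g); first exact: smooth_derive.
by apply/funext => x; rewrite /derive D.
Qed.

End Calculus.

(** * Symmetry of second derivatives *)

Section Calculus2.
Context {R : realType} {n : nat}.
Local Notation V := 'rV[R]_n.
Implicit Types (f g : V -> R) (i j : 'I_n) (s t : seq 'I_n) (x : V).

(** The mean value theorem, first along [i] for the increment along [j], then
    along [j]. *)
Lemma second_difference f i j x (h : R) : smoothR f -> 0 < h ->
  exists2 p : R * R, (0 < p.1 < h) /\ (0 < p.2 < h) &
   f (x + h *: 'e_i + h *: 'e_j) - f (x + h *: 'e_i) - (f (x + h *: 'e_j) - f x)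
   = 'D_('e_j) ('D_('e_i) f) (x + p.1 *: 'e_i + p.2 *: 'e_j) * h * h.
Proof.
move=> sf h0.
have [sF dF] := shift_line_derive i j h sf.
set F := (fun y => f (y + h *: 'e_j)) in sF dF.
have {}dF z : 'D_('e_i) F z = 'D_('e_i) f (z + h *: 'e_j) by exact: (congr1 (fun k => k z) dF).
pose G : V -> R := F + (-1) *: f.
have sG : smoothR G by exact: smoothD sF (smoothZ _ sf).
have ED z : 'D_('e_i) G z = 'D_('e_i) F z - 'D_('e_i) f z.
  have D1 : derivable F z 'e_i := smooth_derivable sF.
  have D2 : derivable f z 'e_i := smooth_derivable sf.
  rewrite /G deriveD; [|exact: D1|by apply: derivableZ; exact: D2].
  rewrite deriveZ; [by rewrite scaleN1r|exact: D2].
have [c ch E] := mvt_line i x sG h0.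
have sDf : smoothR ('D_('e_i) f) by apply: smooth_derive.
have [c' ch' E'] := mvt_line j (x + c *: 'e_i) sDf h0.
exists (c, c') => //=.
have GE z : G z = F z - f z by rewrite /G !fctE scaleN1r.
rewrite !scale0r !addr0 subr0 ED dF !GE /F in E.
move: E'; rewrite scale0r !addr0 subr0 => E'.
rewrite -E' -E; ring.
Qed.

Lemma difference_swap (a b c d A B h : R) : 0 < h ->
  a - b - (c - d) = A * h * h -> a - c - (b - d) = B * h * h -> A = B.
Proof.
move=> h0 E1 E2; have hn : h != 0 by rewrite gt_eqF.
by apply: (mulIf hn); apply: (mulIf hn); rewrite -E1 -E2; ring.
Qed.

Lemma half_close (a b c e : R) : `|a - c| < e / 2 -> `|b - c| < e / 2 -> `|a - b| <= e.
Proof.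
move=> ac bc; rewrite -(subrKA c) (le_trans (ler_normD _ _))//.
by rewrite [X in _ + X]distrC; lra.
Qed.

(** The same second difference is h^2 times either mixed derivative at nearby
    points; let h tend to 0. *)
Lemma clairaut f i j : smoothR f ->
  'D_('e_i) ('D_('e_j) f) = 'D_('e_j) ('D_('e_i) f).
Proof.
move=> sf; apply/funext => x.
have key e : 0 < e -> forall k l, \forall h \near 0^'+, forall p : R * R,
   0 < p.1 < h -> 0 < p.2 < h -> `|'D_('e_l) ('D_('e_k) f) x
     - 'D_('e_l) ('D_('e_k) f) (x + p.1 *: 'e_k + p.2 *: 'e_l)| < e.
  move=> e0 k l.
  have c : continuous ('D_('e_l) ('D_('e_k) f)) by apply: smooth_cont; do 2!apply: smooth_derive.
  have /cvgrPdist_lt/(_ _ e0) := c x.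
  rewrite nearE /= => /nbhs_ballP[d /= d0 Hd].
  near=> h => p /andP[p1 p1h] /andP[p2 p2h].
  apply: Hd; rewrite -ball_normE /= -addrA opprD addrA subrr sub0r normrN.
  rewrite (le_lt_trans (ler_normD _ _))//.
  have ne (m : 'I_n) : `|'e_m : V| <= 1.
    rewrite {1}/Num.norm /= mx_normrE; apply/bigmax_leP; split=> // -[a b] _ /=.
    by rewrite mxE; case: (_ && _); rewrite ?normr1 ?normr0.
  rewrite !normrZ !gtr0_norm//.
  have hd : h < d / 2 by near: h; apply: nbhs_right_lt; rewrite divr_gt0.
  have A1 : p.1 * `|'e_k : V| <= p.1 by rewrite ler_piMr// ltW.
  have A2 : p.2 * `|'e_l : V| <= p.2 by rewrite ler_piMr// ltW.
  lra.
apply/eqP; rewrite -subr_eq0; apply/eqP/normr0_eq0/eqP; rewrite eq_le normr_ge0 andbT.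
apply/ler_addgt0Pl => e e0; rewrite addr0.
have e2 : 0 < e / 2 by rewrite divr_gt0.
have H1 := key _ e2 j i; have H2 := key _ e2 i j.
have [h [h0 [Hh1 Hh2]]] := @filter_ex _ _ (at_right_proper_filter 0) _
  (filterI (nbhs_right_gt (0 : R)) (filterI H1 H2)).
have [p [p1 p2] E1] := second_difference i j x sf h0.
have [q [q1 q2] E2] := second_difference j i x sf h0.
have E : 'D_'e_j ('D_'e_i f) (x + p.1 *: 'e_i + p.2 *: 'e_j) =
     'D_'e_i ('D_'e_j f) (x + q.1 *: 'e_j + q.2 *: 'e_i).
  have xc : x + h *: 'e_j + h *: 'e_i = x + h *: 'e_i + h *: 'e_j by rewrite addrAC.
  rewrite {}xc in E2; move: E1 E2.
  exact: difference_swap h0.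
have Q1 := Hh1 q q1 q2; have Q2 := Hh2 p p1 p2.
rewrite E in Q2.
exact: half_close Q1 Q2.
Unshelve. all: by end_near.
Qed.

End Calculus2.

(** * Uniform approximation by Bernstein operators *)

Section Walk.
Context {R : realType}.
Implicit Types (t c : R) (g : nat -> R).

(** The expectation of [g] at the final position of a [k]-step walk that moves
    up with probability [t]. This is the Bernstein operator; the recursion
    spares the binomial sums. *)
Fixpoint walk k t g : R :=
  if k is k'.+1 then t * walk k' t (fun j => g j.+1) + (1 - t) * walk k' t g
  else g 0%N.

Lemma walkD k t g1 g2 : walk k t (fun j => g1 j + g2 j) = walk k t g1 + walk k t g2.
Proof. by elim: k g1 g2 => //= k IH g1 g2; rewrite !IH; ring. Qed.

Lemma walkZ k t c g : walk k t (fun j => c * g j) = c * walk k t g.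
Proof. by elim: k g => //= k IH g; rewrite !IH; ring. Qed.

Lemma walk_cst k t c : walk k t (fun=> c) = c.
Proof. by elim: k => //= k ->; ring. Qed.

Lemma walk_le k t g1 g2 : 0 <= t <= 1 -> (forall j, (j <= k)%N -> g1 j <= g2 j) ->
  walk k t g1 <= walk k t g2.
Proof.
move=> /andP[t0 t1]; elim: k g1 g2 => [|k IH] g1 g2 H /=; first exact: H.
apply: lerD; apply: ler_wpM2l; rewrite ?subr_ge0//; apply: IH => j jk; apply: H => //.
exact: leqW.
Qed.

Lemma walk_norm k t g : 0 <= t <= 1 -> `|walk k t g| <= walk k t (fun j => `|g j|).
Proof.
move=> t01; rewrite ler_norml; apply/andP; split; last first.
  by apply: walk_le => // j _; exact: ler_norm.
rewrite -mulN1r -walkZ; apply: walk_le => // j _.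
by rewrite mulN1r lerNl -normrN ler_norm.
Qed.

Lemma walk_variance k t c :
  walk k t (fun j => (j%:R - c) ^+ 2) = k%:R * t * (1 - t) + (k%:R * t - c) ^+ 2.
Proof.
elim: k c => [|k IH] c /=; first by ring.
have -> : (fun j : nat => (j.+1%:R - c) ^+ 2) = (fun j => (j%:R - (c - 1)) ^+ 2).
  by apply/funext => j; rewrite -natr1; ring.
by rewrite !IH -natr1; ring.
Qed.

End Walk.

Section Weierstrass.
Context {R : realType} {n : nat}.
Local Notation V := 'rV[R]_n.
Implicit Types (f g : V -> R) (i j : 'I_n) (s t w : seq 'I_n) (x : V) (a b e r : R).

Definition upd x i r : V := x + (r - x 0 i) *: 'e_i.

Lemma updE x i r j : upd x i r 0 j = if i == j then r else x 0 j.
Proof.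
rewrite /upd line_coord; case: eqP => [->|_]; rewrite ?mulr1 ?mulr0 ?addr0//.
by rewrite addrC subrK.
Qed.

Lemma upd_id x i : upd x i (x 0 i) = x.
Proof. by rewrite /upd subrr scale0r addr0. Qed.

Definition cube a : set V := [set x | forall j, `|x 0 j| <= a].

Lemma cube_upd a x i r : cube a x -> `|r| <= a -> cube a (upd x i r).
Proof. by move=> cx ra j; rewrite updE; case: eqP. Qed.

Lemma cube_compact a : compact (cube a).
Proof.
have -> : cube a = [set v : V | forall j, `[- a, a]%classic (v ord0 j)].
  apply/seteqP; split => v /= H j; have := H j; rewrite in_itv /= ler_norml//.
apply: (@rV_compact R n (fun=> `[- a, a]%classic)) => j; exact: segment_compact.
Qed.

(** Uniform continuity on the cube, only for changes of one coordinate, which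
    is all that a one-coordinate Bernstein operator needs. *)
Lemma unif_cont_coord f a e i : continuous f -> 0 < e ->
  exists2 d : R, 0 < d & forall x r, cube a x -> `|r - x 0 i| < d ->
     `|f (upd x i r) - f x| < e.
Proof.
move=> cf e0.
have /compact_near_coveringP/near_covering_withinP := @cube_compact a.
move=> /(_ R (0:R)^'+ (fun d x => forall r, `|r - x 0 i| < d -> `|f (upd x i r) - f x| < e) _).
case.
  move=> x cx.
  have e2 : 0 < e / 2 by rewrite divr_gt0.
  have /cvgrPdist_lt/(_ _ e2) := cf x.
  rewrite nearE /= => /nbhs_ballP[d /= d0 Hd].
  exists (ball x (d / 2), [set h : R | h < d / 2]).
    split => /=; first by apply: nbhsx_ballx; rewrite divr_gt0.
    by apply: nbhs_right_lt; rewrite divr_gt0.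
  move=> [y h] /= [By hd] cy r rh.
  have B1 : ball x d y by apply: le_ball By; lra.
  have B2 : ball x d (upd y i r).
    have := By; rewrite -!ball_normE /ball_ /= => {}By.
    rewrite /upd opprD addrA (le_lt_trans (ler_normB _ _))//.
    have ne (m : 'I_n) : `|'e_m : V| <= 1.
      rewrite {1}/Num.norm /= mx_normrE; apply/bigmax_leP; split=> // -[u v] _ /=.
      by rewrite mxE; case: (_ && _); rewrite ?normr1 ?normr0.
    have : `|(r - y 0 i) *: ('e_i : V)| <= `|r - y 0 i|.
      by rewrite normrZ ler_piMr.
    by move: By rh hd; set A := `|_|; set B := `|_|; set C := `|_|; lra.
  have := Hd _ B1; have := Hd _ B2.
  set A := f x; set B := f _; set C := f y => H1 H2.
  rewrite -(subrKA A) (le_lt_trans (ler_normD _ _))//.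
  by rewrite distrC; lra.
move=> d /= d0 Hd.
exists (d / 2); first by rewrite divr_gt0.
move=> x r cx rd; apply: (Hd (d / 2)) => //=; last by rewrite divr_gt0.
by rewrite sub0r normrN gtr0_norm ?divr_gt0// ltr_pdivrMr// ltr_pMr// ltr1n.
Qed.

Lemma cube_bounded f a : 0 <= a -> continuous f ->
  exists2 M : R, 0 <= M & forall x, cube a x -> `|f x| <= M.
Proof.
move=> a0 cf.
have cnf : {within cube a, continuous (fun x => `|f x|)}.
  apply: continuous_subspaceT => x; apply: (@continuous_comp _ _ _ f); first exact: cf.
  exact: norm_continuous.
have c0 : cube a !=set0 by exists 0 => j; rewrite mxE normr0.
have [c _ H] := EVT_max_rV c0 (@cube_compact a) cnf.
exists `|f c| => // x cx; apply: H; exact/mem_set.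
Qed.

(** The Bernstein operator in the coordinate [i] on the interval from -a to a,
    the other coordinates being parameters. *)
Definition bern i a k f : V -> R := fun x =>
  walk k ((x 0 i + a) / (2 * a)) (fun j : nat => f (upd x i (- a + 2 * a * (j%:R / k%:R)))).

Lemma cube_param a x i : 0 < a -> cube a x -> 0 <= (x 0 i + a) / (2 * a) <= 1.
Proof.
move=> a0 /(_ i); rewrite ler_norml => /andP[h1 h2].
rewrite ler_pdivlMr ?ler_pdivrMr ?mulr_gt0//; apply/andP; split; lra.
Qed.

Lemma cube_node a k (j : nat) : 0 < a -> (j <= k.+1)%N ->
  `|- a + 2 * a * (j%:R / k.+1%:R)| <= a.
Proof.
move=> a0 jk; have : 0 <= (j%:R / k.+1%:R : R) <= 1.
  by rewrite divr_ge0//= ler_pdivrMr ?ltr0n// mul1r ler_nat.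
set q := _ / _ => /andP[q0 q1].
have h : 0 <= a * q <= a by rewrite mulr_ge0 ?(ltW a0)//= ler_piMr ?(ltW a0).
by rewrite ler_norml -mulrA; move: h; set z := a * q; lra.
Qed.

(** Bernstein operators do not increase the sup norm on the cube, so errors
    made in previous coordinates are not amplified. *)
Lemma bern_contract i a k f e : 0 < a -> (forall x, cube a x -> `|f x| <= e) ->
  forall x, cube a x -> `|bern i a k.+1 f x| <= e.
Proof.
move=> a0 H x cx; have t01 := cube_param i a0 cx.
rewrite /bern (le_trans (walk_norm _ _ t01))// -[leRHS](walk_cst k.+1 ((x 0 i + a) / (2 * a))).
by apply: walk_le => // j jk; apply: H; apply: cube_upd => //; apply: cube_node.
Qed.

(** Chebyshev's argument: nodes close to the point contribute little by
    uniform continuity, the others have weight O(1/k) by the variance of the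
    walk. *)
Lemma bern_unif i a f e : 0 < a -> 0 < e -> continuous f ->
  exists k, forall x, cube a x -> `|bern i a k.+1 f x - f x| <= e.
Proof.
move=> a0 e0 cf.
have e2 : 0 < e / 2 by rewrite divr_gt0.
have [d d0 Hd] := unif_cont_coord a i cf e2.
have [M M0 HM] := cube_bounded (ltW a0) cf.
(* At a node at distance at least d, the jump 2M is dominated by 2M
   (distance/d)^2, and distances are 2a/k times those of the walk. *)
pose C := 2 * M / d ^+ 2 * (2 * a) ^+ 2.
have C0 : 0 <= C by rewrite !mulr_ge0 ?invr_ge0 ?exprn_ge0 ?mulr_ge0 ?(ltW a0) ?(ltW d0).
pose k := Num.truncn (C / (e / 2)).
have Hk : C / k.+1%:R <= e / 2.
  rewrite ler_pdivrMr ?ltr0n// mulrC -ler_pdivrMr//.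
  by apply: ltW; apply: truncnS_gt.
exists k => x cx; have t01 := cube_param i a0 cx.
set K := k.+1 in Hk *.
have K0 : 0 < (K%:R : R) by rewrite ltr0n.
rewrite /bern; set t := _ / _ in t01 *.
have tE : x 0 i = - a + 2 * a * t by rewrite /t; field; rewrite gt_eqF.
rewrite -[X in `|_ + X|](walk_cst K t) -walkD (le_trans (walk_norm _ _ t01))//.
apply: (@le_trans _ _ (walk K t (fun j : nat => e / 2 + C / K%:R ^+ 2 * (j%:R - K%:R * t) ^+ 2))).
  apply: walk_le => // j jK.
  set r := - a + _.
  have ra : `|r| <= a by apply: cube_node.
  have S0 : 0 <= C / K%:R ^+ 2 * (j%:R - K%:R * t) ^+ 2.
    by rewrite mulr_ge0 ?divr_ge0 ?sqr_ge0.
  have [lt|ge] := ltP `|r - x 0 i| d.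
    by apply: ltW; rewrite (lt_le_trans (Hd x r cx lt))// lerDl.
  have -> : C / K%:R ^+ 2 * (j%:R - K%:R * t) ^+ 2 = 2 * M * ((r - x 0 i) ^+ 2 / d ^+ 2).
    by rewrite /C /r tE; field; rewrite !gt_eqF.
  have h1 : 1 <= (r - x 0 i) ^+ 2 / d ^+ 2.
    rewrite ler_pdivlMr ?exprn_gt0// mul1r -[leRHS]real_normK ?num_real//.
    by rewrite ler_pXn2r ?nnegrE ?(ltW d0).
  have h2 := HM _ cx; have h3 := HM _ (cube_upd i cx ra).
  have h4 : 2 * M <= 2 * M * ((r - x 0 i) ^+ 2 / d ^+ 2) by rewrite ler_peMr// mulr_ge0.
  rewrite (le_trans (ler_normB _ _))//.
  by move: h2 h3 h4 e2; set A := `|_|; set B := `|_|; set D := 2 * M * _; lra.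
rewrite walkD walk_cst walkZ walk_variance subrr expr0n addr0.
have -> : C / K%:R ^+ 2 * (K%:R * t * (1 - t)) = C / K%:R * (t * (1 - t)).
  by field; rewrite gt_eqF.
have tt : t * (1 - t) <= 1 by nra.
have : C / K%:R * (t * (1 - t)) <= C / K%:R by rewrite ler_piMr// divr_ge0// ltW.
by move: Hk; set A := C / _; lra.
Qed.

End Weierstrass.

(** * Polynomial approximation of all derivatives at once *)

Section Poly.
Context {R : realType} {n : nat}.
Local Notation V := 'rV[R]_n.
Implicit Types (f g : V -> R) (i j : 'I_n) (s t w : seq 'I_n) (x : V) (a b e r : R) (S : {set 'I_n}).

(** Polynomials in the coordinates of [S] whose coefficients are arbitrary
    functions of the remaining coordinates. Applying a Bernstein operator in
    [i] adds [i] to [S], so that n of them turn any function into a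
    polynomial. *)
Inductive polyin S : (V -> R) -> Prop :=
 | polyin_base f : (forall i x r, i \in S -> f (upd x i r) = f x) -> polyin S f
 | polyin_add f g : polyin S f -> polyin S g -> polyin S (f + g)
 | polyin_coord j f : j \in S -> polyin S f -> polyin S (coordf j * f).

Lemma scale_mulr c f g : c *: (f * g) = f * (c *: g).
Proof. by apply/funext => x; rewrite !fctE /GRing.scale /= mulrCA. Qed.

Lemma polyinZ S c f : polyin S f -> polyin S (c *: f).
Proof.
elim=> {f} [f H|f g _ fp _ gp|j f jS _ fp].
- by apply: polyin_base => i x r iS; rewrite !fctE H.
- by rewrite scalerDr; apply: polyin_add.
- by rewrite scale_mulr; apply: polyin_coord.
Qed.

Lemma polyin_walk S i a k (g : nat -> V -> R) : i \in S ->
  (forall m, polyin S (g m)) ->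
  polyin S (fun x => walk k ((x 0 i + a) / (2 * a)) (fun m => g m x)).
Proof.
move=> iS; elim: k g => [|k IH] g Hg; first exact: Hg.
pose A x := walk k ((x 0 i + a) / (2 * a)) (fun m => g m.+1 x).
pose B x := walk k ((x 0 i + a) / (2 * a)) (fun m => g m x).
have pA : polyin S A by apply: IH => m; apply: Hg.
have pB : polyin S B by apply: IH.
rewrite (_ : (fun x => _) = (2 * a)^-1 *: (coordf i * (A + (-1) *: B))
     + (a / (2 * a)) *: (A + (-1) *: B) + B).
  do 2?apply: polyin_add => //; apply: polyinZ; first apply: polyin_coord => //.
    by apply: polyin_add => //; apply: polyinZ.
  by apply: polyin_add => //; apply: polyinZ.
apply/funext => x; rewrite /= -/(A x) -/(B x) !fctE /coordf.
by rewrite /GRing.scale /=; ring.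
Qed.

Lemma bern_polyin S i a k f : i \notin S -> polyin S f -> polyin (i |: S) (bern i a k f).
Proof.
move=> iS; elim=> {f} [f H|f g _ fp _ gp|j f jS _ fp].
- apply: (@polyin_walk (i |: S) i a k (fun m x => f (upd x i (- a + 2 * a * (m%:R / k%:R)))));
    first by rewrite setU11.
  move=> m; apply: polyin_base => l x r; rewrite !inE => /orP[/eqP->|lS].
    congr f; apply/rowP => j; rewrite !updE; by case: eqP.
  rewrite -[RHS](H l _ r lS); congr f; apply/rowP => j; rewrite !updE.
  case: eqP => [<-|//]; case: eqP => // il; by rewrite -il lS in iS.
- rewrite (_ : bern i a k (f + g) = bern i a k f + bern i a k g).
    exact: polyin_add.
  by apply/funext => x; rewrite /bern !fctE -walkD.
- rewrite (_ : bern i a k (coordf j * f) = coordf j * bern i a k f).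
    by apply: polyin_coord => //; rewrite setU1r.
  apply/funext => x; rewrite /bern !fctE -walkZ; congr walk; apply/funext => m.
  rewrite /coordf updE; case: eqP => // ij; by rewrite ij jS in iS.
Qed.

(** Products are built one coordinate at a time, which is the shape that the
    induction for antiderivatives follows. *)
Inductive polyfun : (V -> R) -> Prop :=
 | polyfun_cst c : polyfun (cst c)
 | polyfun_add f g : polyfun f -> polyfun g -> polyfun (f + g)
 | polyfun_coord j f : polyfun f -> polyfun (coordf j * f).

Lemma polyinT f : polyin [set: 'I_n] f -> polyfun f.
Proof.
elim=> {f} [f H|f g _ fp _ gp|j f jS _ fp].
- rewrite (_ : f = cst (f 0)); first exact: polyfun_cst.
  apply/funext => x /=.
  have E (l : seq 'I_n) : f (foldr (fun i y => upd y i 0) x l) = f x.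
    by elim: l => //= i l <-; rewrite H ?inE.
  rewrite -(E (enum 'I_n)); congr f; apply/rowP => j; rewrite mxE.
  have : j \in enum 'I_n by rewrite mem_enum.
  elim: (enum _) => //= i l IH; rewrite inE updE eq_sym.
  by case: eqP => //= _ /IH.
- exact: polyfun_add.
- exact: polyfun_coord.
Qed.

Lemma polyfunZ c f : polyfun f -> polyfun (c *: f).
Proof.
elim=> {f} [k|f g _ fp _ gp|j f _ fp].
- exact: (polyfun_cst (c * k)).
- by rewrite scalerDr; apply: polyfun_add.
- by rewrite scale_mulr; apply: polyfun_coord.
Qed.

Lemma polyfun_smooth f : polyfun f -> smoothR f.
Proof.
elim=> {f} [k|f g _ fp _ gp|j f _ fp].
- exact: smooth_cst.
- exact: smoothD.
- exact: (smoothM (smooth_coord _) fp).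
Qed.

Lemma weierstrass f a e : 0 < a -> 0 < e -> continuous f ->
  exists2 P, polyfun P & forall x, cube a x -> `|P x - f x| <= e.
Proof.
move=> a0 e0 cf.
pose N := size (enum 'I_n).
pose e1 := e / N.+1%:R.
have e10 : 0 < e1 by rewrite divr_gt0.
have [P pP HP] : exists2 P, polyin [set i in enum 'I_n] P &
    forall x, cube a x -> `|P x - f x| <= N%:R * e1.
  rewrite /N; elim: (enum 'I_n) (enum_uniq 'I_n) => [_|i l IH /= /andP[il ul]].
    exists f; first by apply: polyin_base => i x r; rewrite inE.
    by move=> x _; rewrite subrr normr0 mul0r.
  have [P pP HP] := IH ul.
  have [k Hk] := bern_unif i a0 e10 cf.
  exists (bern i a k.+1 P).
    rewrite set_cons; apply: bern_polyin => //.
    by rewrite inE.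
  move=> x cx.
  have E : bern i a k.+1 P x - f x = bern i a k.+1 (P - f) x + (bern i a k.+1 f x - f x).
    rewrite [RHS]addrA; congr (_ - _).
    rewrite /bern -walkD; congr walk; apply/funext => m; by rewrite !fctE subrK.
  rewrite E (le_trans (ler_normD _ _))// -natr1 mulrDl mul1r.
  by apply: lerD; [apply: bern_contract|exact: Hk].
exists P; last first.
  move=> x cx; rewrite (le_trans (HP _ cx))// /e1 mulrA ler_pdivrMr ?ltr0n// mulrC.
  by rewrite ler_pM2l// ler_nat.
apply: polyinT; move: pP; congr polyin; apply/setP => i; by rewrite !inE mem_enum.
Qed.

Lemma polyfun_upd f i r : polyfun f -> polyfun (fun x => f (upd x i r)).
Proof.
elim=> {f} [k|f g _ fp _ gp|j f _ fp].
- exact: polyfun_cst.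
- exact: (polyfun_add fp gp).
- case: (eqVneq i j) => [ij|ij].
    rewrite (_ : (fun x => _) = r *: (fun x => f (upd x i r))); first exact: polyfunZ.
    by apply/funext => x; rewrite !fctE /coordf updE ij eqxx.
  rewrite (_ : (fun x => _) = coordf j * (fun x => f (upd x i r))); first exact: polyfun_coord.
  by apply/funext => x; rewrite !fctE /coordf updE (negbTE ij).
Qed.

Lemma derive_coordM i j f x : smoothR f ->
  'D_('e_i) (coordf j * f) x = x 0 j * 'D_('e_i) f x + (i == j)%:R * f x.
Proof.
move=> sf; have := congr1 (@^~ x) (partial_coordM j [:: i] sf).
rewrite /= !fctE => ->; congr (_ + _).
by case: eqP => _; rewrite ?big_nil ?big_seq1 ?mul1r ?mul0r.
Qed.

(** The factor x_i^k is needed for the induction: a factor x_i of [f] is moved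
    into it. *)
Lemma antiderivative i f : polyfun f -> forall k : nat,
  exists2 Q, polyfun Q & forall x, 'D_('e_i) Q x = x 0 i ^+ k * f x.
Proof.
elim=> {f} [c|f g _ fp _ gp|j f _ fp] k.
- have pX m : polyfun (coordf i ^+ m).
    elim: m => [|m IH]; first by rewrite expr0; exact: (polyfun_cst 1).
    by rewrite exprS; apply: polyfun_coord.
  exists ((c / k.+1%:R) *: (coordf i ^+ k.+1)) => [|x]; first exact: polyfunZ.
  have D : derivable (coordf i) x 'e_i := smooth_derivable (@smooth_coord R n i).
  rewrite deriveZ; last by apply: derivableX; exact: D.
  rewrite deriveX; last exact: D.
  have [_ ->] := is_derive_coord i i x.
  by rewrite eqxx /= /coordf /GRing.scale /= mulr1 mulrA divfK ?pnatr_eq0// mulrC.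
- have [P pP HP] := fp k; have [Q pQ HQ] := gp k.
  exists (P + Q) => [|x]; first exact: polyfun_add.
  have sP := polyfun_smooth pP; have sQ := polyfun_smooth pQ.
  have /(congr1 (@^~ x)) := partialD [:: i] sP sQ; rewrite /= !fctE HP HQ => ->.
  by rewrite mulrDr.
- case: (eqVneq i j) => [<-|ij].
    have [P pP HP] := fp k.+1; exists P => // x.
    by rewrite HP !fctE /coordf exprSr mulrA.
  have [P pP HP] := fp k; exists (coordf j * P) => [|x]; first exact: polyfun_coord.
  rewrite derive_coordM ?HP ?(negbTE ij); last exact: polyfun_smooth.
  by rewrite mul0r addr0 !fctE mulrCA.
Qed.


(** The value on the hyperplane is a polynomial that does not depend on x_i;
    subtracting it leaves the derivative unchanged. *)
Lemma antiderivative_vanish i f b : polyfun f ->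
  exists Q, [/\ polyfun Q, 'D_('e_i) Q = f & forall x, x 0 i = b -> Q x = 0].
Proof.
move=> pf; have [Q pQ HQ] := antiderivative i pf 0.
pose Q0 : V -> R := fun x => Q (upd x i b).
have pQ0 : polyfun ((-1) *: Q0) by apply: polyfunZ; apply: polyfun_upd.
exists (Q + (-1) *: Q0); split; first exact: polyfun_add.
  apply/funext => x; rewrite deriveD; last 2 first.
    exact: smooth_derivable (polyfun_smooth pQ).
    exact: smooth_derivable (polyfun_smooth pQ0).
  rewrite HQ expr0 mul1r.
  have -> : 'D_'e_i ((-1) *: Q0) x = 0; last by rewrite addr0.
  have := derive_line ((-1) *: Q0) x 'e_i 0; rewrite scale0r addr0 => <-.
  rewrite (_ : (fun r : R => _) = cst (- Q0 x)); first by rewrite derive_cst.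
  apply/funext => r; rewrite !fctE scaleN1r; congr (- _); rewrite /Q0; congr Q.
  by apply/rowP => j; rewrite !updE line_coord; case: eqP => // _; rewrite mulr0 addr0.
move=> x xb; rewrite !fctE scaleN1r /Q0 -xb upd_id subrr.
by [].
Qed.

Lemma derive_partial i f s : smoothR f ->
  'D_('e_i) (partial f s) = partial ('D_('e_i) f) s.
Proof.
move=> sf; elim: s => //= j s <-.
by rewrite [LHS]clairaut; [|exact: smooth_partial].
Qed.

Lemma partial_rem i f s : smoothR f -> i \in s ->
  partial f s = partial ('D_('e_i) f) (rem i s).
Proof.
move=> sf; elim: s => //= j s IH; rewrite inE eq_sym.
case: (eqVneq j i) => [->|ji] /=; first by rewrite derive_partial.
by move=> /IH ->.
Qed.

(** Derivatives along the other coordinates are computed inside the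
    hyperplane. *)
Lemma partial_eq0_hyperplane i b f s : smoothR f -> i \notin s ->
  (forall x, x 0 i = b -> f x = 0) -> forall x, x 0 i = b -> partial f s x = 0.
Proof.
move=> sf + f0; elim: s => [|j s IH] /=; first by move=> _; exact: f0.
rewrite inE negb_or => /andP[ij /IH {}IH] x xb.
have := derive_line (partial f s) x 'e_j 0; rewrite scale0r addr0 => <-.
rewrite (_ : (fun r : R => _) = cst 0); first by rewrite derive_cst.
apply/funext => r; apply: IH.
by rewrite line_coord eq_sym (negbTE ij) mulr0 addr0.
Qed.

(** Induction on the word [w]. If [P] approximates D_i f, let [Q] be its
    antiderivative vanishing on x_i = -a, where [f] vanishes too. A derivative
    of f - Q that involves [i] is, by symmetry, one of D_i f - P; one that
    does not vanishes for x_i = -a, and the mean value theorem bounds it by 2a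
    times the error on D_i f - P. *)
Lemma polyfun_approx w f a b e : 0 < a -> - a < b -> 0 < e -> smoothR f ->
  (forall x i, x 0 i < b -> f x = 0) ->
  exists2 P, polyfun P & forall s, (forall i, (count_mem i s <= count_mem i w)%N) ->
    forall x, cube a x -> `|partial f s x - partial P s x| <= e.
Proof.
move=> a0 ab; elim: w f e => [|i w IH] f e e0 sf f0.
  have [P pP HP] := weierstrass a0 e0 (smooth_cont sf).
  exists P => // -[|j s] H x cx; first by rewrite distrC HP.
  by have := H j; rewrite /= eqxx.
(* The two bounds e1 and 2a e1 must both stay below e. *)
pose e1 := e / (1 + 2 * a).
have A0 : 0 < 1 + 2 * a by rewrite addr_gt0 ?mulr_gt0.
have e10 : 0 < e1 by rewrite divr_gt0.
have Ee : e = e1 + 2 * a * e1 by rewrite /e1; field; rewrite gt_eqF.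
have [|P pP HP] := IH ('D_('e_i) f) e1 e10 (smooth_derive i sf).
  move=> x j xb.
  apply: (@partial_eq0_open R n f [set x | x 0 j < b] [:: i]) => //.
    have : open (coordf j @^-1` [set r : R | r < b]).
      by apply: open_comp => [z _|]; [apply: coord_continuous|apply: open_lt].
    by [].
  by move=> y /= /f0.
have [Q [pQ DQ Q0]] := antiderivative_vanish i (- a) pP.
exists Q => // s Hs x cx.
have sQ := polyfun_smooth pQ.
case: (boolP (i \in s)) => [si|si].
  rewrite (partial_rem sf si) (partial_rem sQ si) DQ.
  have e1e : e1 <= e by rewrite Ee lerDl -mulrA; move: (mulr_gt0 a0 e10); set z := a * e1; lra.
  apply: le_trans e1e; apply: HP; last exact: cx.
    move=> j; have := Hs j; rewrite /= count_rem si /= leq_subLR.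
  by [].
have Hw : forall j, (count_mem j s <= count_mem j w)%N.
  move=> j; have := Hs j => /=; case: eqP => //= <- _.
  by rewrite (count_memPn si).
pose g : V -> R := f + (-1) *: Q.
have sg : smoothR g by exact: smoothD sf (smoothZ _ sQ).
have gE t y : partial g t y = partial f t y - partial Q t y.
  rewrite /g partialD; [|exact: sf|exact: smoothZ].
  by rewrite partialZ; [rewrite !fctE scaleN1r|exact: sQ].
rewrite -gE.
have g0 : forall y : V, y 0 i = - a -> partial g s y = 0.
  apply: (@partial_eq0_hyperplane i (- a) g s sg si) => y yi.
  by rewrite /g !fctE scaleN1r (Q0 _ yi) (f0 y i) ?yi// subrr.
have := cx i; rewrite ler_norml le_eqVlt eq_sym => /andP[/orP[/eqP xa|xa] xa'].
  by rewrite g0// normr0 ltW.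
have h0 : 0 < x 0 i + a by rewrite -ltrBlDr sub0r.
have [c /andP[c1 c2]] := mvt_line i (upd x i (- a)) (smooth_partial s sg) h0.
have eqb r : upd x i (- a) + r *: 'e_i = upd x i (r - a).
  by rewrite /upd -addrA -scalerDl; congr (x + _ *: _); ring.
rewrite !eqb addrK upd_id sub0r (g0 (upd x i (- a))) ?updE ?eqxx// !subr0 => ->.
have cy : cube a (upd x i (c - a)).
  by apply: cube_upd => //; rewrite ler_norml; apply/andP; split; lra.
have -> : 'D_'e_i (partial g s) (upd x i (c - a)) =
    partial ('D_'e_i f) s (upd x i (c - a)) - partial P s (upd x i (c - a)).
  have /(congr1 (@^~ (upd x i (c - a)))) /= -> := derive_partial i s sg.
  have /(congr1 (@^~ (upd x i (c - a)))) /= <- := derive_partial i s sf.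
  rewrite -DQ.
  have /(congr1 (@^~ (upd x i (c - a)))) /= <- := derive_partial i s sQ.
  have /(congr1 (@^~ (upd x i (c - a)))) /= <- := derive_partial i s sg.
  exact: (gE (i :: s)).
rewrite normrM (gtr0_norm h0) mulrC Ee.
have := HP _ Hw _ cy; set A := `|_| => HA.
apply: (@le_trans _ _ (2 * a * e1)); last by rewrite lerDr ltW.
by apply: ler_pM; [exact: ltW|exact: normr_ge0|lra|exact: HA].
Qed.

End Poly.

(** * Smooth functions of compact support *)

Section Bump.
Context {R : realType}.
Implicit Types (p : {poly R}) (t x : R).

(** For p = 1 the classical function exp(-1/t); with a polynomial factor in
    1/t the family is stable under derivation. *)
Definition flat p t : R := if 0 < t then p.[t^-1] * expR (- t^-1) else 0.

Lemma poly_le_exp p : exists2 C : R, 0 <= C & forall x, 0 < x -> `|p.[x]| <= C * expR x.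
Proof.
exists (\sum_(i < size p) `|p`_i| * i`!%:R).
  by apply: sumr_ge0 => i _; rewrite mulr_ge0.
move=> x x0; rewrite horner_coef (le_trans (ler_norm_sum _ _ _))// mulr_suml.
apply: ler_sum => i _; rewrite normrM -mulrA ler_wpM2l// ger0_norm ?exprn_ge0 ?(ltW x0)//.
case: (i : nat) => [|k].
  rewrite expr0 fact0 mul1r; apply: le_trans (expR_ge1Dx x).
  by rewrite lerDl ltW.
have := expR_ge1Dxn k (ltW x0) => h.
rewrite mulrC -ler_pdivrMr ?ltr0n ?fact_gt0//; apply: le_trans h; by rewrite lerDr.
Qed.

Lemma is_derive_flat_pos p t : 0 < t ->
  is_derive t 1 (fun t : R => p.[t^-1] * expR (- t^-1))
     ((('X^2 * (p - p^`())) : {poly R}).[t^-1] * expR (- t^-1)).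
Proof.
move=> t0; have tn : t != 0 by rewrite gt_eqF.
have dV : is_derive t 1 (fun t : R => t^-1) (- (t ^- 2)).
  have := @is_deriveV R id t 1 1 tn (is_derive_id _ _).
  by rewrite /= scaleNr scaler1E.
have dp : is_derive t 1 (fun t : R => p.[t^-1]) (p^`().[t^-1] * (- (t ^- 2))).
  exact: (@is_derive1_comp R (horner p) (fun t : R => t^-1) t _ _ (is_derive_poly p t^-1) dV).
have dN : is_derive t 1 (fun t : R => - t^-1) (t ^- 2).
  by have := is_deriveN dV; rewrite opprK.
have dE : is_derive t 1 (fun t : R => expR (- t^-1)) (expR (- t^-1) * t ^- 2).
  exact: (@is_derive1_comp R expR (fun t : R => - t^-1) t _ _ (is_derive_expR _) dN).
suff -> : (('X^2 * (p - p^`())) : {poly R}).[t^-1] * expR (- t^-1) =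
    p.[t^-1] *: (expR (- t^-1) * t ^- 2) + expR (- t^-1) *: (p^`().[t^-1] * (- (t ^- 2))).
  exact: (is_deriveM dp dE).
by rewrite /GRing.scale /= hornerM hornerXn hornerD hornerN exprVn; ring.
Qed.

(** At 0 the difference quotient is h (1/h)^2 p(1/h) exp(-1/h), and exp
    dominates polynomials. *)
Lemma is_derive_flat p t : is_derive t 1 (flat p) (flat ('X^2 * (p - p^`())) t).
Proof.
rewrite {2}/flat; case: ltgtP => [t0|t0|<-].
- apply: near_eq_is_derive (is_derive_flat_pos p t0).
  by near=> s; rewrite /flat ifT//; near: s; apply: lt_nbhsr.
- have H0 : is_derive t (1:R) (cst 0 : R -> R) 0 by exact: is_derive_cst.
  apply: near_eq_is_derive H0.
  by near=> s; rewrite /flat ifF//; apply/negbTE; rewrite -leNgt ltW//; near: s; apply: lt_nbhsl.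
- have [C C0 HC] := poly_le_exp ('X^2 * p).
  have cv : h^-1 *: ((flat p \o shift (0:R)) (h *: 1) - flat p 0) @[h --> 0^'] --> (0:R).
    have f0 : flat p 0 = 0 by rewrite /flat ltxx.
    have B (h : R) : h != 0 -> `|h^-1 *: ((flat p \o shift (0:R)) (h *: 1) - flat p 0)| <= C * `|h|.
      move=> hn; rewrite f0 subr0 /= addr0 scaler1E /flat.
      case: ltP => h0; last by rewrite scaler0 normr0 mulr_ge0.
      have hV : 0 < h^-1 by rewrite invr_gt0.
      have := HC _ hV; rewrite hornerM hornerXn => H.
      have -> : h^-1 *: (p.[h^-1] * expR (- h^-1)) = h * (h^-1 ^+ 2 * p.[h^-1]) * expR (- h^-1).
        by rewrite /GRing.scale /=; field.
      rewrite normrM normrM (ger0_norm (expR_ge0 _)) expRN ler_pdivrMr ?expR_gt0//.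
      by rewrite -[leRHS]mulrA [leRHS]mulrCA ler_wpM2l.
    apply/cvgrPdist_le => /= e e0.
    have C1 : 0 < C + 1 by rewrite ltr_wpDl.
    have eC : 0 < e / (C + 1) by rewrite divr_gt0.
    near=> h; rewrite sub0r normrN (le_trans (B h _))//.
      by near: h; exact: nbhs_dnbhs_neq.
    have hd : `|h| < e / (C + 1) by near: h; exact: dnbhs0_lt.
    rewrite ltr_pdivlMr// in hd; apply: le_trans (ltW hd).
    by rewrite mulrC ler_wpM2l// lerDl.
  split; first by apply/cvg_ex; exists 0.
  exact: cvg_lim cv.
Unshelve. all: by end_near.
Qed.


Lemma flat_continuous p : continuous (flat p).
Proof.
move=> t; apply/differentiable_continuous/derivable1_diffP.
by have [] := is_derive_flat p t.
Qed.

Context {n : nat}.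
Local Notation V := 'rV[R]_n.

Lemma smooth_flat (p : {poly R}) (k : 'I_n) (a b : R) :
  smoothR (fun x : V => flat p (a * x 0 k + b)).
Proof.
apply: (@smooth_coind R n [set F | exists q c, F = fun x : V => c * flat q (a * x 0 k + b)]);
  last by exists p, 1; apply/funext => x; rewrite mul1r.
move=> _ [q [c ->]]; split.
  have cA : continuous (fun r : R => a * r + b).
    rewrite (_ : (fun r => _) = horner (a%:P * 'X + b%:P)); first exact: continuous_horner.
    by apply/funext => r; rewrite !hornerE.
  pose G (x : V) := flat q (a * x 0 k + b).
  have cG : continuous G.
    move=> x; apply: (@continuous_comp _ _ _ (fun x : V => x 0 k) (fun r : R => flat q (a * r + b))).
      exact: coord_continuous.
    apply: (@continuous_comp _ _ _ (fun r : R => a * r + b) (flat q)); first exact: cA.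
    exact: flat_continuous.
  move=> x; apply: (continuousM _ (cG x)); exact: cst_continuous.
move=> i.
have D (x : V) : is_derive (0:R) 1 (fun r : R => c * flat q (a * (x + r *: 'e_i) 0 k + b))
    (c * (i == k)%:R * a * flat ('X^2 * (q - q^`())) (a * x 0 k + b)).
  have dA : is_derive (0:R) 1 (fun r : R => a * (x + r *: 'e_i) 0 k + b) (a * (i == k)%:R).
    rewrite (_ : (fun r => _) = horner ((a * (i == k)%:R)%:P * 'X + (a * x 0 k + b)%:P)).
      have := is_derive_poly ((a * (i == k)%:R)%:P * 'X + (a * x 0 k + b)%:P) 0.
      by rewrite derivD derivM !derivC derivX mul0r add0r mulr1 addr0 hornerC.
    apply/funext => r; rewrite line_coord hornerD hornerM hornerX !hornerC.
    by move: ((i == k)%:R) => z; ring.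
  have dq := is_derive_flat q (a * (x + (0:R) *: 'e_i) 0 k + b).
  have dC := @is_derive1_comp R (flat q) _ 0 _ _ dq dA.
  have := @is_deriveZ R R R _ c 0 1 _ dC.
  rewrite scale0r addr0 /GRing.scale /= => H.
  by rewrite (_ : _ * flat _ _ = c * (flat ('X^2 * (q - q^`())) (a * x 0 k + b) * (a * (i == k)%:R)));
    [exact: H|ring].
pose G (x : V) := c * flat q (a * x 0 k + b).
split => [x|].
  have [d1 _] := D x.
  by have := (@derivable_line R n G x 'e_i 0).1 d1; rewrite scale0r addr0.
exists ('X^2 * (q - q^`())), (c * (i == k)%:R * a); apply/funext => x.
have [_ <-] := D x.
by have := @derive_line R n G x 'e_i 0; rewrite scale0r addr0 => <-.
Qed.

Lemma smooth_prod (I : Type) (r : seq I) (F : I -> V -> R) :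
  (forall i, smoothR (F i)) -> smoothR (\prod_(i <- r) F i).
Proof.
move=> sF; elim: r => [|i r IH]; first by rewrite big_nil; apply: (smooth_cst 1).
by rewrite big_cons; apply: smoothM; [exact: sF|exact: IH].
Qed.

(** Two reversed copies of [flat] in each coordinate. *)
Lemma bump (c : V) (e : R) : 0 < e -> exists psi : V -> R,
  [/\ smoothR psi, psi c != 0 & forall x : V, psi x != 0 -> forall k, `|x 0 k - c 0 k| < e].
Proof.
move=> e0.
pose F k (s : R) := fun x : V => flat 1 (s * x 0 k + (e - s * c 0 k)).
have FE k s (x : V) : (F k s x != 0) = (0 < s * (x 0 k - c 0 k) + e).
  rewrite /F /flat hornerC mul1r (_ : s * x 0 k + _ = s * (x 0 k - c 0 k) + e); last by ring.
  by case: ifP => _; rewrite ?eqxx// gt_eqF ?expR_gt0.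
pose psi := \prod_(k <- enum 'I_n) (F k 1 * F k (-1)).
have pE (x : V) : psi x = \prod_(k <- enum 'I_n) (F k 1 x * F k (-1) x).
  rewrite /psi; elim: (enum _) => [|k l IH]; first by rewrite !big_nil.
  by rewrite !big_cons -IH.
exists psi; split.
- by apply: smooth_prod => k; apply: smoothM; apply: smooth_flat.
- rewrite pE; elim: (enum _) => [|k l IH]; first by rewrite big_nil oner_eq0.
  by rewrite big_cons !mulf_neq0// FE subrr mulr0 add0r.
- move=> x; rewrite pE => H k; move: H.
  have : k \in enum 'I_n by rewrite mem_enum.
  elim: (enum _) => // j l IH; rewrite inE big_cons !mulf_eq0 !negb_or.
  move=> kj /andP[/andP[]]; rewrite !FE mul1r mulN1r => h1 h2 /IH {}IH.
  case/orP: kj => [/eqP->|/IH//].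
  by rewrite ltr_norml; apply/andP; split; lra.
Qed.

End Bump.

(** * Complex-valued smooth functions *)

Section ComplexFunctions.
Context {R : realType} {n : nat}.
Local Notation C := R[i].
Local Notation V := 'rV[R]_n.
Local Notation Re := complex.Re.
Local Notation Im := complex.Im.
Local Notation normc := ComplexField.Normc.normc.
Implicit Types (f g : V -> C) (c z w : C) (s t : seq 'I_n) (j : 'I_n) (x : V).

Lemma cReD z w : Re (z + w) = Re z + Re w. Proof. by case: z w => [a b] []. Qed.
Lemma cImD z w : Im (z + w) = Im z + Im w. Proof. by case: z w => [a b] []. Qed.
Lemma cReM z w : Re (z * w) = Re z * Re w - Im z * Im w.
Proof. by case: z w => [a b] []. Qed.
Lemma cImM z w : Im (z * w) = Re z * Im w + Im z * Re w.
Proof. by case: z w => [a b] []. Qed.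
Lemma ccomplexP z w : Re z = Re w -> Im z = Im w -> z = w.
Proof. by case: z w => [a b] [c d] /= -> ->. Qed.
Lemma normcE z : `|z| = (normc z)%:C. Proof. by []. Qed.
Lemma normc_ge0 z : 0 <= normc z. Proof. by have := normr_ge0 z; rewrite normcE lecE => /andP[]. Qed.
Lemma normc_le z : normc z <= `|Re z| + `|Im z|.
Proof.
case: z => a b /=; rewrite -[leRHS]ger0_norm ?addr_ge0// -sqrtr_sqr ler_wsqrtr//.
rewrite sqrrD !real_normK ?num_real// lerD2r lerDl.
by rewrite mulrn_wge0// mulr_ge0.
Qed.
Lemma normc_ltR z (r : R) : (`|z| < r%:C) = (normc z < r).
Proof. by rewrite normcE ltcR. Qed.

Lemma smoothC_cst c : smooth (fun _ : V => c).
Proof. by split; apply: smooth_cst. Qed.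

Lemma Re_addf f g : (fun x => Re (f x + g x)) = (fun x => Re (f x)) + (fun x => Re (g x)).
Proof. by apply/funext => x; rewrite cReD. Qed.
Lemma Im_addf f g : (fun x => Im (f x + g x)) = (fun x => Im (f x)) + (fun x => Im (g x)).
Proof. by apply/funext => x; rewrite cImD. Qed.
Lemma Re_scalef c f : (fun x => Re (c * f x)) =
   Re c *: (fun x => Re (f x)) + (- Im c) *: (fun x => Im (f x)).
Proof. by apply/funext => x; rewrite cReM !fctE /GRing.scale /= mulNr. Qed.
Lemma Im_scalef c f : (fun x => Im (c * f x)) =
   Re c *: (fun x => Im (f x)) + Im c *: (fun x => Re (f x)).
Proof. by apply/funext => x; rewrite cImM !fctE. Qed.
Lemma Re_coordf j f : (fun x => Re ((x 0 j)%:C * f x)) = coordf j * (fun x => Re (f x)).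
Proof. by apply/funext => x; rewrite cReM /= mul0r subr0. Qed.
Lemma Im_coordf j f : (fun x => Im ((x 0 j)%:C * f x)) = coordf j * (fun x => Im (f x)).
Proof. by apply/funext => x; rewrite cImM /= mul0r addr0. Qed.

Lemma smoothC_add f g : smooth f -> smooth g -> smooth (fun x => f x + g x).
Proof.
by move=> [f1 f2] [g1 g2]; split; rewrite ?Re_addf ?Im_addf; apply: smoothD.
Qed.

Lemma smoothC_scale c f : smooth f -> smooth (fun x => c * f x).
Proof.
by move=> [f1 f2]; split; rewrite ?Re_scalef ?Im_scalef; apply: smoothD; apply: smoothZ.
Qed.

Lemma smoothC_coord j f : smooth f -> smooth (fun x => (x 0 j)%:C * f x).
Proof.
move=> [f1 f2]; split; rewrite ?Re_coordf ?Im_coordf.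
  exact: (smoothM (smooth_coord j) f1).
exact: (smoothM (smooth_coord j) f2).
Qed.

Lemma partialC_add f g s x : smooth f -> smooth g ->
  partialC (fun x => f x + g x) s x = partialC f s x + partialC g s x.
Proof.
by move=> [f1 f2] [g1 g2]; rewrite /partialC Re_addf Im_addf !partialD.
Qed.

Lemma partialC_scale c f s x : smooth f ->
  partialC (fun x => c * f x) s x = c * partialC f s x.
Proof.
move=> [f1 f2]; rewrite /partialC Re_scalef Im_scalef.
rewrite !partialD; try exact: smoothZ.
rewrite !partialZ//; apply: ccomplexP; rewrite ?cReM ?cImM /= !fctE //.
by rewrite /GRing.scale /= mulNr.
Qed.

Lemma partialC_coord j f s x : smooth f ->
  partialC (fun x => (x 0 j)%:C * f x) s x =
  (x 0 j)%:C * partialC f s x + \sum_(t <- rems j s) partialC f t x.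
Proof.
move=> [f1 f2]; rewrite /partialC Re_coordf Im_coordf !partial_coordM//.
apply: ccomplexP; rewrite ?cReD ?cImD ?cReM ?cImM /= !mul0r ?subr0 ?addr0 !fctE; congr (_ + _).
  elim: (rems j s) => [|t l IH]; first by rewrite !big_nil.
  by rewrite !big_cons fctE IH cReD.
elim: (rems j s) => [|t l IH]; first by rewrite !big_nil.
by rewrite !big_cons fctE IH cImD.
Qed.

Lemma partialC_cst c s x : partialC (fun _ : V => c) s x = if s is [::] then c else 0.
Proof.
by rewrite /partialC !partial_cst; case: s => //; case: c.
Qed.

End ComplexFunctions.

(** * Compactly supported distributions and density of polynomials *)

Section DistributionCalculus.
Context {R : realType} {n : nat}.
Local Notation C := R[i].
Local Notation V := 'rV[R]_n.
Local Notation Re := complex.Re.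
Local Notation Im := complex.Im.
Local Notation nc := ComplexField.Normc.normc.
Implicit Types (f g : V -> C) (c z w : C) (s t : seq 'I_n) (j : 'I_n) (x : V)
  (u : (V -> C) -> C).

Lemma ncM z w : nc (z * w) = nc z * nc w.
Proof. exact: ComplexField.Normc.normcM. Qed.

Lemma nc0 : nc (0 : C) = 0.
Proof. exact: ComplexField.Normc.normc0. Qed.

Lemma nc_sum_le (T : eqType) (l : seq T) (F : T -> C) (r : R) :
  (forall t : T, t \in l -> nc (F t) <= r) -> nc (\sum_(t <- l) F t) <= (size l)%:R * r.
Proof.
elim: l => [|a l IH] H; first by rewrite big_nil nc0 mul0r.
rewrite big_cons (le_trans (le_normcD _ _))// /= -natr1 mulrDl mul1r addrC.
apply: lerD; last by apply: H; rewrite inE eqxx.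
by apply: IH => t tl; apply: H; rewrite inE tl orbT.
Qed.

Lemma dist_lin u a f g : compact_distribution u -> smooth f -> smooth g ->
  u (fun x => a * f x + g x) = a * u f + u g.
Proof. by move=> [H _]; apply: H. Qed.

Lemma dist0 u : compact_distribution u -> u (fun=> 0) = 0.
Proof.
move=> du; have := dist_lin 1 du (smoothC_cst 0) (smoothC_cst 0).
rewrite (_ : (fun _ => _) = (fun=> 0)); last by apply/funext => x; rewrite mulr0 addr0.
by rewrite mul1r => /eqP; rewrite -subr_eq0 opprD addNKr oppr_eq0 => /eqP.
Qed.

Lemma dist_scale u a f : compact_distribution u -> smooth f ->
  u (fun x => a * f x) = a * u f.
Proof.
move=> du sf; have := dist_lin a du sf (smoothC_cst 0); rewrite dist0// addr0 => <-.
by congr u; apply/funext => x; rewrite addr0.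
Qed.

(** Take the union of the compact sets, the larger order and the smaller
    radius. *)
Lemma dist_comb u1 u2 a : compact_distribution u1 -> compact_distribution u2 ->
  compact_distribution (fun f => a * u1 f + u2 f).
Proof.
move=> [l1 c1] [l2 c2]; split.
  by move=> b f g sf sg; rewrite l1// l2//; ring.
move=> f sf e e0.
have A0 : 0 < nc a + 1 by rewrite ltr_wpDl// normc_ge0.
have e1 : 0 < e / 2 / (nc a + 1) by rewrite !divr_gt0.
have e2 : 0 < e / 2 by rewrite divr_gt0.
have [K1 [N1 [r1 [k1 r10 H1]]]] := c1 f sf _ e1.
have [K2 [N2 [r2 [k2 r20 H2]]]] := c2 f sf _ e2.
exists (K1 `|` K2), (maxn N1 N2), (Num.min r1 r2); split.
- exact: compactU.
- by rewrite lt_min r10.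
move=> g sg Hg; rewrite normc_ltR.
have -> : a * u1 g + u2 g - (a * u1 f + u2 f) = a * (u1 g - u1 f) + (u2 g - u2 f) by ring.
rewrite (le_lt_trans (le_normcD _ _))// ncM.
have h1 : nc (u1 g - u1 f) < e / 2 / (nc a + 1).
  rewrite -normc_ltR; apply: H1 => // s sN x Kx.
  apply: (@lt_le_trans _ _ ((Num.min r1 r2)%:C)); last by rewrite lecR ge_min lexx.
  by apply: Hg; [rewrite leq_max sN|left].
have h2 : nc (u2 g - u2 f) < e / 2.
  rewrite -normc_ltR; apply: H2 => // s sN x Kx.
  apply: (@lt_le_trans _ _ ((Num.min r1 r2)%:C)); last by rewrite lecR ge_min lexx orbT.
  by apply: Hg; [rewrite leq_max sN orbT|right].
have h3 : nc a * nc (u1 g - u1 f) <= e / 2.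
  rewrite ltr_pdivlMr// mulrC in h1; apply: le_trans (ltW h1).
  by rewrite ler_wpM2r ?normc_ge0// lerDl.
by move: h2 h3; set p := nc (u2 g - _); set q := nc a * _; lra.
Qed.

Lemma dist_zero : compact_distribution (fun _ : V -> C => 0).
Proof.
split=> [a f g _ _|f sf e e0]; first by rewrite mulr0 addr0.
exists set0, 0%N, 1; split=> //; first exact: compact0.
by move=> g _ _; rewrite subrr normr0 ltcR.
Qed.

Lemma dist_sum (I : Type) (r : seq I) (F : I -> (V -> C) -> C) :
  (forall i, compact_distribution (F i)) ->
  compact_distribution (fun f => \sum_(i <- r) F i f).
Proof.
move=> dF; elim: r => [|i r IH].
  rewrite (_ : (fun f => _) = fun=> 0); first exact: dist_zero.
  by apply/funext => f; rewrite big_nil.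
rewrite (_ : (fun f => _) = fun f => 1 * F i f + \sum_(i <- r) F i f); first exact: dist_comb.
by apply/funext => f; rewrite big_cons mul1r.
Qed.

Lemma dist_eval c s x : compact_distribution (fun f => c * partialC f s x).
Proof.
split=> [a f g sf sg|f sf e e0].
  rewrite partialC_add; [|exact: smoothC_scale|exact: sg].
  by rewrite partialC_scale; [ring|exact: sf].
have A0 : 0 < nc c + 1 by rewrite ltr_wpDl// normc_ge0.
exists [set x], (size s), (e / (nc c + 1)); split.
- exact: compact_set1.
- by rewrite divr_gt0.
move=> g sg H; rewrite -mulrBr normc_ltR ncM.
have := H s (leqnn _) x erefl; rewrite normc_ltR ltr_pdivlMr// mulrC => h.
by apply: le_lt_trans h; rewrite ler_wpM2r ?normc_ge0// lerDl.
Qed.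

Lemma compact_cube (K : set V) : compact K -> exists2 a, 0 < a & K `<=` cube a.
Proof.
move=> cK; have [M [_ HM]] := compact_bounded cK.
exists (`|M| + 1); first by rewrite ltr_wpDl.
move=> x Kx j; have h : M < `|M| + 1 by rewrite (le_lt_trans (ler_norm _))// ltrDl.
apply: le_trans (HM _ h _ Kx).
have -> : `|x| = mx_norm x by [].
by rewrite mx_normrE; apply: (le_bigmax _ (fun i => `|x i.1 i.2|) (0, j)).
Qed.

Lemma size_rems j s : (size (rems j s) <= size s)%N.
Proof.
elim: s => //= i s IH; rewrite size_cat size_map -add1n.
by apply: leq_add => //; case: ifP.
Qed.

Lemma rems_size j s t : t \in rems j s -> (size t < size s)%N.
Proof.
elim: s t => //= i s IH t; rewrite mem_cat => /orP[|/mapP[t' /IH h ->]] //=.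
by case: ifP; rewrite //= inE => _ /eqP->.
Qed.

(** By the Leibniz rule the derivatives of x_j f up to order N are controlled
    by those of f, with the constant sup |x_j| + N on the compact set. *)
Lemma dist_coord j u : compact_distribution u ->
  compact_distribution (fun f => u (fun x => (x 0 j)%:C * f x)).
Proof.
move=> du; split=> [a f g sf sg|f sf e e0].
  rewrite -dist_lin; [|exact: du|exact: smoothC_coord|exact: smoothC_coord].
  by congr u; apply/funext => x; ring.
have [K [N [r [cK r0 H]]]] := du.2 _ (smoothC_coord j sf) e e0.
have [a a0 Ka] := compact_cube cK.
have A0 : 0 < a + N%:R + 1 by rewrite -addrA addr_gt0// ltr_wpDl.
exists K, N, (r / (a + N%:R + 1)); split => //; first by rewrite divr_gt0.
set r' := r / _ => g sg Hg; apply: H; first exact: smoothC_coord.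
have r'0 : 0 < r' by rewrite divr_gt0.
have rE : r = a * r' + N%:R * r' + r' by rewrite /r'; field; rewrite gt_eqF.
move=> s sN x Kx; rewrite (partialC_coord j s x sg) (partialC_coord j s x sf) normc_ltR.
have -> : (x 0 j)%:C * partialC g s x + \sum_(t <- rems j s) partialC g t x -
    ((x 0 j)%:C * partialC f s x + \sum_(t <- rems j s) partialC f t x) =
    (x 0 j)%:C * (partialC g s x - partialC f s x) +
    \sum_(t <- rems j s) (partialC g t x - partialC f t x).
  by rewrite sumrB; ring.
rewrite (le_lt_trans (le_normcD _ _))// ncM.
have h1 : nc (x 0 j)%:C * nc (partialC g s x - partialC f s x) <= a * r'.
  apply: ler_pM; rewrite ?normc_ge0//.
    by rewrite /= expr0n /= addr0 sqrtr_sqr; apply: Ka.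
  by rewrite ltW// -normc_ltR; apply: Hg.
have h2 : nc (\sum_(t <- rems j s) (partialC g t x - partialC f t x)) <= N%:R * r'.
  apply: (@le_trans _ _ ((size (rems j s))%:R * r')).
    apply: nc_sum_le => t /rems_size ts; rewrite ltW// -normc_ltR; apply: Hg => //.
    by rewrite ltnW// (leq_trans ts).
  by rewrite ler_wpM2r ?(ltW r'0)// ler_nat (leq_trans (size_rems _ _)).
by rewrite rE; move: h1 h2; set p := _ * nc _; set q := nc (\sum_(_ <- _) _); lra.
Qed.

Definition cplx (P Q : V -> R) : V -> C := fun x => P x +i* Q x.

(** By continuity it is enough to approximate [phi] with its derivatives on a
    cube that contains both its support and the compact set of the estimate. *)
Lemma dist_density u : compact_distribution u ->
  (forall P, polyfun P -> u (fun x => (P x)%:C) = 0) ->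
  forall phi, smooth phi -> compact (closure [set x | phi x != 0]) -> u phi = 0.
Proof.
move=> du u0 phi [sR sI] cphi.
have sphi : smooth phi by split.
have sp P : polyfun P -> smooth (fun x : V => (P x)%:C).
  by move=> pP; split; [exact: polyfun_smooth|exact: smooth_cst].
have uPQ P Q : polyfun P -> polyfun Q -> u (cplx P Q) = 0.
  move=> pP pQ; rewrite (_ : cplx P Q = fun x => 'i%C * (Q x)%:C + (P x)%:C).
    by rewrite dist_lin; [rewrite !u0 // mulr0 addr0|exact: du|exact: sp|exact: sp].
  by apply/funext => x; apply: ccomplexP; rewrite ?cReD ?cImD ?cReM ?cImM /=; ring.
apply: ComplexField.Normc.eq0_normc.
apply/eqP; rewrite eq_le normc_ge0 andbT; apply/ler_addgt0Pl => e e0; rewrite addr0 ltW//.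
have [K [N [r [cK r0 H]]]] := du.2 _ sphi e e0.
have [a1 a10 H1] := compact_cube cK.
have [a2 a20 H2] := compact_cube cphi.
pose a := a1 + a2 + 1.
have a0 : 0 < a by rewrite /a !addr_gt0.
have z x i : x 0 i < - a2 -> phi x = 0.
  move=> xi; apply/eqP; apply/negPn/negP => px.
  have /H2/(_ i) : closure [set x | phi x != 0] x by apply: subset_closure.
  by rewrite ler_norml leNgt xi.
have ab : - a < - a2 by rewrite /a; lra.
have r4 : 0 < r / 4 by rewrite divr_gt0.
(* Every word of length at most N uses each letter at most N times. *)
pose w := flatten (nseq N (enum 'I_n)).
have Hw s : (size s <= N)%N -> forall i, (count_mem i s <= count_mem i w)%N.
  move=> sN i; apply: leq_trans (count_size _ _) (leq_trans sN _).
  rewrite /w; elim: (N) => // m IH; rewrite /= count_cat -add1n leq_add//.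
  by rewrite count_uniq_mem ?enum_uniq// mem_enum.
have [|P pP HP] := @polyfun_approx R n w (fun x => Re (phi x)) a (- a2) (r / 4) a0 ab r4 sR.
  by move=> x i /z ->.
have [|Q pQ HQ] := @polyfun_approx R n w (fun x => Im (phi x)) a (- a2) (r / 4) a0 ab r4 sI.
  by move=> x i /z ->.
have sPQ : smooth (cplx P Q) by split; exact: polyfun_smooth.
have : `|u (cplx P Q) - u phi| < e%:C.
  apply: H => // s sN x Kx; rewrite normc_ltR (le_lt_trans (normc_le _))//.
  have cx : cube a x by move=> j; rewrite (le_trans (H1 _ Kx j))// /a; lra.
  have := HP s (Hw _ sN) x cx; have := HQ s (Hw _ sN) x cx.
  rewrite distrC => h1; rewrite distrC => h2.
  move: h1 h2; rewrite /partialC /cplx /=; set p := `|_|; set q := `|_|; lra.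
by rewrite uPQ// sub0r normrN normc_ltR.
Qed.

End DistributionCalculus.

(** * Multiplicative functionals live at real points *)

Section RealCoordinate.
Context {R : realType} {n : nat}.
Local Notation C := R[i].
Local Notation V := 'rV[R]_n.
Local Notation Re := complex.Re.
Local Notation Im := complex.Im.
Local Notation nc := ComplexField.Normc.normc.

Variable (j : 'I_n).

(** The test polynomials; the parameter [b] will be a small imaginary number. *)
Definition linpow (b : C) (m : nat) : V -> C := fun x => (1 + b * (x 0 j)%:C) ^+ m.

Lemma linpowS b m : linpow b m.+1 = fun x : V => b * ((x 0 j)%:C * linpow b m x) + linpow b m x.
Proof. by apply/funext => x; rewrite /linpow exprS; ring. Qed.

Lemma smooth_linpow b m : smooth (linpow b m).
Proof.
elim: m => [|m IH]; first exact: smoothC_cst.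
by rewrite linpowS; apply: smoothC_add; [apply: smoothC_scale; exact: smoothC_coord|exact: IH].
Qed.

Lemma derive_linpow b m i x : partialC (linpow b m) [:: i] x =
  (i == j)%:R * m%:R * b * linpow b m.-1 x.
Proof.
elim: m => [|m IH]; first by rewrite mulr0 !mul0r (partialC_cst (1 : C)).
have sm := smooth_linpow b m.
rewrite linpowS partialC_add; [|by apply: smoothC_scale; apply: smoothC_coord|exact: sm].
rewrite partialC_scale; [|exact: smoothC_coord].
rewrite (partialC_coord _ _ _ sm) IH /= -natr1.
case: (eqVneq i j) => _ /=; rewrite ?big_seq1 ?big_nil; last by rewrite !(mul0r,mulr0,addr0).
rewrite !mul1r (_ : partialC _ [::] x = linpow b m x); last first.
  by apply: ccomplexP.
case: m {sm IH} => [|m] /=; first by rewrite !(mul0r,mulr0,add0r,addr0) mul1r.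
by rewrite linpowS; ring.
Qed.

Lemma partialC_rcons (f : V -> C) s i x :
  partialC f (rcons s i) x = partialC (partialC f [:: i]) s x.
Proof. by rewrite /partialC -cats1 !partial_cat. Qed.

Lemma partialC_linpow_bound b M (A : R) x : 0 <= A ->
  (forall m, (m <= M)%N -> nc (linpow b m x) <= A) ->
  forall s m, (m <= M)%N ->
  nc (partialC (linpow b m) s x) <= (M%:R * nc b) ^+ size s * A.
Proof.
move=> A0 HA; elim/last_ind => [|s i IH] m mM.
  by rewrite expr0 mul1r (_ : partialC _ [::] x = linpow b m x) ?HA//; apply: ccomplexP.
rewrite partialC_rcons (_ : partialC (linpow b m) [:: i] =
   fun y => ((i == j)%:R * m%:R * b) * linpow b m.-1 y); last first.
  by apply/funext => y; rewrite derive_linpow.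
rewrite partialC_scale; [|exact: smooth_linpow].
rewrite ncM size_rcons exprS -[leRHS]mulrA; apply: ler_pM; rewrite ?normc_ge0//.
  rewrite ncM ler_wpM2r ?normc_ge0//.
  have -> : nc ((i == j)%:R * m%:R) = (i == j)%:R * m%:R :> R.
    have h (k : nat) : (k%:R : C) = (k%:R : R)%:C by rewrite rmorph_nat.
    rewrite ncM !h /= !expr0n /= !addr0 !sqrtr_sqr !ger0_norm//.
  by case: eqP => _; rewrite ?mul1r ?mul0r ?ler_nat.
by apply: IH; rewrite (leq_trans (leq_pred _)).
Qed.

Lemma ncX (z : C) m : nc (z ^+ m) = nc z ^+ m.
Proof.
elim: m => [|m IH]; last by rewrite !exprS ncM IH.
by rewrite !expr0 /= expr1n expr0n addr0 sqrtr1.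
Qed.

Lemma bernoulli_le (y : R) m : 0 <= y -> 1 + m%:R * y <= (1 + y) ^+ m.
Proof.
move=> y0; elim: m => [|m IH]; first by rewrite mul0r addr0 expr0.
rewrite exprS -natr1.
have h : (1 + y) * (1 + m%:R * y) <= (1 + y) * (1 + y) ^+ m.
  by rewrite ler_wpM2l// addr_ge0.
apply: le_trans h.
rewrite -subr_ge0 (_ : _ - _ = m%:R * y * y); last by ring.
by rewrite !mulr_ge0.
Qed.

(** Through the term of order N+1 of the exponential series. *)
Lemma exp_beats_poly (y D : R) N : 0 < y ->
  exists k : nat, D * k.+1%:R ^+ N < (1 + y) ^+ k.+1.
Proof.
move=> y0.
have l0 : 0 < ln (1 + y) by rewrite ln_gt0// ltrDl.
set l := ln (1 + y) in l0.
have yl : 1 + y = expR l by rewrite lnK// posrE addr_gt0.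
pose E := D * N.+1`!%:R / l ^+ N.+1.
exists (Num.truncn E).
set k := (Num.truncn E).+1.
have kE : E < k%:R by apply: truncnS_gt.
have k0 : 0 < (k%:R : R) by rewrite ltr0n.
rewrite yl -expRM_natl.
have := @expR_ge1Dxn R (k%:R * l) N; rewrite mulr_ge0 ?(ltW k0) ?(ltW l0)// => /(_ isT).
apply: lt_le_trans.
have f0 : 0 < (N.+1`!%:R : R) by rewrite ltr0n fact_gt0.
have -> : (k%:R * l) ^+ N.+1 / N.+1`!%:R = k%:R ^+ N * (k%:R * l ^+ N.+1 / N.+1`!%:R).
  by rewrite exprMn exprS; ring.
apply: (@le_lt_trans _ _ (k%:R ^+ N * (k%:R * l ^+ N.+1 / N.+1`!%:R))); last by rewrite ltrDr.
rewrite mulrC ler_wpM2l ?exprn_ge0//.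
rewrite ler_pdivlMr// -ler_pdivrMr ?exprn_gt0//.
exact: ltW.
Qed.

(** If xi is not real, choose the sign so that 1 + b xi has modulus at least 1
    + eta/q, where b = -i sg/q and eta = |Im xi|. The power q^2 of it is at
    least (1 + eta)^q, whereas for real x the polynomial (1 + b x)^(q^2) stays
    bounded and its derivatives up to order N are O(q^N). This contradicts
    continuity for large q. *)
Lemma dist_real_point (u : (V -> C) -> C) (xi c : C) : compact_distribution u ->
  (forall m, u (fun x : V => (x 0 j)%:C ^+ m) = xi ^+ m * c) -> c != 0 -> Im xi = 0.
Proof.
move=> du Hu c0; apply/eqP/negPn/negP => eta0.
pose eta := `|Im xi|; pose sg : R := Num.sg (Im xi).
have ep : 0 < eta by rewrite normr_gt0.
have uF b m : u (linpow b m) = (1 + b * xi) ^+ m * c.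
  have sl l m' : smooth (fun x : V => (x 0 j)%:C ^+ l * linpow b m' x).
    elim: l => [|l IH].
      rewrite (_ : (fun x => _) = linpow b m'); first exact: smooth_linpow.
      by apply/funext => x; rewrite expr0 mul1r.
    rewrite (_ : (fun x => _) = (fun x : V => (x 0 j)%:C * ((x 0 j)%:C ^+ l * linpow b m' x))).
      exact: smoothC_coord.
    by apply/funext => x; rewrite exprS mulrA.
  have H l : u (fun x : V => (x 0 j)%:C ^+ l * linpow b m x) = xi ^+ l * (1 + b * xi) ^+ m * c.
    elim: m l => [|m IH] l.
      rewrite expr0 mulr1 -Hu; congr u; apply/funext => x.
      by rewrite /linpow expr0 mulr1.
    rewrite (_ : (fun x => _) = (fun x : V =>
        b * ((x 0 j)%:C ^+ l.+1 * linpow b m x) + (x 0 j)%:C ^+ l * linpow b m x)).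
      rewrite dist_lin; [|exact: du|exact: sl|exact: sl].
      by rewrite !IH !exprS; ring.
    by apply/funext => x; rewrite linpowS !exprS; ring.
  have := H 0%N; rewrite expr0 mul1r => <-; congr u; apply/funext => x.
  by rewrite expr0 mul1r.
have s0 : smooth (fun _ : V => 0 : C) := smoothC_cst 0.
have [K [N [r [cK r0 H]]]] := du.2 _ s0 1 ltr01.
have [a a0 Ka] := compact_cube cK.
pose A := expR (a ^+ 2).
have A1 : 1 <= A by rewrite -[leLHS]addr0; apply: le_trans (expR_ge1Dx _); rewrite lerD2l exprn_ge0 ?ltW.
have A0 : 0 < A by apply: lt_le_trans A1.
have ncc : 0 < nc c.
  rewrite lt_neqAle normc_ge0 andbT eq_sym; apply/negP => /eqP/ComplexField.Normc.eq0_normc.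
  by move/eqP; rewrite (negbTE c0).
have [k Hk] := exp_beats_poly (2 * A / (r * nc c)) N ep.
set q := k.+1 in Hk.
have q0 : 0 < (q%:R : R) by rewrite ltr0n.
pose b : C := 0 +i* (- sg / q%:R).
(* With exponent q^2 the derivative of order s picks up (q^2 |b|)^s = q^s. *)
pose M := (q * q)%N.
have ncb : nc b = q%:R^-1.
  rewrite /b /= expr0n /= add0r sqrtr_sqr normrM normrN normfV [`|q%:R|]gtr0_norm//.
  by rewrite /sg normr_sg eta0 mul1r.
have bound (x : V) m : cube a x -> (m <= M)%N -> nc (linpow b m x) <= A.
  move=> cx mM.
  have nx : nc (1 + b * (x 0 j)%:C) ^+ 2 <= expR (a ^+ 2 / q%:R ^+ 2).
    have -> : nc (1 + b * (x 0 j)%:C) ^+ 2 = 1 + (x 0 j) ^+ 2 / q%:R ^+ 2.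
      rewrite /= sqr_sqrtr ?addr_ge0 ?sqr_ge0//.
      have sg2 : sg ^+ 2 = 1 by rewrite /sg sqr_sg eta0.
      rewrite !mul0r !mulr0 !subr0 !addr0 !add0r.
      by rewrite expr1n exprMn exprMn sqrrN sg2 mul1r mulrC exprVn.
    apply: le_trans (expR_ge1Dx _); rewrite lerD2l ler_wpM2r ?invr_ge0 ?exprn_ge0 ?(ltW q0)//.
    by rewrite -[leLHS]real_normK ?num_real// ler_pXn2r ?nnegrE ?(ltW a0)//; apply: cx.
  rewrite /linpow ncX.
  have h : (nc (1 + b * (x 0 j)%:C) ^+ m) ^+ 2 <= A.
    rewrite exprAC (le_trans (y := expR (a ^+ 2 / q%:R ^+ 2) ^+ m))//.
      by rewrite lerXn2r ?nnegrE ?exprn_ge0 ?expR_ge0 ?normc_ge0.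
    rewrite -expRM_natl /A ler_expR mulrCA ler_piMr ?exprn_ge0 ?(ltW a0)//.
    rewrite ler_pdivrMr ?exprn_gt0// mul1r -natrX ler_nat.
    by rewrite (leq_trans mM).
  set y := nc _ ^+ m in h *.
  have y0 : 0 <= y by rewrite exprn_ge0// normc_ge0.
  by rewrite leNgt; apply/negP => Ay; move: h; rewrite leNgt => /negP; apply; nra.
(* The scaling that brings the test polynomial into the neighbourhood of 0. *)
pose dl := r / (2 * q%:R ^+ N * A).
have dl0 : 0 < dl by rewrite divr_gt0// !mulr_gt0// exprn_gt0.
have : `|u (fun x => dl%:C * linpow b M x) - u (fun=> 0)| < 1%:C.
  apply: H; first exact: smoothC_scale (smooth_linpow _ _).
  move=> s sN x Kx; rewrite partialC_cst.
  have -> : (if s is [::] then 0 else 0 : C) = 0 by case: s {sN}.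
  rewrite subr0 partialC_scale; [|exact: smooth_linpow].
  rewrite normc_ltR ncM.
  have -> : nc dl%:C = dl by rewrite /= expr0n /= addr0 sqrtr_sqr gtr0_norm.
  have := @partialC_linpow_bound b M A x (ltW A0) _ s M (leqnn _).
  move=> /(_ (fun m => @bound x m (Ka _ Kx))) h.
  have Mb : M%:R * nc b = q%:R by rewrite ncb /M natrM mulfK// gt_eqF.
  rewrite Mb in h.
  have h2 : q%:R ^+ size s * A <= q%:R ^+ N * A.
    by rewrite ler_wpM2r ?(ltW A0)// ler_weXn2l// ler1n.
  have h3 := le_trans h h2.
  apply: (@le_lt_trans _ _ (dl * (q%:R ^+ N * A))); first by rewrite ler_wpM2l ?(ltW dl0).
  have -> : dl * (q%:R ^+ N * A) = r / 2.
    by rewrite /dl; field; rewrite !gt_eqF// exprn_gt0.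
  by rewrite ltr_pdivrMr// ltr_pMr// ltr1n.
rewrite dist0// subr0 dist_scale; [|exact: du|exact: smooth_linpow].
rewrite uF normc_ltR !ncM.
have -> : nc dl%:C = dl by rewrite /= expr0n /= addr0 sqrtr_sqr gtr0_norm.
rewrite ncX; apply/negP; rewrite -leNgt.
have low : 1 + eta / q%:R <= nc (1 + b * xi).
  have E : Re (1 + b * xi) = 1 + eta / q%:R.
    rewrite cReD cReM /b /= mul0r sub0r /eta normrEsg.
    by rewrite !mulNr opprK -/sg mulrAC.
  rewrite -E -lecR -normcE; apply: le_trans (normc_ge_Re _); rewrite lecR.
  exact: ler_norm.
have low2 : (1 + eta) ^+ q <= nc (1 + b * xi) ^+ M.
  rewrite /M exprM; apply: lerXn2r; rewrite ?nnegrE ?exprn_ge0 ?normc_ge0 ?addr_ge0 ?(ltW ep)//.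
  have := @bernoulli_le (eta / q%:R) q; rewrite divr_ge0 ?(ltW ep)// => /(_ isT).
  rewrite mulrC divfK ?gt_eqF// => h; apply: le_trans h _.
  by apply: lerXn2r; rewrite ?nnegrE ?normc_ge0 ?addr_ge0 ?divr_ge0 ?(ltW ep).
have low3 := lt_le_trans Hk low2.
rewrite /dl -(ler_pM2r (x := 2 * q%:R ^+ N * A)) ?mul1r; last by rewrite !mulr_gt0// exprn_gt0.
set Z := nc _ ^+ M in low3 *.
have -> : r / (2 * q%:R ^+ N * A) * (Z * nc c) * (2 * q%:R ^+ N * A) = Z * (r * nc c).
  by field; rewrite !gt_eqF// exprn_gt0.
have rc : 0 < r * nc c by rewrite mulr_gt0.
rewrite ltW// -ltr_pdivrMr//; apply: le_lt_trans low3.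
rewrite le_eqVlt; apply/orP; left; apply/eqP; by ring.
Qed.

End RealCoordinate.

(** * Polynomial functionals of a commuting tuple *)

Section MultivariatePolynomials.
Context {n : nat} {C : fieldType}.
Implicit Types (p q : mpoly n C) (k : 'I_n).

Definition mvar k : mpoly n C := mpolyX C (mnm1 k).

Lemma mpoly_var_ind (P : mpoly n C -> Prop) :
  P 1 -> (forall a p q, P p -> P q -> P (a *: p + q)) ->
  (forall k p, P p -> P (mvar k * p)) -> forall p, P p.
Proof.
move=> P1 PD PX.
have P0 : P 0 by rewrite -[0](addNr 1) -scaleN1r; apply: PD.
have PM mu : P (mpolyX C mu).
  rewrite mpolyXE_id; elim: (index_enum _) => [|i l IH]; first by rewrite big_nil.
  rewrite big_cons; elim: (mu i) => [|m IHm]; first by rewrite expr0 mul1r.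
  by rewrite exprS -mulrA; apply: PX.
elim/mpolyind => // c mu p _ _ Pp; exact: PD.
Qed.

(** The linear extension of a function on monomials, in the form that [Lambda]
    has. *)
Definition mono_sum (phi : multinom n -> C) p : C :=
  \sum_(mu <- msupp p) mcoeff mu p * phi mu.

(** A common index list makes linearity visible, since the support of a sum
    can shrink. *)
Lemma mono_sum_widen phi p (r : seq (multinom n)) : uniq r -> {subset msupp p <= r} ->
  mono_sum phi p = \sum_(mu <- r) mcoeff mu p * phi mu.
Proof.
move=> ur sr; rewrite (bigID (mem (msupp p))) /= [X in _ + X]big1 => [|mu]; last first.
  by rewrite -mcoeff_eq0 => /eqP->; rewrite mul0r.
rewrite addr0 -big_filter; apply: perm_big; apply: uniq_perm.
- exact: msupp_uniq.
- by rewrite filter_uniq.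
- move=> mu; rewrite mem_filter; apply/idP/andP => [h|[]//]; split=> //; exact: sr.
Qed.

Lemma mono_sum_linear phi a p q :
  mono_sum phi (a *: p + q) = a * mono_sum phi p + mono_sum phi q.
Proof.
pose r := undup (msupp p ++ msupp q ++ msupp (a *: p + q)).
rewrite !(mono_sum_widen phi (r := r)) ?undup_uniq//; try by move=> mu h;
  rewrite mem_undup !mem_cat h ?orbT.
rewrite mulr_sumr -big_split; apply: eq_bigr => mu _ /=.
by rewrite mcoeffD mcoeffZ; ring.
Qed.

Lemma mono_sumX phi mu : mono_sum phi (mpolyX C mu) = phi mu.
Proof. by rewrite /mono_sum msuppX big_seq1 mcoeffX eqxx mul1r. Qed.

Lemma linear_ext (F G : mpoly n C -> C) :
  (forall a p q, F (a *: p + q) = a * F p + F q) ->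
  (forall a p q, G (a *: p + q) = a * G p + G q) ->
  (forall mu, F (mpolyX C mu) = G (mpolyX C mu)) -> F =1 G.
Proof.
move=> lF lG H; have z (K : mpoly n C -> C) : (forall a p q, K (a *: p + q) = a * K p + K q) -> K 0 = 0.
  by move=> lK; rewrite -[X in K X](addNr 1) -scaleN1r lK; ring.
elim/mpolyind => [|c mu p _ _ IH]; first by rewrite !z.
by rewrite lF lG H IH.
Qed.

Lemma mono_sum_mulX phi k p :
  mono_sum phi (mvar k * p) = mono_sum (fun mu => phi (mnm_add (mnm1 k) mu)) p.
Proof.
move: p; apply: linear_ext => [a p q|a p q|mu].
- by rewrite mulrDr -scalerAr mono_sum_linear.
- exact: mono_sum_linear.
- by rewrite mono_sumX -mono_sumX mpolyXD.
Qed.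

Lemma mono_sum_ext phi psi p : phi =1 psi -> mono_sum phi p = mono_sum psi p.
Proof. by move=> E; apply: eq_bigr => mu _; rewrite E. Qed.

End MultivariatePolynomials.

Section TupleAlgebra.
Context {R : realType} {d m : nat}.
Local Notation C := R[i].
Implicit Types (v w : 'cV[C]_m) (k : 'I_d).
Variable T : 'I_d -> 'M[C]_m.
Hypothesis cT : commuting_tuple T.

Lemma inner_linear a v v' w : inner (a *: v + v') w = a * inner v w + inner v' w.
Proof.
rewrite /inner mulr_sumr -big_split; apply: eq_bigr => i _ /=.
by rewrite !mxE; ring.
Qed.

Lemma inner_semilinear a v w w' : inner v (a *: w + w') = a^* * inner v w + inner v w'.
Proof.
rewrite /inner mulr_sumr -big_split; apply: eq_bigr => i _ /=.
by rewrite !mxE rmorphD rmorphM; ring.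
Qed.

Lemma tuple_pow_comm k (a : 'I_d -> nat) : T k *m tuple_pow T a = tuple_pow T a *m T k.
Proof.
rewrite /tuple_pow; elim: (index_enum _) => [|i l IH].
  by rewrite big_nil -[1]/(1%:M) mulmx1 mul1mx.
rewrite big_cons -[_ * _]/(_ *m _) mulmxA -[RHS]mulmxA -IH !mulmxA; congr (_ *m _).
by have := @commrX _ (T k) (T i) (a i) (cT k i).
Qed.

Lemma tuple_powS k (a : 'I_d -> nat) :
  tuple_pow T (fun i => ((k == i) + a i)%N) = T k *m tuple_pow T a.
Proof.
have H (l : seq 'I_d) : uniq l -> \prod_(i <- l) T i ^+ ((k == i) + a i)%N =
   T k ^+ (k \in l) * \prod_(i <- l) T i ^+ a i.
  elim: l => [_|i l IH /= /andP[il ul]]; first by rewrite !big_nil expr0 mul1r.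
  rewrite !big_cons (IH ul) inE; case: (eqVneq k i) => [ki|ki] /=.
    by rewrite ki (negbTE il) expr1 exprS expr0 mul1r mulrA.
  rewrite add0n !mulrA; congr (_ * _).
  have co : GRing.comm (T i) (T k) by exact: cT.
  by apply: commrX; apply: commr_sym; apply: commrX; apply: commr_sym.
by rewrite /tuple_pow H ?index_enum_uniq// mem_index_enum expr1.
Qed.

(** [Lambda] with two independent vectors: the form that is stable under
    multiplication by variables. *)
Definition Lam v w (p : mpoly (d + d) C) : C :=
  mono_sum (fun mu => inner (tuple_pow T (fun i => fun_of_multinom mu (lshift d i)) *m v)
                            (tuple_pow T (fun i => fun_of_multinom mu (rshift d i)) *m w)) p.

Lemma Lam_linear v w a p q : Lam v w (a *: p + q) = a * Lam v w p + Lam v w q.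
Proof. exact: mono_sum_linear. Qed.

Lemma Lam1 v w : Lam v w 1 = inner v w.
Proof.
rewrite -mpolyX0 /Lam mono_sumX /tuple_pow !big1 ?mul1mx// => i _;
  by rewrite mnm0E expr0.
Qed.

Lemma Lam_linearl a v v' w p : Lam (a *: v + v') w p = a * Lam v w p + Lam v' w p.
Proof.
rewrite /Lam /mono_sum mulr_sumr -big_split; apply: eq_bigr => mu _ /=.
by rewrite mulmxDr -scalemxAr inner_linear; ring.
Qed.

Lemma Lam_semilinear a v w w' p : Lam v (a *: w + w') p = a^* * Lam v w p + Lam v w' p.
Proof.
rewrite /Lam /mono_sum mulr_sumr -big_split; apply: eq_bigr => mu _ /=.
by rewrite mulmxDr -scalemxAr inner_semilinear; ring.
Qed.

Lemma Lam_z k v w p : Lam v w (mvar (lshift d k) * p) = Lam (T k *m v) w p.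
Proof.
rewrite /Lam mono_sum_mulX; apply: mono_sum_ext => mu; congr inner.
  rewrite mulmxA -tuple_pow_comm -tuple_powS; congr (_ *m _); congr (tuple_pow T _).
  by apply/funext => i; rewrite mnmDE mnm1E (inj_eq (@lshift_inj _ _)).
congr (_ *m _); congr (tuple_pow T _).
by apply/funext => i; rewrite mnmDE mnm1E eq_lrshift.
Qed.

Lemma Lam_zbar k v w p : Lam v w (mvar (rshift d k) * p) = Lam v (T k *m w) p.
Proof.
rewrite /Lam mono_sum_mulX; apply: mono_sum_ext => mu; congr inner; last first.
  rewrite mulmxA -tuple_pow_comm -tuple_powS; congr (_ *m _); congr (tuple_pow T _).
  by apply/funext => i; rewrite mnmDE mnm1E (inj_eq (@rshift_inj _ _)).
congr (_ *m _); congr (tuple_pow T _).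
by apply/funext => i; rewrite mnmDE mnm1E eq_rlshift.
Qed.

End TupleAlgebra.

(** * Taylor functionals *)

Section RealCoordinates.
Context {R : realType} {d : nat}.
Local Notation C := R[i].
Local Notation V := 'rV[R]_(d + d).
Implicit Types (p q : mpoly (d + d) C) (x : V) (i : 'I_d) (j : 'I_(d + d)).

Lemma zz_linear a p q x : zzbar_eval (a *: p + q) x = a * zzbar_eval p x + zzbar_eval q x.
Proof. by rewrite /zzbar_eval mevalD mevalZ. Qed.

Lemma zz1 x : zzbar_eval (1 : mpoly (d + d) C) x = 1.
Proof. by rewrite /zzbar_eval meval1. Qed.

Lemma zz_mvar k p x : zzbar_eval (mvar k * p) x =
   match fintype.split k with inl i => toCd x 0 i | inr i => (toCd x 0 i)^* end * zzbar_eval p x.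
Proof. by rewrite /zzbar_eval rmorphM /= mevalXU. Qed.

Lemma conj_complexE (z : C) : z^* = complex.Re z -i* complex.Im z.
Proof. by case: z. Qed.

(** The real and imaginary parts of z_i, as polynomials in z_i and its
    conjugate. *)
Definition xvar j : mpoly (d + d) C :=
  match fintype.split j with
  | inl i => 2^-1 *: (mvar (lshift d i) + mvar (rshift d i))
  | inr i => (- 'i%C / 2) *: (mvar (lshift d i) - mvar (rshift d i))
  end.

Lemma zz_xvar j p x : zzbar_eval (xvar j * p) x = (x 0 j)%:C * zzbar_eval p x.
Proof.
have two : (2 : C) != 0 by rewrite pnatr_eq0.
have E a b k l : zzbar_eval ((a *: (mvar k + b *: mvar l)) * p) x =
    a * (zzbar_eval (mvar k * p) x + b * zzbar_eval (mvar l * p) x).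
  rewrite /zzbar_eval -!scalerAl mevalZ mulrDl mevalD -!scalerAl mevalZ //.
have sl i : fintype.split (lshift d i) = inl i := unsplitK (inl i).
have sr i : fintype.split (rshift d i) = inr i := unsplitK (inr i).
have jE := splitK j; rewrite /xvar; case: (fintype.split j) jE => i /= jE.
  rewrite -[X in _ + X]scale1r E !zz_mvar sl sr conj_complexE mxE -jE /=.
  set z := zzbar_eval p x; apply: (mulfI two); rewrite !mulrA mulfV// mul1r mul1r -mulrDl.
  congr (_ * z); apply: ccomplexP; rewrite ?cReD ?cImD ?cReM ?cImM /=; by ring.
rewrite -[- mvar (rshift d i)]scaleN1r E !zz_mvar sl sr conj_complexE mxE -jE /=.
set z := zzbar_eval p x; apply: (mulfI two).
rewrite mulN1r -mulrBl !mulrA; congr (_ * z).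
rewrite [2 * - _]mulrC mulfK//.
by apply: ccomplexP; rewrite ?cReD ?cImD ?cReM ?cImM /=; ring.
Qed.

Lemma mvar_xvar k : mvar k = match fintype.split k with
   | inl i => 'i%C *: xvar (rshift d i) + xvar (lshift d i)
   | inr i => (- 'i%C) *: xvar (rshift d i) + xvar (lshift d i) end :> mpoly (d + d) C.
Proof.
have two : (2 : C) != 0 by rewrite pnatr_eq0.
have sl i : fintype.split (lshift d i) = inl i := unsplitK (inl i).
have sr i : fintype.split (rshift d i) = inr i := unsplitK (inr i).
have ii : 'i%C * 'i%C = -1 :> C by rewrite -expr2 sqr_i.
have half (z w : mpoly (d + d) C) : 2^-1 *: (z - w) + 2^-1 *: (z + w) = z.
  rewrite -scalerDr addrACA addNr addr0 scalerDr -scalerDl.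
    by rewrite [_ + _](_ : _ = 1) ?scale1r//; field.
have jE := splitK k; case: (fintype.split k) jE => i /= jE; rewrite /xvar sl sr -jE scalerA.
  by rewrite mulrA mulrN ii opprK mul1r half.
rewrite mulrA mulrNN ii mulN1r scaleNr -scalerN opprB [in X in _ + X]addrC.
by rewrite half.
Qed.

(** The real coordinates generate the polynomial ring, since z_i = x_i + i
    y_i. *)
Lemma mpoly_xvar_ind (P : mpoly (d + d) C -> Prop) :
  P 1 -> (forall a p q, P p -> P q -> P (a *: p + q)) ->
  (forall j p, P p -> P (xvar j * p)) -> forall p, P p.
Proof.
move=> P1 PD PX; apply: mpoly_var_ind => // k p Pp.
rewrite mvar_xvar; case: (fintype.split k) => i; rewrite mulrDl -scalerAl; apply: PD; exact: PX.
Qed.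

Lemma smooth_zz p : smooth (@zzbar_eval R d p).
Proof.
elim/mpoly_xvar_ind: p => [|a p q sp sq|j p sp].
- rewrite (_ : zzbar_eval _ = fun=> 1); first exact: smoothC_cst.
  by apply/funext => x; rewrite zz1.
- rewrite (_ : zzbar_eval _ = fun x => a * zzbar_eval p x + zzbar_eval q x).
    by apply: smoothC_add; [exact: smoothC_scale|exact: sq].
  by apply/funext => x; rewrite zz_linear.
- rewrite (_ : zzbar_eval _ = fun x : V => (x 0 j)%:C * zzbar_eval p x); first exact: smoothC_coord.
  by apply/funext => x; rewrite zz_xvar.
Qed.

Lemma polyfun_zz (P : V -> R) : polyfun P -> exists p, forall x, zzbar_eval p x = (P x)%:C.
Proof.
elim=> {P} [c|f g _ [p fp] _ [q gp]|j f _ [p fp]].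
- exists (c%:C *: 1 + 0) => x.
  by rewrite zz_linear zz1 mulr1 /zzbar_eval meval0 addr0.
- exists (1 *: p + q) => x; rewrite zz_linear mul1r fp gp.
  by apply: ccomplexP; rewrite ?cReD ?cImD /= ?addr0.
- exists (xvar j * p) => x; rewrite zz_xvar fp.
  by apply: ccomplexP; rewrite ?cReM ?cImM /= ?(mul0r, mulr0, subr0, addr0).
Qed.

Lemma dist_zz_eq0 u : compact_distribution u -> (forall p, u (zzbar_eval p) = 0) ->
  forall phi : V -> C, smooth phi -> compact (closure [set x | phi x != 0]) -> u phi = 0.
Proof.
move=> du u0; apply: dist_density => // P /polyfun_zz[p Hp].
by rewrite -(u0 p); congr u; apply/funext => x.
Qed.

End RealCoordinates.

Section Words.
Context {n : nat} {C : fieldType}.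
Implicit Types (F G : seq 'I_n -> C) (j : 'I_n).

Fixpoint wsum k F : C :=
  if k is k'.+1 then \sum_(i < n) wsum k' (fun s => F (i :: s)) else F [::].

Lemma wsum_ext k F G : (forall s, size s = k -> F s = G s) -> wsum k F = wsum k G.
Proof.
elim: k F G => [|k IH] F G H /=; first exact: H.
by apply: eq_bigr => i _; apply: IH => s sk; apply: H; rewrite /= sk.
Qed.

Lemma wsumD k F G : wsum k (fun s => F s + G s) = wsum k F + wsum k G.
Proof.
elim: k F G => //= k IH F G; rewrite -big_split; apply: eq_bigr => i _; exact: IH.
Qed.

Lemma wsumZ k c F : wsum k (fun s => c * F s) = c * wsum k F.
Proof.
elim: k F => //= k IH F; rewrite mulr_sumr; apply: eq_bigr => i _; exact: IH.
Qed.

Lemma wsum_eq0 k F : (forall s, size s = k -> F s = 0) -> wsum k F = 0.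
Proof.
move=> H; rewrite (wsum_ext (G := fun s => 0 * F s)) ?wsumZ ?mul0r// => s /H ->.
by rewrite mulr0.
Qed.

(** A word of length k has as many insertions of [j] as positions, namely k +
    1, and [G] does not see the position. This is the factor that turns
    1/(k+1)! into 1/k!. *)
Lemma wsum_rems j k F G : (forall s t, perm_eq s t -> G s = G t) ->
  wsum k.+1 (fun s => G s * \sum_(t <- rems j s) F t) =
  k.+1%:R * wsum k (fun t => G (j :: t) * F t).
Proof.
elim: k F G => [|k IH] F G HG.
  rewrite /= (bigD1 j)//= eqxx big_seq1 big1 ?addr0 ?mul1r// => i ij.
  by rewrite (negbTE ij) big_nil mulr0.
rewrite -[wsum k.+2 _]/(\sum_(i < n) wsum k.+1 (fun s => G (i :: s) * \sum_(t <- rems j (i :: s)) F t)).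
under eq_bigr => i _.
  rewrite (@wsum_ext _ _ (fun s => (i == j)%:R * (G (j :: s) * F s) +
      G (i :: s) * \sum_(t <- rems j s) F (i :: t))); last first.
    move=> s _ /=; rewrite big_cat big_map mulrDr; congr (_ + _).
    by case: eqP => [->|_]; rewrite ?big_seq1 ?big_nil ?mul1r ?mul0r ?mulr0.
  rewrite wsumD wsumZ (IH (fun t => F (i :: t)) (fun t => G (i :: t))); last first.
    by move=> s t st; apply: HG; rewrite perm_cons.
  over.
rewrite big_split /= -mulr_suml -mulr_sumr (bigD1 j)//= eqxx big1 ?addr0; last by move=> i /negbTE->.
rewrite mul1r -[k.+2%:R]natr1 mulrDl mul1r addrC; congr (_ * _ + _).
apply: eq_bigr => i _; apply: wsum_ext => s _; congr (_ * _); apply: HG.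
by rewrite -![_ :: _ :: s]/([:: _] ++ [:: _] ++ s) perm_catCA.
Qed.

End Words.

Section TaylorFunctional.
Context {R : realType} {d : nat}.
Local Notation C := R[i].
Local Notation V := 'rV[R]_(d + d).
Implicit Types (p q : mpoly (d + d) C) (f g : V -> C) (j : 'I_(d + d)) (s t : seq 'I_(d + d)).

Variables (l : mpoly (d + d) C -> C) (x0 : V) (K : nat).

Definition xpow s : mpoly (d + d) C := \prod_(j <- s) (xvar j - (x0 0 j)%:C *: 1).

Hypothesis l_linear : forall a p q, l (a *: p + q) = a * l p + l q.
Hypothesis l_vanish : forall s q, size s = K -> l (q * xpow s) = 0.

(** The functional [l] applied to [q] times the Taylor polynomial of [f] at
    [x0] of degree less than [K], written over words of derivatives. *)
Definition taylor q f : C :=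
  \sum_(k < K) (k`!%:R)^-1 * wsum k (fun s => l (q * xpow s) * partialC f s x0).

Lemma dist_taylor q : compact_distribution (taylor q).
Proof.
apply: dist_sum => k.
have H m (c : seq 'I_(d + d) -> seq 'I_(d + d)) : compact_distribution
    (fun f : V -> C => wsum m (fun s => l (q * xpow (c s)) * partialC f (c s) x0)).
  elim: m c => [|m IH] c; first exact: dist_eval.
  by apply: dist_sum => i; apply: (IH (fun s => c (i :: s))).
rewrite (_ : (fun f => _) = fun f => (k`!%:R)^-1 *
    wsum k (fun s => l (q * xpow s) * partialC f s x0) + 0).
  by apply: dist_comb; [exact: (H k id)|exact: dist_zero].
by apply/funext => f; rewrite addr0.
Qed.

(** Leibniz and [wsum_rems] shift the Taylor sum by one degree; the missing
    top term vanishes because its word has K letters. *)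
Lemma taylor_coord q j f : smooth f ->
  taylor q (fun x => (x 0 j)%:C * f x) = taylor (q * xvar j) f.
Proof.
move=> sf.
pose G s := l (q * xpow s).
have GP s t : perm_eq s t -> G s = G t.
  by move=> st; rewrite /G /xpow (perm_big _ st).
have Gj t : G (j :: t) = l (q * xvar j * xpow t) - (x0 0 j)%:C * G t.
  rewrite /G /xpow big_cons mulrA mulrBr mulrBl -scalerAr mulr1 -scalerAl.
  by rewrite addrC -scaleNr l_linear mulNr addrC.
have E k : wsum k (fun s => l (q * xpow s) * partialC (fun x => (x 0 j)%:C * f x) s x0)
   = (x0 0 j)%:C * wsum k (fun s => G s * partialC f s x0)
     + wsum k (fun s => G s * \sum_(t <- rems j s) partialC f t x0).
  rewrite -wsumZ -wsumD; apply: wsum_ext => s _; rewrite partialC_coord// -/(G s); ring.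
pose B k := (k`!%:R)^-1 * wsum k (fun t => G (j :: t) * partialC f t x0).
have S : \sum_(k < K) (k`!%:R)^-1 * wsum k (fun s => G s * \sum_(t <- rems j s) partialC f t x0)
    = \sum_(k < K) B k.
  case: K l_vanish => [|K' lv]; first by rewrite !big_ord0.
  rewrite big_ord_recl [RHS]big_ord_recr /= big_nil mulr0 mulr0 add0r.
  rewrite [X in _ + X](_ : _ = 0) ?addr0; last first.
    by rewrite /B wsum_eq0 ?mulr0// => s sK; rewrite /G lv ?mul0r//= sK.
  apply: eq_bigr => k _.
  have := @wsum_rems (d + d) C j k (fun t => partialC f t x0) G GP; rewrite /= => ->.
  rewrite /B factS natrM invfM mulrACA mulVf ?mul1r//.
rewrite /taylor; under eq_bigr => k _ do rewrite E mulrDr.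
rewrite big_split /= S -big_split /=; apply: eq_bigr => k _; rewrite /B.
have -> : wsum k (fun t => G (j :: t) * partialC f t x0) =
    wsum k (fun t => l (q * xvar j * xpow t) * partialC f t x0 + (- (x0 0 j)%:C) * (G t * partialC f t x0)).
  by apply: wsum_ext => t _; rewrite Gj; ring.
by rewrite wsumD wsumZ; ring.
Qed.

Lemma taylor1 q : (0 < K)%N -> taylor q (fun=> 1) = l q.
Proof.
rewrite /taylor; case: K => // K' _; rewrite big_ord_recl big1 => [|k _].
  by rewrite addr0 /= fact0 invr1 mul1r (partialC_cst (1 : C)) mulr1 /xpow big_nil mulr1.
rewrite wsum_eq0 ?mulr0// => s; rewrite (partialC_cst (1 : C)).
by case: s => // *; rewrite mulr0.
Qed.

Lemma taylor_zz p : forall q, taylor q (zzbar_eval p) = l (q * p).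
Proof.
have [K0|K0] := posnP K.
  move=> q; have -> : l (q * p) = 0.
    by have := @l_vanish [::] (q * p); rewrite K0 /xpow big_nil mulr1; apply.
  by rewrite /taylor big1// => -[k kK] _; exfalso; move: (kK); rewrite K0.
elim/(@mpoly_xvar_ind R d): p => [|a p p' IHp IHp'|j p IH] q.
- rewrite mulr1 -taylor1//; congr (taylor q); apply/funext => x; exact: zz1.
- rewrite (_ : zzbar_eval _ = fun x => a * zzbar_eval p x + zzbar_eval p' x); last first.
    by apply/funext => x; rewrite zz_linear.
  rewrite (dist_lin a (dist_taylor q) (smooth_zz p) (smooth_zz p')) IHp IHp'.
  by rewrite mulrDr -scalerAr l_linear.
- rewrite (_ : zzbar_eval _ = fun x : V => (x 0 j)%:C * zzbar_eval p x); last first.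
    by apply/funext => x; rewrite zz_xvar.
  by rewrite (taylor_coord q j (smooth_zz p)) IH mulrA.
Qed.

(** A functional that kills the K-th power of the maximal ideal at [x0] is a
    combination of derivatives at [x0], hence extends to smooth functions. *)
Lemma point_distribution : exists u : (V -> C) -> C,
  distribution_extending l u /\
  forall f, (forall s, partialC f s x0 = 0) -> u f = 0.
Proof.
exists (taylor 1); split; first split; first exact: dist_taylor.
  by move=> p; rewrite taylor_zz mul1r.
move=> f f0; rewrite /taylor big1// => k _; rewrite wsum_eq0 ?mulr0// => s _.
by rewrite f0 mulr0.
Qed.

End TaylorFunctional.

(** * Cyclic vectors and localization *)

Lemma linear_form_continuous (K : numFieldType) m (c : 'I_m -> K) :
  continuous (fun y : 'cV[K]_m => \sum_(i < m) y i 0 * c i).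
Proof.
elim: (index_enum _) => [|i l IH].
  rewrite (_ : (fun y => _) = cst 0); first by move=> y; exact: cst_continuous.
  by apply/funext => y; rewrite big_nil.
rewrite (_ : (fun y => _) = (fun y : 'cV[K]_m => y i 0 * c i + \sum_(i <- l) y i 0 * c i)).
  move=> y; apply: (@cvgD K K _ (nbhs y) (nbhs_filter y) (fun y => y i 0 * c i)); last exact: IH.
  apply: (@continuous_comp _ _ _ (fun y : 'cV[K]_m => y i 0) (fun z : K => z * c i)).
    exact: coord_continuous.
  exact: mulrr_continuous.
by apply/funext => y; rewrite big_cons.
Qed.

Section DenseSubspace.
Context {R : realType} {m : nat}.
Local Notation C := R[i].

(** Take linearly independent vectors of [S] in the largest possible number. *)
Lemma subspace_matrix (S : set 'cV[C]_m) : S 0 ->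
  (forall a v w, S v -> S w -> S (a *: v + w)) ->
  exists k (B : 'M[C]_(k, m)), forall x, S x <-> (x^T <= B)%MS.
Proof.
move=> S0 SD.
pose P r := `[< exists k (B : 'M[C]_(k, m)), (forall i, S (row i B)^T) /\ \rank B = r >].
have P0 : exists r, P r.
  by exists 0%N; apply/asboolP; exists 0%N, 0; split=> [[]//|]; rewrite mxrank0.
have Pm r : P r -> (r <= m)%N by move=> /asboolP[k [B [_ <-]]]; exact: rank_leq_col.
case: (ex_maxnP P0 Pm) => r /asboolP[k [B [SB rB]]] rmax.
exists k, B => x; split.
  move=> Sx; have /rmax : P (\rank (col_mx B x^T)).
    apply/asboolP; exists (k + 1)%N, (col_mx B x^T); split=> // i.
    case: (split_ordP i) => j ->; first by rewrite rowKu.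
    by rewrite rowKd ord1 row_id trmxK.
  rewrite -rB => h; have : (B == col_mx B x^T)%MS.
    rewrite -(geq_leqif (mxrank_leqif_eq _)) ?h// -addsmxE; exact: addsmxSl.
  by move=> /andP[_]; rewrite -addsmxE => /(submx_trans (addsmxSr _ _)).
move=> /submxP[D xD]; rewrite -[x]trmxK xD mulmx_sum_row linear_sum /=.
elim/big_ind: _ => // [v w Sv Sw|i _]; first by rewrite -[v]scale1r; apply: SD.
by rewrite linearZ /= -[_ *: _]addr0; apply: SD.
Qed.

(** A proper subspace lies in the kernel of a nonzero linear form, whose
    complement is open and nonempty. *)
Lemma dense_subspace (S : set 'cV[(C : numFieldType)]_m) : S 0 ->
  (forall a v w, S v -> S w -> S (a *: v + w)) -> dense S -> forall x, S x.
Proof.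
move=> S0 SD dS x; apply: contrapT => Sx.
have [k [B HB]] := subspace_matrix S0 SD.
have /existsNP[j /eqP Hj] : ~ forall j, (x^T *m cokermx B) 0 j = 0.
  move=> H; apply: Sx; apply/HB; rewrite submxE; apply/eqP/rowP => j.
  by rewrite H mxE.
pose f (y : 'cV[(C : numFieldType)]_m) : (C : numFieldType) := \sum_(i < m) y i 0 * cokermx B i j.
have fE y : f y = (y^T *m cokermx B) 0 j.
  by rewrite /f [RHS]mxE; apply: eq_bigr => i _; rewrite [X in _ = X * _]mxE.
have cf : continuous f.
  exact: linear_form_continuous.
have oO : open (f @^-1` (~` [set 0])).
  apply: open_comp; first by move=> y _; exact: cf.
  rewrite openC; apply: accessible_closed_set1; apply: hausdorff_accessible.
  exact: norm_hausdorff.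
have [|y [/= fy /HB]] := dS _ _ oO.
  by exists x => /=; rewrite fE; apply/eqP.
rewrite submxE => /eqP y0; apply: fy; by rewrite fE y0 mxE.
Qed.

(** A subspace that contains [h] and is invariant under the tuple contains all
    p(T)h, and is closed. *)
Lemma cyclic_ind d (T : 'I_d -> 'M[C]_m) h (S : set 'cV[C]_m) :
  cyclic_commuting_tuple T h -> S h ->
  (forall a v w, S v -> S w -> S (a *: v + w)) ->
  (forall k v, S v -> S (T k *m v)) -> forall v, S v.
Proof.
move=> [cT dT] Sh SD ST.
have S0 : S 0 by rewrite -(addNr h) -scaleN1r; apply: SD.
apply: dense_subspace => // O O0 oO.
have [v [Ov [p _ pv]]] := dT O O0 oO.
exists v; split=> //; rewrite -pv /tuple_poly mulmx_suml.
elim/big_ind: _ => // [v' w Sv Sw|mu _]; first by rewrite -[v']scale1r; apply: SD.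
rewrite -scalemxAl -[_ *: _]addr0; apply: SD => //.
rewrite /tuple_pow; elim: (index_enum _) => [|i l IH].
  by rewrite big_nil -[1]/(1%:M) mul1mx.
rewrite big_cons -[_ * _]/(_ *m _) -mulmxA.
elim: (fun_of_multinom mu i) => [|q IHq]; first by rewrite expr0 -[1]/(1%:M) mul1mx.
by rewrite exprS -[_ * _]/(_ *m _) -mulmxA; apply: ST.
Qed.

End DenseSubspace.

Section Localization.
Context {R : realType} {d m : nat}.
Local Notation C := R[i].
Local Notation V := 'rV[R]_(d + d).
Variables (T : 'I_d -> 'M[C]_m) (h : 'cV[C]_m).
Hypothesis hT : cyclic_commuting_tuple T h.
Variable u : (V -> C) -> C.
Hypothesis du : distribution_extending (Lambda T h) u.

Lemma vanishes_on_mul (A : set V) (v : (V -> C) -> C) (g : (V -> C) -> V -> C) :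
  vanishes_on v A -> (forall f, smooth f -> smooth (g f)) ->
  (forall f x, f x = 0 -> g f x = 0) -> vanishes_on (fun f => v (g f)) A.
Proof.
move=> vA sg g0 phi sphi cphi phiA.
have sub : closure [set x | g phi x != 0] `<=` closure [set x | phi x != 0].
  by apply: closureS => x /=; apply: contraNN => /eqP/g0/eqP.
apply: vA; first exact: sg.
  by apply: (subclosed_compact _ cphi sub); exact: closed_closure.
exact: subset_trans sub phiA.
Qed.

(** The clause on vanishing transports the support: the distributions obtained
    from [u] vanish wherever [u] does. *)
Definition localized (v w : 'cV[C]_m) := exists u' : (V -> C) -> C,
  distribution_extending (Lam T v w) u' /\
  forall A, vanishes_on u A -> vanishes_on u' A.

Lemma localized_h : localized h h.
Proof. by exists u. Qed.

Lemma localized_comb (a : C) u1 u2 v1 w1 v2 w2 v w :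
  distribution_extending (Lam T v1 w1) u1 -> distribution_extending (Lam T v2 w2) u2 ->
  (forall p, Lam T v w p = a * Lam T v1 w1 p + Lam T v2 w2 p) ->
  (forall A, vanishes_on u A -> vanishes_on u1 A) ->
  (forall A, vanishes_on u A -> vanishes_on u2 A) ->
  localized v w.
Proof.
move=> [d1 e1] [d2 e2] E v1A v2A; exists (fun f => a * u1 f + u2 f); split.
  split; first exact: dist_comb.
  by move=> p; rewrite e1 e2 E.
move=> A vA phi sphi cphi phiA.
by rewrite (v1A A vA) // (v2A A vA)// mulr0 addr0.
Qed.

(** Multiplication by z_k or its conjugate, through its real and imaginary
    parts. *)
Lemma localized_mvar k (L L' : mpoly (d + d) C -> C) u1 :
  distribution_extending L u1 -> (forall A, vanishes_on u A -> vanishes_on u1 A) ->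
  (forall p, L' p = L (mvar k * p)) ->
  exists u', distribution_extending L' u' /\ forall A, vanishes_on u A -> vanishes_on u' A.
Proof.
move=> [d1 e1] v1 E.
have [i [s Hk]] : exists i (s : C), forall p x, zzbar_eval (mvar k * p) x =
   ((x 0 (lshift d i))%:C + s * (x 0 (rshift d i))%:C) * zzbar_eval p x.
  case Ek : (fintype.split k) => [i|i]; exists i.
    exists 'i%C => p x; rewrite zz_mvar Ek mxE; congr (_ * _).
    by apply: ccomplexP; rewrite ?cReD ?cImD ?cReM ?cImM /=; ring.
  exists (- 'i%C) => p x; rewrite zz_mvar Ek conj_complexE mxE; congr (_ * _).
  by apply: ccomplexP; rewrite ?cReD ?cImD ?cReM ?cImM /=; ring.
pose X j (f : V -> C) := fun x : V => (x 0 j)%:C * f x.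
exists (fun f => s * u1 (X (rshift d i) f) + u1 (X (lshift d i) f)); split; first split.
- by apply: dist_comb; exact: dist_coord.
- move=> p; rewrite E -e1 -dist_lin; 
    [|exact: d1|apply: smoothC_coord; exact: smooth_zz|apply: smoothC_coord; exact: smooth_zz].
  by congr u1; apply/funext => x; rewrite Hk /X; ring.
move=> A vA phi sphi cphi phiA.
have vX j : vanishes_on (fun f => u1 (X j f)) A.
  apply: vanishes_on_mul; first exact: v1.
    by move=> f sf; exact: smoothC_coord.
  by move=> f x f0; rewrite /X f0 mulr0.
by rewrite (vX (rshift d i) phi) // (vX (lshift d i) phi) // mulr0 addr0.
Qed.

Lemma localized_all v w : localized v w.
Proof.
have cT := hT.1.
have H : forall v, localized v h.
  apply: (cyclic_ind hT) => [|a v1 v2 [u1 [e1 h1]] [u2 [e2 h2]]|k v1 [u1 [e1 h1]]].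
  - exact: localized_h.
  - by apply: (localized_comb (a := a) e1 e2) => // p; exact: Lam_linearl.
  - by apply: (localized_mvar (k := lshift d k) e1 h1) => p; rewrite Lam_z.
move: w; apply: (cyclic_ind hT) => [|a w1 w2 [u1 [e1 h1]] [u2 [e2 h2]]|k w1 [u1 [e1 h1]]].
- exact: H.
- by apply: (localized_comb (a := a^*) e1 e2) => // p; exact: Lam_semilinear.
- by apply: (localized_mvar (k := rshift d k) e1 h1) => p; rewrite Lam_zbar.
Qed.

End Localization.

(** * Generalized joint eigenvectors *)

Section Orthogonality.
Context {R : realType} {d m : nat}.
Local Notation C := R[i].
Local Notation V := 'rV[R]_(d + d).
Implicit Types (v w : 'cV[C]_m) (i k : 'I_d).
Variable T : 'I_d -> 'M[C]_m.
Hypothesis cT : commuting_tuple T.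

Definition shifted (lam : 'I_d -> C) i : 'M[C]_m := T i - (lam i)%:M.

Lemma mul_shifted lam i v : T i *m v = lam i *: v + shifted lam i *m v.
Proof. by rewrite /shifted mulmxBl mul_scalar_mx addrC subrK. Qed.

Lemma shifted_comm lam i k : T k *m shifted lam i = shifted lam i *m T k.
Proof. by rewrite /shifted mulmxBr mulmxBl cT scalar_mxC. Qed.

Lemma comm_mxX (A B : 'M[C]_m) n : A *m B = B *m A -> A *m (B ^+ n) = (B ^+ n) *m A.
Proof. by move=> AB; have := @commrX _ A B n AB. Qed.

Lemma Lam_eq0 v w p :
  (forall a b, inner (tuple_pow T a *m v) (tuple_pow T b *m w) = 0) -> Lam T v w p = 0.
Proof. by move=> H; rewrite /Lam /mono_sum big1// => mu _; rewrite H mulr0. Qed.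

Lemma inner0l w : inner (0 : 'cV[C]_m) w = 0.
Proof. by rewrite /inner big1// => i _; rewrite mxE mul0r. Qed.

Lemma inner0r v : inner v (0 : 'cV[C]_m) = 0.
Proof. by rewrite /inner big1// => i _; rewrite mxE conjC0 mulr0. Qed.

(** If (T_i - la_i) v and (T_i - mu_i) w do not contribute, then z_i acts as
    la_i and conj(z_i) as conj(mu_i), independently of each other. The real
    coordinates then take complex values. *)
Lemma Lam_xvar j v w (la mu : 'I_d -> C) p :
  let i := match fintype.split j with inl i => i | inr i => i end in
  Lam T (shifted la i *m v) w p = 0 -> Lam T v (shifted mu i *m w) p = 0 ->
  Lam T v w (xvar j * p) =
  match fintype.split j with inl i => 2^-1 * (la i + (mu i)^*)
                    | inr i => - 'i%C / 2 * (la i - (mu i)^*) end * Lam T v w p.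
Proof.
have z : forall k, Lam T (shifted la k *m v) w p = 0 ->
   Lam T v w (mvar (lshift d k) * p) = la k * Lam T v w p.
  by move=> k H; rewrite Lam_z// (mul_shifted la) Lam_linearl H addr0.
have zb : forall k, Lam T v (shifted mu k *m w) p = 0 ->
   Lam T v w (mvar (rshift d k) * p) = (mu k)^* * Lam T v w p.
  by move=> k H; rewrite Lam_zbar// (mul_shifted mu) Lam_semilinear H addr0.
have LZ a p' : Lam T v w (a *: p') = a * Lam T v w p'.
  have := Lam_linear T v w a p' 0; rewrite addr0 => ->.
  have := Lam_linear T v w (-1) 0 0; rewrite scaler0 addr0 mulN1r addNr => ->.
  by rewrite addr0.
rewrite /xvar; case: (fintype.split j) => k /= H1 H2.
  rewrite -scalerAl LZ mulrDl -[mvar (lshift d k) * p]scale1r Lam_linear mul1r (z _ H1) (zb _ H2); ring.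
rewrite -scalerAl LZ mulrBl addrC -[- (mvar _ * p)]scaleN1r Lam_linear (z _ H1) (zb _ H2); ring.
Qed.

(** Double induction on the orders of [v] and [w]: vectors of lower order are
    orthogonal, so [Lam_xvar] applies, and [dist_real_point] forces x = y as
    soon as <v, w> is not 0. *)
Lemma gen_eigen_orthogonal (h : 'cV[C]_m) u :
  cyclic_commuting_tuple T h -> distribution_extending (Lambda T h) u ->
  forall i (x y : C), x != y -> forall a b v w,
  (T i - x%:M) ^+ a *m v = 0 -> (T i - y%:M) ^+ b *m w = 0 -> inner v w = 0.
Proof.
move=> hT du i x y xy.
pose la (_ : 'I_d) := x; pose mu (_ : 'I_d) := y.
rewrite -[_ - x%:M]/(shifted la i) -[_ - y%:M]/(shifted mu i).
have co lm e (g : 'I_d -> nat) (n : nat) v : shifted lm e ^+ n *m v = 0 ->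
    shifted lm e ^+ n *m (tuple_pow T g *m v) = 0.
  move=> H; rewrite mulmxA.
  suff -> : shifted lm e ^+ n *m tuple_pow T g = tuple_pow T g *m shifted lm e ^+ n.
    by rewrite -mulmxA H mulmx0.
  apply/esym/comm_mxX; rewrite /shifted mulmxBl mulmxBr scalar_mxC; congr (_ - _).
  by rewrite tuple_pow_comm.
elim=> [|a IHa]; first by move=> b v w; rewrite expr0 mul1mx => -> _; exact: inner0l.
elim=> [|b IHb] v w; first by rewrite expr0 mul1mx => _ ->; exact: inner0r.
move=> Hv Hw.
have Hv' : shifted la i ^+ a *m (shifted la i *m v) = 0 by move: Hv; rewrite exprSr -[_ * _]/(_ *m _) -mulmxA.
have Hw' : shifted mu i ^+ b *m (shifted mu i *m w) = 0 by move: Hw; rewrite exprSr -[_ * _]/(_ *m _) -mulmxA.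
have L1 p : Lam T (shifted la i *m v) w p = 0.
  by apply: Lam_eq0 => f g; apply: (IHa b.+1); apply: co.
have L2 p : Lam T v (shifted mu i *m w) p = 0.
  by apply: Lam_eq0 => f g; apply: IHb; apply: co.
apply/eqP/negPn/negP => c0.
have [u' [[du' eu'] _]] := localized_all hT du v w.
have key j : match fintype.split j with inl i => i | inr i => i end = i ->
  complex.Im (match fintype.split j with inl i => 2^-1 * (la i + (mu i)^*)
                    | inr i => - 'i%C / 2 * (la i - (mu i)^*) end) = 0.
  move=> ji; set xi := (X in complex.Im X).
  apply: (@dist_real_point R (d + d) j u' xi (inner v w) du' _ c0) => n.
  rewrite (_ : (fun x0 => _) = zzbar_eval (xvar j ^+ n)); last first.
    elim: n => [|n IH]; first by apply/funext => z; rewrite expr0 zz1.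
    apply/funext => z; rewrite !exprS zz_xvar; congr (_ * _).
    exact: (congr1 (fun f => f z) IH).
  rewrite eu'; elim: n => [|n IH]; first by rewrite !expr0 Lam1 mul1r.
  by rewrite !exprS (Lam_xvar (la := la) (mu := mu)) ?ji// IH mulrA.
have := key (lshift d i); have := key (rshift d i).
have sl : fintype.split (lshift d i) = inl i := unsplitK (inl i).
have sr : fintype.split (rshift d i) = inr i := unsplitK (inr i).
rewrite sl sr /la /mu => /(_ erefl) h2 /(_ erefl) h1.
move/negP: xy; apply; apply/eqP.
have two : (2 : C)^-1 = (2^-1 : R)%:C by rewrite -[2%:R](rmorph_nat (real_complex R)) fmorphV.
move: h1 h2; rewrite !conj_complexE two.
case: (x) (y) => [x1 x2] [y1 y2]; rewrite !cImM !cReM ?cImD ?cReD ?cImM ?cReM /= => h1 h2.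
by congr (_ +i* _); lra.
Qed.

Fixpoint shift_word (lam : 'I_d -> C) (a : seq 'I_d) v : 'cV[C]_m :=
  if a is i :: a' then shifted lam i *m shift_word lam a' v else v.

Lemma shift_word_rcons lam a i v :
  shift_word lam (rcons a i) v = shift_word lam a (shifted lam i *m v).
Proof. by elim: a => //= k a ->. Qed.

Lemma shift_word_count lam a i v :
  shift_word lam a v = shift_word lam [seq k <- a | k != i] (shifted lam i ^+ (count_mem i a) *m v).
Proof.
have co k n (x : 'cV[C]_m) :
  shifted lam k *m (shifted lam i ^+ n *m x) = shifted lam i ^+ n *m (shifted lam k *m x).
  rewrite !mulmxA; congr (_ *m _); apply: comm_mxX.
  by rewrite -[shifted lam k]/(T k - (lam k)%:M) mulmxBl [RHS]mulmxBr shifted_comm scalar_mxC.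
have co2 l x : shifted lam i *m shift_word lam l x = shift_word lam l (shifted lam i *m x).
  elim: l => //= k l IH; rewrite -IH.
  by rewrite -[in LHS](expr1 (shifted lam i)) -co expr1.
elim: a => [|k a IH] /=; first by rewrite expr0 mul1mx.
rewrite IH; case: (eqVneq k i) => [->|ki] //=.
by rewrite co2 exprS -[_ * _]/(_ *m _) mulmxA.
Qed.

(** Pigeonhole: in a longer word some letter occurs often enough, and the
    factors commute. *)
Lemma shift_word_eq0 lam (e : 'I_d -> nat) v a :
  (forall i, shifted lam i ^+ e i *m v = 0) -> ((\sum_i e i) < size a)%N ->
  shift_word lam a v = 0.
Proof.
move=> H sa.
have [i ei] : exists i, (e i <= count_mem i a)%N.
  apply: contrapT => /forallNP N; move: sa; apply/negP; rewrite -leqNgt.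
  have -> : size a = (\sum_i count_mem i a)%N.
    elim: a {N} => [|k a IH] /=; first by rewrite big1.
    rewrite big_split /= -IH (bigD1 k)//= eqxx big1 ?addn0// => i ik.
    by rewrite eq_sym (negbTE ik).
  by apply: leq_sum => i _; rewrite ltnW// ltnNge; apply/negP/N.
rewrite (shift_word_count lam a i) -(subnK ei) exprD -[_ * _]/(_ *m _) -mulmxA H mulmx0.
elim: [seq _ <- _ | _] => //= k l ->; by rewrite mulmx0.
Qed.

Definition toR (lam : 'I_d -> C) : V :=
  \row_j match fintype.split j with inl i => complex.Re (lam i) | inr i => complex.Im (lam i) end.

Lemma toCd_toR lam : toCd (toR lam) = \row_i lam i.
Proof.
apply/rowP => i; rewrite !mxE.
have -> : fintype.split (lshift d i) = inl i := unsplitK (inl i).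
have -> : fintype.split (rshift d i) = inr i := unsplitK (inr i).
by case: (lam i).
Qed.

(** Each factor xvar j - x_j is a combination of z_i - lam_i, which moves to
    [v], and of its conjugate, which moves to [w]; so the letters of [s] are
    distributed over both vectors. *)
Lemma Lam_xpow_vanish (lam : 'I_d -> C) s v w q :
  (forall a b, (size a + size b)%N = size s -> shift_word lam a v = 0 \/ shift_word lam b w = 0) ->
  Lam T v w (q * xpow (toR lam) s) = 0.
Proof.
elim: s v w q => [|j s IH] v w q H.
  have [/= ->|/= ->] := H [::] [::] erefl.
    by apply: Lam_eq0 => a b; rewrite mulmx0 inner0l.
  by apply: Lam_eq0 => a b; rewrite mulmx0 inner0r.
rewrite /xpow big_cons mulrCA.
set p := q * _.
pose i := match fintype.split j with inl i => i | inr i => i end.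
have L1 : Lam T (shifted lam i *m v) w p = 0.
  apply: IH => a b ab; rewrite -shift_word_rcons; apply: H.
  by rewrite size_rcons addSn ab.
have L2 : Lam T v (shifted lam i *m w) p = 0.
  apply: IH => a b ab; rewrite -shift_word_rcons; apply: H.
  by rewrite size_rcons addnS ab.
rewrite mulrBl -scalerAl mul1r addrC -scaleNr Lam_linear (Lam_xvar L1 L2).
rewrite addrC -mulrDl; set z := (X in X * _ = _).
suff -> : z = 0 by rewrite mul0r.
rewrite {}/z.
have two : (2 : C) != 0 by rewrite pnatr_eq0.
rewrite /toR mxE; case: (fintype.split j) => k; case: (lam k) => [x y] /=;
  apply/eqP; rewrite subr_eq0 ?conj_complexE /=; apply/eqP; apply: (mulfI two).
  rewrite mulVKf//; by apply: ccomplexP; rewrite ?cReD ?cImD ?cReM ?cImM /=; ring.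
rewrite !mulrA [2 * - _]mulrC mulfK//.
by apply: ccomplexP; rewrite ?cReD ?cImD ?cReM ?cImM /=; ring.
Qed.

(** With twice as many factors as a single vector can survive, one of the two
    vectors is killed. *)
Lemma Lam_point (lam : 'I_d -> C) (e : 'I_d -> nat) v :
  (forall i, shifted lam i ^+ e i *m v = 0) ->
  exists u : (V -> C) -> C, distribution_extending (Lam T v v) u /\
  forall f, (forall s, partialC f s (toR lam) = 0) -> u f = 0.
Proof.
move=> H; pose D := (\sum_i e i)%N.
apply: (@point_distribution R d (Lam T v v) (toR lam) (D.+1 + D.+1)%N).
  exact: Lam_linear.
move=> s q sD; apply: Lam_xpow_vanish => a b; rewrite sD => ab.
have [aD|aD] := ltnP D (size a); first by left; apply: shift_word_eq0 aD.
right; apply: (shift_word_eq0 H); rewrite -/D ltnNge; apply/negP => bD.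
by have := leq_add aD bD; rewrite ab addSn addnS ltnNge leqnSn.
Qed.

End Orthogonality.

(** * Joint spectral projections *)

Section Partition.
Context {C : closedFieldType}.

Lemma bezout_one (p q : {poly C}) : coprimep p q -> exists a b, a * p + b * q = 1.
Proof.
move=> /Bezout_coprimepP[[a b] /= /eqpP[[c1 c2] /= /andP[c10 c20] E]].
exists ((c2^-1 * c1) *: a), ((c2^-1 * c1) *: b).
by rewrite -!scalerAl -scalerDr -scalerA E scalerA mulVf// scale1r.
Qed.

Lemma coprimep_XsubC_prod (x : C) (s : seq C) n k : x \notin s ->
  coprimep (('X - x%:P) ^+ n) (\prod_(y <- s) ('X - y%:P) ^+ k).
Proof.
move=> xs; apply: coprimep_expl; elim: s xs => [|y s IH]; first by rewrite big_nil coprimep1.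
rewrite inE negb_or big_cons => /andP[xy xs]; rewrite coprimepMr IH// andbT.
by apply: coprimep_expr; rewrite coprimep_XsubC root_XsubC eq_sym.
Qed.

(** Polynomials congruent to the idempotents of the Chinese remainder theorem
    modulo the powers of the X - y. *)
Lemma poly_partition (s : seq C) n : uniq s -> exists e : C -> {poly C},
  \prod_(y <- s) ('X - y%:P) ^+ n %| 1 - \sum_(y <- s) e y /\
  forall y, y \in s -> \prod_(y <- s) ('X - y%:P) ^+ n %| ('X - y%:P) ^+ n * e y.
Proof.
elim: s => [_|x s IH /= /andP[xs us]].
  by exists (fun=> 0); rewrite !big_nil dvd1p; split.
have [e [e1 e2]] := IH us.
have [a [b ab]] := bezout_one (coprimep_XsubC_prod n n xs).
set P := \prod_(y <- s) _ in e1 e2 ab *; set X := ('X - x%:P) ^+ n in ab *.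
exists (fun y => if y == x then b * P else a * X * e y); split.
  rewrite !big_cons eqxx -/P -/X.
  have -> : \sum_(y <- s) (if y == x then b * P else a * X * e y) = a * X * \sum_(y <- s) e y.
    rewrite mulr_sumr [LHS]big_seq [RHS]big_seq; apply: eq_bigr => y ys.
    by case: eqP => // yx; rewrite -yx ys in xs.
  have -> : 1 - (b * P + a * X * \sum_(y <- s) e y) = X * (a * (1 - \sum_(y <- s) e y)).
    by rewrite -{1}ab; ring.
  by rewrite dvdp_mul// dvdp_mull.
move=> y; rewrite big_cons -/P -/X inE; case: eqP => [-> _|yx /= ys].
  by rewrite -/X dvdp_mul// dvdp_mull.
rewrite (_ : _ * (a * X * e y) = X * (a * (('X - y%:P) ^+ n * e y))); last by ring.
by rewrite dvdp_mul// dvdp_mull// e2.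
Qed.

Lemma prod_XsubC_dvd (l r : seq C) n : uniq l -> {subset r <= l} -> (size r <= n)%N ->
  \prod_(z <- r) ('X - z%:P) %| \prod_(y <- l) ('X - y%:P) ^+ n.
Proof.
elim: l r => [|y l IH] r.
  by case: r => [|z r] _ sub _; [rewrite !big_nil|have := sub z; rewrite inE eqxx => /(_ isT)].
move=> /= /andP[yl ul] sub sn.
rewrite big_cons (bigID (pred1 y)) /= dvdp_mul//.
  rewrite (eq_bigr (fun=> 'X - y%:P)) => [|z /eqP->//].
  rewrite big_const_seq iter_mulr_1 dvdp_exp2l//.
  by rewrite (leq_trans (count_size _ _)).
rewrite -big_filter; apply: IH => //.
  move=> z; rewrite mem_filter => /andP[zy /sub]; by rewrite inE (negbTE zy).
by rewrite size_filter (leq_trans (count_size _ _)).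
Qed.

(** Collect the eigenvalues of all the matrices; each characteristic
    polynomial divides the product, since multiplicities are at most the size.
    A single list serves the whole tuple. *)
Lemma matrix_annihilator m (s : seq 'M[C]_m.+1) : exists2 l : seq C, uniq l &
  forall A, A \in s -> horner_mx A (\prod_(y <- l) ('X - y%:P) ^+ m.+1) = 0.
Proof.
have rP (A : 'M[C]_m.+1) : {r : seq C | char_poly A = \prod_(z <- r) ('X - z%:P)}.
  have [r] := closed_field_poly_normal (char_poly A).
  by rewrite (monicP (char_poly_monic A)) scale1r; exists r.
pose r A := sval (rP A).
have rE A : char_poly A = \prod_(z <- r A) ('X - z%:P) := svalP (rP A).
exists (undup (flatten [seq r A | A <- s])); first exact: undup_uniq.
move=> A As; apply/eqP.
have sub : {subset r A <= undup (flatten [seq r A | A <- s])}.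
  by move=> z zr; rewrite mem_undup; apply/flatten_mapP; exists A.
have : char_poly A %| \prod_(y <- undup (flatten [seq r A | A <- s])) ('X - y%:P) ^+ m.+1.
  have size_r : (size (r A) <= m.+1)%N.
    by have := size_char_poly A; rewrite rE size_prod_XsubC => -[->].
  by rewrite rE; apply: prod_XsubC_dvd => //; exact: undup_uniq.
by move=> /dvdpP[q ->]; rewrite rmorphM /= Cayley_Hamilton mulr0.
Qed.

(** Expand the product over i of the partitions of unity of the T_i: one term
    for each choice of an eigenvalue for each i. The terms are polynomials in
    the tuple, hence lie in its bicommutant. *)
Lemma commuting_projections d m (T : 'I_d -> 'M[C]_m) : (forall i j, T i *m T j = T j *m T i) ->
  exists (r : nat) (P : 'I_r -> 'M[C]_m) (lam : 'I_r -> 'I_d -> C),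
  [/\ injective lam, \sum_k P k = 1%:M,
      forall k i, (T i - (lam k i)%:M) ^+ m *m P k = 0 &
      forall k A, (forall i, A *m T i = T i *m A) -> A *m P k = P k *m A].
Proof.
case: m T => [|m] T cT.
  exists 0%N, (fun=> 0), (fun=> fun=> 0); split=> [[]//||[]//|[]//].
  by apply/matrixP => -[].
have [l ul Hl] := matrix_annihilator [seq T i | i : 'I_d].
have {}Hl i : horner_mx (T i) (\prod_(y <- l) ('X - y%:P) ^+ m.+1) = 0.
  by apply: Hl; apply/mapP; exists i; rewrite ?mem_enum.
have [e [e1 e2]] := poly_partition m.+1 ul.
pose y_ (j : 'I_(size l)) := l`_j.
pose E i j := horner_mx (T i) (e (y_ j)).
have sE i : \sum_j E i j = 1.
  rewrite -rmorph_sum /=.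
  have -> : \sum_j e (y_ j) = \sum_(y <- l) e y by rewrite (big_nth 0) big_mkord.
  apply/eqP; rewrite -subr_eq0 -oppr_eq0 opprB -(rmorph1 (horner_mx (T i))) -rmorphB /=.
  by move/dvdpP: e1 => [q ->]; rewrite rmorphM /= Hl mulr0.
have nE i j : (T i - (y_ j)%:M) ^+ m.+1 *m E i j = 0.
  have -> : T i - (y_ j)%:M = horner_mx (T i) ('X - (y_ j)%:P).
    by rewrite rmorphB /= horner_mx_X horner_mx_C.
  rewrite -rmorphXn -[_ *m _]/(_ * _) -rmorphM /=.
  by have /dvdpP[q ->] := e2 (y_ j) (mem_nth 0 (ltn_ord j)); rewrite rmorphM /= Hl mulr0.
have cE A : (forall i, A *m T i = T i *m A) -> forall i j, A *m E i j = E i j *m A.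
  by move=> AT i j; apply: comm_mx_horner; exact: AT.
pose I := {ffun 'I_d -> 'I_(size l)}.
pose P (f : I) : 'M[C]_m.+1 := \prod_i E i (f i).
have cP A : (forall i, A *m T i = T i *m A) -> forall f, A *m P f = P f *m A.
  move=> AT f; rewrite /P; elim: (index_enum _) => [|i s IH].
    by rewrite big_nil mulmx1 mul1mx.
  by rewrite big_cons -[_ * _]/(_ *m _) mulmxA cE// -!mulmxA IH.
exists #|I|, (fun k => P (enum_val k)), (fun k i => y_ ((enum_val k : I) i)); split.
- move=> k k' /= kk'; apply: enum_val_inj; apply/ffunP => i.
  have := congr1 (@^~ i) kk' => /= /eqP.
  by rewrite /y_ nth_uniq// => /eqP/val_inj.
- rewrite -(big_enum_val (fun f : I => P f)) /=.
  rewrite (eq_bigl xpredT)//.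
  rewrite /P -(bigA_distr_bigA E) big1// => i _; exact: sE.
- move=> k i; set f := enum_val k; rewrite /P.
  have co : forall j, (T i - (y_ (f i))%:M) ^+ m.+1 *m E j (f j) = E j (f j) *m (T i - (y_ (f i))%:M) ^+ m.+1.
    move=> j; apply: cE => k'; apply: esym; apply: (@commrX _ (T k') (T i - (y_ (f i))%:M)).
    by rewrite /GRing.comm -![_ * _]/(_ *m _) mulmxBl mulmxBr cT scalar_mxC.
  have : i \in index_enum 'I_d by rewrite mem_index_enum.
  elim: (index_enum _) => // j s IH; rewrite inE big_cons -[_ * _]/(_ *m _) mulmxA.
  by case: eqP => [<- _|_ /= /IH {}IH]; [rewrite nE mul0mx|rewrite co -mulmxA IH mulmx0].
- by move=> k A AT; exact: cP.
Qed.

End Partition.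

(** * Orthogonal generalized eigenspaces give Jordan tuples *)

Local Notation "A ^h" := (map_mx Num.conj A^T) (at level 8, format "A ^h").

Section Adjoint.
Context {C : numClosedFieldType}.

Lemma adjM m n p (A : 'M[C]_(m, n)) (B : 'M[C]_(n, p)) : (A *m B)^h = B^h *m A^h.
Proof. by rewrite trmx_mul map_mxM. Qed.

Lemma adjK m n (A : 'M[C]_(m, n)) : (A^h)^h = A.
Proof. by apply/matrixP => i j; rewrite !mxE conjCK. Qed.

Lemma adj_mxcol r (p : 'I_r -> nat) n (B : forall k, 'M[C]_(p k, n)) :
  (\mxcol_k B k)^h = \mxrow_k (B k)^h.
Proof. by apply/matrixP => i j; rewrite !mxE. Qed.

Lemma mxblock_diag r (p : 'I_r -> nat) (B : forall k l, 'M[C]_(p k, p l)) :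
  (forall k l, k != l -> B k l = 0) ->
  \mxblock_(k, l) B k l = \mxdiag_k B k k.
Proof.
move=> B0; rewrite /mxdiag; apply/eq_mxblockP => k l.
by case: eqP => [<-|/eqP /B0->//]; rewrite conform_mx_id.
Qed.

Lemma castmx_unitary_conj s m n (e : s = m) (W : 'M[C]_(n, s)) (A : 'M[C]_n) :
  (castmx (erefl n, e) W)^h *m A *m castmx (erefl n, e) W =
  castmx (e, e) (W^h *m A *m W).
Proof. by case: m / e; rewrite !castmx_id. Qed.

Lemma castmx_unitary s m (e : s = m) (W : 'M[C]_(m, s)) :
  W^h *m W = 1%:M -> castmx (erefl m, e) W \is unitarymx.
Proof.
move=> H; apply/unitarymxP; move: W H; case: m / e => W H.
by rewrite castmx_id; apply: mulmx1C.
Qed.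

End Adjoint.

Section JordanDecomposition.
Context {R : realType} {d m : nat}.
Local Notation C := R[i].
Variable T : 'I_d -> 'M[C]_m.
Hypothesis cT : commuting_tuple T.

Lemma inner_adj (x y : 'cV[C]_m) : inner x y = (y^h *m x) 0 0.
Proof. by rewrite /inner mxE; apply: eq_bigr => k _; rewrite !mxE mulrC. Qed.

Hypothesis orth : forall i (x y : C), x != y -> forall a b v w,
  (T i - x%:M) ^+ a *m v = 0 -> (T i - y%:M) ^+ b *m w = 0 -> inner v w = 0.

(** The columns of the unitary matrix are orthonormal bases of the ranges of
    the spectral projections. Distinct ranges are orthogonal because they
    differ in the eigenvalue of some T_i; the ranges are invariant, so the
    off-diagonal blocks of the T_i vanish. *)
Lemma orthogonal_jordan : jordan_tuple T.
Proof.
have [r [P [lam [lam_inj sP nP cP]]]] := @commuting_projections C d m T cT.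
pose A k := (P k)^h.
have sub k n (X : 'M[C]_(n, m)) : (X <= A k)%MS -> exists D, X^h = P k *m D.
  by move=> /submxP[D ->]; exists D^h; rewrite adjM /A adjK.
have F k l n1 n2 (X : 'M[C]_(n1, m)) (Y : 'M[C]_(n2, m)) :
    (X <= A k)%MS -> (Y <= A l)%MS -> k != l -> X *m Y^h = 0.
  move=> /sub[D XD] /sub[D' YD] kl.
  have [i li] : exists i, lam l i != lam k i.
    apply: contrapT => /forallNP N; move/negP: kl; apply; apply/eqP/lam_inj/funext => i.
    by apply/esym/eqP; apply/negPn/negP; exact: N.
  apply/matrixP => a b.
  have z k' n (Z : 'M[C]_(m, n)) c : (T i - (lam k' i)%:M) ^+ m *m col c (P k' *m Z) = 0.
    by rewrite colE !mulmxA nP !mul0mx.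
  have := orth li (z l _ D' b) (z k _ D a).
  rewrite -XD -YD inner_adj !mxE => H; rewrite -[RHS]H; apply: eq_bigr => j _.
  by rewrite !mxE conjCK.
pose n k := \rank (A k).
pose B k : 'M[C]_(n k, m) := schmidt (row_base (A k)).
have Bu k : B k *m (B k)^h = 1%:M.
  by apply/unitarymxP; apply: schmidt_unitarymx; exact: rank_leq_row.
have BA k : (B k :=: A k)%MS.
  apply: eqmx_trans (eqmx_schmidt_free _) (eq_row_base _); exact: row_base_free.
have Bsub k : (B k <= A k)%MS by rewrite BA.
have TA k i n' (X : 'M[C]_(n', m)) : (X <= A k)%MS -> (X *m (T i)^h <= A k)%MS.
  move=> /submxP[D ->]; rewrite -mulmxA /A -adjM (cP k (T i)) ?adjM; last exact: cT.
  by rewrite mulmxA submxMl.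
pose W := (\mxcol_k B k)^h.
have WW : W^h *m W = 1%:M.
  rewrite /W adjK adj_mxcol mul_mxcol_mxrow mxblock_diag => [|k l kl].
    by rewrite (eq_mxdiag (B'_ := fun k => (1%:M : 'M[C]_(n k)))) ?mxdiagZ.
  exact: F kl.
(* The rows of the stacked bases are orthonormal, so there are at most m of
   them; they span because the projections add up to 1. *)
have e : (\sum_k n k)%N = m.
  apply/eqP; rewrite eqn_leq; apply/andP; split.
    have Vu : \mxcol_k B k \is unitarymx by apply/unitarymxP; rewrite -[RHS]WW /W adjK.
    by rewrite -(mxrank_unitary Vu) rank_leq_col.
  have h1 : ((1%:M : 'M[C]_m) <= \mxcol_k B k)%MS.
    have -> : 1%:M = \sum_k A k.
      apply/matrixP => a b; have := congr1 (fun M : 'M[C]_m => Num.conj (M b a)) sP.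
      rewrite /= !summxE rmorph_sum /= => H.
      rewrite (eq_bigr (fun k => Num.conj (P k b a))) => [|k _]; last by rewrite !mxE.
      by rewrite H !mxE eq_sym conjC_nat.
    apply: summx_sub => k _; rewrite -BA.
    by rewrite eqmx_col (sumsmx_sup k)// genmxE.
  have := mxrankS h1; rewrite mxrank1 => h2; apply: leq_trans h2 (rank_leq_row _).
pose J k i := B k *m T i *m (B k)^h.
have TB k i : T i *m (B k)^h = (B k)^h *m J k i.
  have /submxP[D BD] : (B k *m (T i)^h <= B k)%MS by rewrite BA; apply: TA.
  have E : T i *m (B k)^h = (B k)^h *m D^h by rewrite -adjM -BD adjM adjK.
  by rewrite /J -[X in _ = _ *m X]mulmxA E (mulmxA (B k)) Bu mul1mx.
exists r, n, e, J, (castmx (erefl m, e) W); split.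
- move=> k; exists (\row_i lam k i).
  have NB i a : (T i - (lam k i)%:M) ^+ a *m (B k)^h = (B k)^h *m (J k i - (lam k i)%:M) ^+ a.
    elim: a => [|a IH]; first by rewrite !expr0 mul1mx mulmx1.
    have T1 : (T i - (lam k i)%:M) *m (B k)^h = (B k)^h *m (J k i - (lam k i)%:M).
      by rewrite mulmxBl TB mul_scalar_mx -mul_mx_scalar -mulmxBr.
    rewrite exprSr -[_ * _]/(_ *m _) -mulmxA T1 mulmxA IH -mulmxA; congr (_ *m _).
    by rewrite exprSr.
  have JJ i j : J k i *m J k j = J k j *m J k i.
    have inj (X Y : 'M[C]_(n k)) : (B k)^h *m X = (B k)^h *m Y -> X = Y.
      by move=> /(congr1 (mulmx (B k))); rewrite !mulmxA Bu !mul1mx.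
    have h i' j' : (B k)^h *m (J k i' *m J k j') = T i' *m T j' *m (B k)^h.
      by rewrite mulmxA -(TB k i') -[LHS]mulmxA -(TB k j') mulmxA.
    by apply: inj; rewrite [LHS]h [RHS]h cT.
  exists (fun i => J k i - (lam k i)%:M); last by move=> i; rewrite mxE addrC subrK.
  split.
    have sub_scal (X : 'M[C]_(n k)) (c : C) Y : X *m Y = Y *m X -> (X - c%:M) *m Y = Y *m (X - c%:M).
      by move=> XY; rewrite mulmxBl mulmxBr XY scalar_mxC.
    move=> i j; apply: (sub_scal _ _ _ _); apply: esym; apply: (sub_scal _ _ _ _).
    by apply: esym; apply: JJ.
  exists (fun=> m) => i.
  have [D BD] := sub k _ _ (Bsub k).
  have := NB i m; rewrite BD mulmxA nP mul0mx => /(congr1 (mulmx (B k))).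
  by rewrite mulmx0 -BD mulmxA Bu mul1mx => <-.
- exact: castmx_unitary.
- move=> i; rewrite castmx_unitary_conj; congr castmx.
  rewrite {1}/W adjK /W adj_mxcol mxcol_mul mul_mxcol_mxrow mxblock_diag// => k l kl.
  have := F _ _ _ _ _ _ (Bsub k) (TA l i _ _ (Bsub l)) kl.
  by rewrite adjM adjK mulmxA.
Qed.

End JordanDecomposition.

(** * Exactness of the Koszul complex *)

Section Koszul.
Context {R : realType} {d m : nat}.
Local Notation C := R[i].
Implicit Types (S : {set 'I_d}) (i j k : 'I_d).

(** The sign of the Koszul differential. *)
Definition eps i S : C := (-1) ^+ #|[set j in S | (j < i)%N]%SET|.

(** The effect on [eps] of adding or removing the element [k]. *)
Definition sgn_lt (k i : 'I_d) : C := if (k < i)%N then -1 else 1.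

Lemma eps_setU1 i k S : k \notin S -> eps i (k |: S) = sgn_lt k i * eps i S.
Proof.
move=> kS; rewrite /eps /sgn_lt; case: ifP => ki.
  rewrite -exprS -[(#|_|).+1]add1n; congr (_ ^+ _).
  rewrite (_ : [set j in k |: S | _]%SET = (k |: [set j in S | (j < i)%N])%SET).
    by rewrite cardsU1 !inE (negbTE kS).
  by apply/setP => j; rewrite !inE; case: eqP => [->|//]; rewrite ki.
rewrite mul1r; congr (_ ^+ _); apply: eq_card => j; rewrite !inE.
by case: eqP => [->|//]; rewrite ki !andbF.
Qed.

Lemma eps_sqr i S : eps i S * eps i S = 1.
Proof. by rewrite -expr2 -exprM mulnC exprM sqrrN expr1n expr1n. Qed.

Lemma sgn_lt_sqr k i : sgn_lt k i * sgn_lt k i = 1.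
Proof. by rewrite /sgn_lt; case: ifP => _; rewrite ?mulrNN mulr1. Qed.

Lemma eps_setD1 i k S : k \in S -> eps i (S :\ k) = sgn_lt k i * eps i S.
Proof.
move=> kS; have := eps_setU1 i (k := k) (S := S :\ k); rewrite !inE eqxx => /(_ isT).
by rewrite finset.setD1K// => ->; rewrite mulrA sgn_lt_sqr mul1r.
Qed.

Lemma sgn_lt_anti i j : i != j -> sgn_lt i j = - sgn_lt j i.
Proof.
by rewrite /sgn_lt; case: ltngtP => [|| /val_inj->]; rewrite ?opprK// eqxx.
Qed.

Lemma sgn_ltii i : sgn_lt i i = 1. Proof. by rewrite /sgn_lt ltnn. Qed.

Lemma koszulE (T : 'I_d -> 'M[C]_m) x S :
  koszul T x S = \sum_(i in S) eps i S *: (T i *m x (S :\ i)).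
Proof. by rewrite ffunE. Qed.

Lemma anti_sum (G : 'I_d -> 'I_d -> 'cV[C]_m) : (forall i j, G i j = - G j i) ->
  \sum_i \sum_j G i j = 0.
Proof.
move=> H; set X := \sum_i _; have : X = - X.
  rewrite {1}/X exchange_big /= -sumrN; apply: eq_bigr => i _.
  by rewrite -sumrN; apply: eq_bigr => j _.
move/eqP; rewrite -addr_eq0 -mulr2n -scaler_nat scaler_eq0 pnatr_eq0 /=.
by move/eqP.
Qed.

(** Removing i and then j, or j and then i, gives opposite signs. *)
Lemma koszul_square (T : 'I_d -> 'M[C]_m) x : commuting_tuple T -> koszul T (koszul T x) = 0.
Proof.
move=> cT; apply/ffunP => S; rewrite koszulE ffunE.
pose G i j : 'cV[C]_m := if [&& i \in S, j \in S & i != j] then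
  (eps i S * (sgn_lt i j * eps j S)) *: (T i *m T j *m x (S :\ i :\ j)) else 0.
rewrite -[RHS](@anti_sum G).
  rewrite big_mkcond; apply: eq_bigr => i _; rewrite /G.
  case: ifP => iS /=; last by rewrite big1.
  rewrite koszulE mulmx_sumr scaler_sumr big_mkcond /=; apply: eq_bigr => j _.
  rewrite !inE eq_sym andbC; case: ifP => // /andP[jS ji].
  by rewrite eps_setD1// -scalemxAr scalerA mulmxA.
move=> i j; rewrite /G; case: (eqVneq i j) => [->|ij]; first by rewrite ?eqxx !andbF oppr0.
rewrite ?(eq_sym j) ?ij !andbT andbC; case: ifP; rewrite ?oppr0// => _.
rewrite cT (sgn_lt_anti ij) finset.setDDl finset.setUC -finset.setDDl -scaleNr; congr (_ *: _); ring.
Qed.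

(** The homotopy is s x (S) = sum over j not in S of +- B_j x (S + j). In K s
    + s K the terms with two distinct indices cancel and the others add up to
    sum_i A_i B_i = 1. Since K x = 0, this reads K (s x) = x. *)
Lemma koszul_contraction (A B : 'I_d -> 'M[C]_m) : commuting_tuple A ->
  (forall i j, A i *m B j = B j *m A i) -> \sum_i A i *m B i = 1%:M -> koszul_exact A.
Proof.
move=> cA AB AB1 x; split; last by move=> [y ->]; exact: koszul_square.
move=> Kx.
pose s : {ffun {set 'I_d} -> 'cV[C]_m} :=
  [ffun S : {set 'I_d} => \sum_(j | j \notin S) eps j S *: (B j *m x (j |: S)%SET)].
exists s; apply/ffunP => S.
pose F i j : 'cV[C]_m := (eps i S * (sgn_lt i j * eps j S)) *: (A i *m B j *m x (j |: (S :\ i))%SET).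
have E1 : koszul A s S = \sum_(i in S) (A i *m B i *m x S + \sum_(j | j \notin S) F i j).
  rewrite koszulE; apply: eq_bigr => i iS; rewrite ffunE.
  rewrite (bigD1 i) /=; last by rewrite !inE eqxx.
  rewrite mulmxDr scalerDr finset.setD1K// -scalemxAr scalerA eps_setD1// sgn_ltii mul1r
    eps_sqr scale1r mulmxA.
  congr (_ + _); rewrite mulmx_sumr scaler_sumr; apply: eq_big => j.
    rewrite !inE; case: (eqVneq j i) => [->|]; by rewrite ?iS ?andbT.
  by move=> _; rewrite /F -scalemxAr scalerA eps_setD1// mulmxA.
have E2 : \sum_(j | j \notin S) eps j S *: (B j *m koszul A x (j |: S)%SET) =
   \sum_(j | j \notin S) (A j *m B j *m x S + \sum_(i in S) - F i j).
  apply: eq_bigr => j jS; rewrite koszulE (bigD1 j) /=; last by rewrite !inE eqxx.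
  rewrite mulmxDr scalerDr finset.setU1K// -scalemxAr scalerA eps_setU1// sgn_ltii mul1r
    eps_sqr scale1r mulmxA AB.
  congr (_ + _); rewrite mulmx_sumr scaler_sumr; apply: eq_big => i.
    rewrite !inE; case: (eqVneq i j) => [->|]; by rewrite ?(negbTE jS) ?andbT.
  rewrite !inE => /andP[ijS ij].
  have iS : i \in S by move: ijS; rewrite (negbTE ij).
  rewrite /F -scalemxAr scalerA eps_setU1// mulmxA AB (sgn_lt_anti ij) -scaleNr.
  have -> : ((j |: S) :\ i = j |: (S :\ i))%SET.
    by apply/setP => k; rewrite !inE; case: (eqVneq k j) => [->|//]; rewrite eq_sym ij.
  congr (_ *: _); ring.
have : \sum_(j | j \notin S) eps j S *: (B j *m koszul A x (j |: S)%SET) = 0.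
  by rewrite Kx big1// => j _; rewrite ffunE mulmx0 scaler0.
rewrite E2 big_split /= => E3.
rewrite E1 big_split /= -[LHS]mul1mx -AB1 mulmx_suml (bigID (mem S)) /=; congr (_ + _).
move/eqP: E3; rewrite addr_eq0 => /eqP->; rewrite exchange_big /= -sumrN.
by apply: eq_bigr => i _; rewrite sumrN opprK.
Qed.

(** In degree 0 a joint null vector is a cycle, and nothing maps to degree 0. *)
Lemma koszul_eigenvector (A : 'I_d -> 'M[C]_m) (v : 'cV[C]_m) :
  v != 0 -> (forall i, A i *m v = 0) -> ~ koszul_exact A.
Proof.
move=> v0 Av /(_ [ffun S : {set 'I_d} => if S == finset.set0 then v else 0]) [H _].
have [|y /ffunP/(_ finset.set0)] := H.
  apply/ffunP => S; rewrite koszulE [RHS]ffunE big1// => i _; rewrite ffunE.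
  by case: ifP => _; rewrite ?Av ?mulmx0 scaler0.
rewrite ffunE eqxx koszulE big1 => [/eqP|i]; first by rewrite (negbTE v0).
by rewrite inE.
Qed.

End Koszul.

(** * The Taylor spectrum of commuting matrices *)

Section Spectrum.
Context {R : realType} {d m : nat}.
Local Notation C := R[i].
Variable T : 'I_d -> 'M[C]_m.
Hypothesis cT : commuting_tuple T.

(** For one index after the other, replace the vector by its last nonzero
    image under the powers of the nilpotent matrix. *)
Lemma joint_kernel (N : 'I_d -> 'M[C]_m) (e : 'I_d -> nat) (v : 'cV[C]_m) :
  commuting_tuple N -> v != 0 -> (forall i, N i ^+ e i *m v = 0) ->
  exists2 w : 'cV[C]_m, w != 0 & forall i, N i *m w = 0.
Proof.
move=> cN v0 Nv.
suff [w [w0 _ Hw]] : exists w : 'cV[C]_m, [/\ w != 0, forall i, N i ^+ e i *m w = 0 &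
    forall i, i \in enum 'I_d -> N i *m w = 0].
  by exists w => // i; apply: Hw; rewrite mem_enum.
elim: (enum 'I_d) => [|i l [w [w0 Nw Hw]]]; first by exists v.
have exq : exists q, N i ^+ q *m w == 0 by exists (e i); rewrite Nw.
case: (ex_minnP exq) => -[|q] /eqP Nq qmin; first by rewrite expr0 mul1mx in Nq; rewrite Nq eqxx in w0.
have co k a : N k ^+ a *m (N i ^+ q *m w) = N i ^+ q *m (N k ^+ a *m w).
  rewrite !mulmxA; congr (_ *m _); apply: comm_mxX.
  by apply: esym; apply: comm_mxX; exact: cN.
exists (N i ^+ q *m w); split.
- by apply/negP => /qmin; rewrite ltnn.
- by move=> k; rewrite co Nw mulmx0.
- move=> k; rewrite inE => /orP[/eqP->|kl].
    by rewrite mulmxA -[_ *m _]/(N i * N i ^+ q *m w) -exprS.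
  by have := co k 1%N; rewrite expr1 => ->; rewrite Hw// mulmx0.
Qed.

Definition commutes_with_commutant (X : 'M[C]_m) :=
  forall A, (forall i, A *m T i = T i *m A) -> A *m X = X *m A.

(** Where T_i - y is nilpotent, T_i - x is invertible by the geometric series.
    The inverse is a polynomial in T_i, hence lies in the bicommutant. *)
Lemma local_inverse (i : 'I_d) (x y : C) n (P : 'M[C]_m) : x != y ->
  (T i - y%:M) ^+ n *m P = 0 -> exists2 X, commutes_with_commutant X &
  P = (T i - x%:M) *m (X *m P).
Proof.
move=> xy; elim: n P => [|n IH] P.
  rewrite expr0 mul1mx => ->; exists 0; last by rewrite !mulmx0.
  by move=> A _; rewrite mulmx0 mul0mx.
set N := T i - y%:M => NP.
have [|X cX E] := IH (N *m P).
  by rewrite mulmxA -[_ *m _]/(N ^+ n * N *m P) -exprSr.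
have yx : y - x != 0 by rewrite subr_eq0 eq_sym.
have comN A : (forall i, A *m T i = T i *m A) -> A *m N = N *m A.
  by move=> AT; rewrite /N mulmxBr mulmxBl AT scalar_mxC.
exists ((y - x)^-1 *: (1%:M - X *m N)).
  move=> A AT; rewrite -scalemxAr -scalemxAl mulmxBr mulmxBl mulmx1 mul1mx.
  by rewrite mulmxA cX// -!mulmxA comN.
rewrite -scalemxAl -scalemxAr (mulmxBl 1%:M) mul1mx mulmxBr -(mulmxA X) -E.
have -> : T i - x%:M = N + (y - x)%:M.
  by rewrite /N raddfB /= addrA subrK.
by rewrite mulmxDl addrAC subrr add0r mul_scalar_mx scalerA mulVf// scale1r.
Qed.

(** If [lam] is not a joint eigenvalue, each spectral projection factors
    through some T_i - lam_i: those at another point by [local_inverse], the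
    one at [lam] because it is 0. Adding up yields sum_i (T_i - lam_i) B_i =
    1. *)
Lemma taylor_spectrumE (lam : 'rV[C]_d) : taylor_spectrum T lam <->
  exists2 v : 'cV[C]_m, v != 0 & forall i, T i *m v = lam 0 i *: v.
Proof.
have eig v i : (T i *m v = lam 0 i *: v) <-> (T i - (lam 0 i)%:M) *m v = 0.
  rewrite mulmxBl mul_scalar_mx; split => [->|/eqP]; first by rewrite subrr.
  by rewrite subr_eq0 => /eqP.
split; last first.
  by move=> [v v0 Hv]; apply: (koszul_eigenvector v0) => i; apply/eig.
move=> sp; apply: contrapT => noeig; apply: sp.
have cA : commuting_tuple (fun i => T i - (lam 0 i)%:M).
  move=> i j; have h := shifted_comm cT (fun k => lam 0 k) j i.
  by rewrite [LHS]mulmxBl [RHS]mulmxBr -/(shifted T _ j) h scalar_mxC.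
have [r [P [mu [mu_inj sP nP cP]]]] := @commuting_projections C d m T cT.
have H k : exists b : 'I_d -> 'M[C]_m, (forall i, commutes_with_commutant (b i)) /\
   P k = \sum_i (T i - (lam 0 i)%:M) *m b i.
  have [muk|] := pselect (forall i, mu k i = lam 0 i).
    exists (fun=> 0); split; first by move=> i A _; rewrite mulmx0 mul0mx.
    rewrite big1 => [|i _]; last by rewrite mulmx0.
    apply/matrixP => a b; rewrite mxE; apply/eqP/negPn/negP => Pab.
    apply: noeig.
    have [||i|w w0 Hw] := @joint_kernel (fun i => T i - (lam 0 i)%:M) (fun=> m) (col b (P k)).
    - exact: cA.
    - by apply/negP => /eqP/matrixP/(_ a 0); rewrite !mxE => /eqP; rewrite (negbTE Pab).
    - by rewrite colE mulmxA -muk nP mul0mx.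
    by exists w => // i; apply/eig.
  move/existsNP => [i0 /eqP mui].
  have [|X cX E] := @local_inverse i0 (lam 0 i0) (mu k i0) m (P k) _ (nP k i0).
    by rewrite eq_sym.
  exists (fun i => if i == i0 then X *m P k else 0); split.
    move=> i A AT; case: eqP => _; last by rewrite mulmx0 mul0mx.
    by rewrite mulmxA cX// -mulmxA cP// mulmxA.
  rewrite (bigD1 i0)//= eqxx -E big1 ?addr0// => i /negbTE->; by rewrite mulmx0.
have [b Hb] := choice H.
apply: (koszul_contraction (B := fun i => \sum_k b k i) cA).
  move=> i j; rewrite mulmx_sumr mulmx_suml; apply: eq_bigr => k _.
  apply: (Hb k).1 => l; rewrite mulmxBl mulmxBr cT scalar_mxC //.
rewrite -sP (eq_bigr _ (fun k _ => (Hb k).2)) exchange_big /=; apply: eq_bigr => i _.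
by rewrite mulmx_sumr.
Qed.

(** A spectral projection that does not kill a joint eigenvector sits at its
    eigenvalue. *)
Lemma taylor_spectrum_finite : finite_set (taylor_spectrum T).
Proof.
have [r [P [mu [mu_inj sP nP cP]]]] := @commuting_projections C d m T cT.
apply: (@sub_finite_set _ _ [set \row_i mu k i | k in [set: 'I_r]]); last first.
  by apply: finite_image; exact: finite_finset.
move=> lam /taylor_spectrumE[v v0 Tv].
have [k Pk] : exists k, P k *m v != 0.
  apply: contrapT => /forallNP H; move/negP: v0; apply; apply/eqP.
  rewrite -[v]mul1mx -sP mulmx_suml big1// => k _.
  by apply/eqP/negPn/negP; exact: H.
exists k => //; apply/rowP => i; rewrite mxE.
apply/eqP/negPn/negP => ne.
have E n : (T i - (mu k i)%:M) ^+ n *m (P k *m v) = (lam 0 i - mu k i) ^+ n *: (P k *m v).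
  elim: n => [|n IH]; first by rewrite !expr0 mul1mx scale1r.
  rewrite exprS -[_ * _]/(_ *m _) -mulmxA IH -scalemxAr mulmxBl mul_scalar_mx.
  rewrite mulmxA (cP k (T i)) -?mulmxA ?Tv; last exact: cT.
  by rewrite -scalemxAr -scalerBl scalerA exprSr.
have := E m; rewrite mulmxA nP mul0mx => /esym/eqP.
by rewrite scaler_eq0 (negbTE Pk) orbF expf_eq0 subr_eq0 eq_sym (negbTE ne) andbF.
Qed.

End Spectrum.

(** * The distribution of a Jordan tuple *)

Section FromJordan.
Context {R : realType} {d : nat}.
Local Notation C := R[i].
Local Notation V := 'rV[R]_(d + d).

Lemma mul_mxdiag r (n : 'I_r -> nat) (A B : forall k, 'M[C]_(n k)) :
  \mxdiag_k A k *m \mxdiag_k B k = \mxdiag_k (A k *m B k).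
Proof.
rewrite {2}/mxdiag mul_mxdiag_mxblock; apply/eq_mxblockP => k l.
case: eqP => [<-|_]; last by rewrite mulmx0.
by rewrite !conform_mx_id.
Qed.

Lemma adj_mxdiag r (n : 'I_r -> nat) (A : forall k, 'M[C]_(n k)) :
  (\mxdiag_k A k)^h = \mxdiag_k (A k)^h.
Proof.
rewrite /mxdiag (_ : map_mx _ _ = \mxblock_(k, l)
   ((if l == k then conform_mx 0 (A l) else 0 : 'M[C]_(n l, n k))^h)); last first.
  by apply/matrixP => a b; rewrite !mxE.
apply/eq_mxblockP => k l; rewrite (eq_sym l k).
case: eqP => [<-|_]; first by rewrite !conform_mx_id.
by rewrite trmx0 map_mx0.
Qed.

(** The block projections, transported by the unitary matrix. *)
Lemma jordan_decomposition m (T : 'I_d -> 'M[C]_m) : jordan_tuple T ->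
  exists (r : nat) (Q : 'I_r -> 'M[C]_m) (lam : 'I_r -> 'I_d -> C) (e : 'I_r -> 'I_d -> nat),
  [/\ \sum_k Q k = 1%:M, forall k i, T i *m Q k = Q k *m T i,
      forall k l, k != l -> (Q k)^h *m Q l = 0 &
      forall k i, (T i - (lam k i)%:M) ^+ e k i *m Q k = 0].
Proof.
move=> [r [n [E [J [U []]]]]]; move: T U; case: m / E => T U HJ Uu UT.
have UU : U *m U^h = 1%:M by exact/unitarymxP.
have UU' : U^h *m U = 1%:M by apply: mulmx1C.
have {UT}TE i : T i *m U = U *m \mxdiag_k J k i.
  by have := UT i; rewrite castmx_id => <-; rewrite !mulmxA UU mul1mx.
have [lam Hlam] := choice HJ.
have Hnil k : exists a : 'I_d -> nat, forall i, (J k i - (lam k 0 i)%:M) ^+ a i = 0.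
  have [N [_ [a Na]] JN] := Hlam k; exists a => i.
  by rewrite JN addrC addKr Na.
have [e He] := choice Hnil.
pose D k := \mxdiag_j ((j == k)%:R%:M : 'M[C]_(n j)).
have DJ k i : (\mxdiag_j J j i) *m D k = D k *m \mxdiag_j J j i.
  by rewrite !mul_mxdiag; apply: eq_mxdiag => j; rewrite scalar_mxC.
have TQ k i : T i *m (U *m D k *m U^h) = U *m D k *m U^h *m T i.
  have UT : U^h *m T i = \mxdiag_k J k i *m U^h.
    rewrite -[LHS]mulmx1 -UU -[U^h *m T i *m _]mulmxA (mulmxA (T i)) TE.
    by rewrite !mulmxA UU' mul1mx.
  rewrite mulmxA [T i *m _]mulmxA TE -(mulmxA U (\mxdiag_j J j i)) DJ.
  by rewrite -[RHS]mulmxA UT !mulmxA.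
exists r, (fun k => U *m D k *m U^h), (fun k i => lam k 0 i), e; split.
- rewrite -mulmx_suml -mulmx_sumr (_ : \sum_k D k = 1%:M) ?mulmx1//.
  rewrite /D -mxdiag_sum -mxdiagZ; apply: eq_mxdiag => j.
  rewrite (bigD1 j)//= eqxx big1 ?addr0// => k; rewrite eq_sym => /negbTE->.
  by rewrite raddf0.
- by move=> k i; exact: TQ.
- move=> k l kl; rewrite !adjM adjK !mulmxA -(mulmxA _ U^h U) UU' mulmx1.
  have -> : (D k)^h = D k.
    rewrite /D adj_mxdiag; apply: eq_mxdiag => j.
    by rewrite tr_scalar_mx map_scalar_mx rmorph_nat.
  rewrite -(mulmxA U) mul_mxdiag (_ : \mxdiag_j _ = 0) ?mulmx0 ?mul0mx//.
  rewrite -mxdiag0; apply: eq_mxdiag => j.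
  case: (eqVneq j k) => [->|_]; first by rewrite (negbTE kl) mul_mx_scalar scale0r.
  by rewrite mul_scalar_mx scale0r.
- move=> k i; set N := T i - _.
  pose M := \mxdiag_j (J j i - (lam k 0 i)%:M).
  have NU a : N ^+ a *m U = U *m M ^+ a.
    have N1 : N *m U = U *m M.
      by rewrite /N mulmxBl TE mul_scalar_mx -mul_mx_scalar -mulmxBr -mxdiagZ /M mxdiagB.
    elim: a => [|a IH]; first by rewrite !expr0 mul1mx mulmx1.
    rewrite exprSr -[_ * _]/(_ *m _) -mulmxA N1 mulmxA IH -mulmxA; congr (_ *m _).
    by rewrite exprSr.
  have MX a : M ^+ a = \mxdiag_j ((J j i - (lam k 0 i)%:M) ^+ a).
    elim: a => [|a IH]; first by rewrite expr0 -[1]/(1%:M) -mxdiagZ; apply: eq_mxdiag => j; rewrite expr0.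
    rewrite exprS IH -[LHS]/(_ *m _) mul_mxdiag; apply: eq_mxdiag => j.
    by rewrite exprS.
  rewrite mulmxA [_ *m (U *m _)]mulmxA NU MX -(mulmxA U) mul_mxdiag.
  rewrite (_ : \mxdiag_j _ = 0) ?mulmx0 ?mul0mx// -mxdiag0; apply: eq_mxdiag => j.
  case: (eqVneq j k) => [->|_]; first by rewrite He mul0mx.
  by rewrite mul_mx_scalar scale0r.
Qed.

Section Lam.
Context {m : nat}.
Variable T : 'I_d -> 'M[C]_m.
Hypothesis cT : commuting_tuple T.

Lemma Lam0l w p : Lam T 0 w p = 0.
Proof. by apply: Lam_eq0 => a b; rewrite mulmx0 inner0l. Qed.

Lemma Lam0r v p : Lam T v 0 p = 0.
Proof. by apply: Lam_eq0 => a b; rewrite mulmx0 inner0r. Qed.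

Lemma Lam_suml (I : Type) (s : seq I) (v : I -> 'cV[C]_m) w p :
  Lam T (\sum_(k <- s) v k) w p = \sum_(k <- s) Lam T (v k) w p.
Proof.
elim: s => [|k s IH]; first by rewrite !big_nil Lam0l.
by rewrite !big_cons -IH -{1}[v k]scale1r Lam_linearl mul1r.
Qed.

Lemma Lam_sumr (I : Type) (s : seq I) v (w : I -> 'cV[C]_m) p :
  Lam T v (\sum_(k <- s) w k) p = \sum_(k <- s) Lam T v (w k) p.
Proof.
elim: s => [|k s IH]; first by rewrite !big_nil Lam0r.
by rewrite !big_cons -IH -{1}[w k]scale1r Lam_semilinear conjC1 mul1r.
Qed.

(** Parts of [h] that vanish are discarded, so the derivatives are only taken
    at joint eigenvalues. *)
Lemma jordan_distribution (h : 'cV[C]_m) : jordan_tuple T ->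
  exists u : (V -> C) -> C, distribution_extending (Lam T h h) u /\
  forall f, (forall lam : 'rV[C]_d, taylor_spectrum T lam ->
     forall s, partialC f s (toR (fun i => lam 0 i)) = 0) -> u f = 0.
Proof.
move=> /jordan_decomposition[r [Q [lam [e [sQ cQ oQ nQ]]]]].
pose v k := Q k *m h.
have vN k i : shifted T (lam k) i ^+ e k i *m v k = 0 by rewrite mulmxA nQ mul0mx.
have H k : exists u : (V -> C) -> C, distribution_extending (Lam T (v k) (v k)) u /\
  forall f, (v k != 0 -> forall s, partialC f s (toR (lam k)) = 0) -> u f = 0.
  case: (eqVneq (v k) 0) => [->|_].
    exists (fun=> 0); split=> //; split; first exact: dist_zero.
    by move=> p; rewrite Lam0l.
  have [u [du u0]] := Lam_point cT (vN k).
  by exists u; split=> // f /(_ isT); apply: u0.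
have [u Hu] := choice H.
have hE : h = \sum_k v k by rewrite -mulmx_suml sQ mul1mx.
have cross k l p : k != l -> Lam T (v k) (v l) p = 0.
  move=> kl; apply: Lam_eq0 => a b.
  have co c j : tuple_pow T c *m v j = Q j *m (tuple_pow T c *m h).
    rewrite !mulmxA; congr (_ *m _); rewrite /tuple_pow.
    elim: (index_enum _) => [|i s IH]; first by rewrite big_nil mul1mx mulmx1.
    rewrite big_cons -[_ * _]/(_ *m _) -mulmxA IH !mulmxA; congr (_ *m _).
    by apply: esym; apply: comm_mxX; rewrite cQ.
  rewrite !co inner_adj adjM -mulmxA (mulmxA _ (Q k)) oQ; last by rewrite eq_sym.
  by rewrite mul0mx mulmx0 mxE.
exists (fun f => \sum_k u k f); split; first split.
- by apply: dist_sum => k; exact: (Hu k).1.1.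
- move=> p; rewrite {1}hE Lam_suml; apply: eq_bigr => k _.
  rewrite (Hu k).1.2 hE Lam_sumr (bigD1 k)//= big1 ?addr0// => l lk.
  by rewrite cross// eq_sym.
- move=> f f0; rewrite big1// => k _; apply: (Hu k).2 => vk.
  have [||i|w w0 Hw] := @joint_kernel R d m (shifted T (lam k)) (e k) (v k).
  - move=> i j; have hh := shifted_comm cT (lam k) j i.
    rewrite -[shifted T (lam k) i]/(T i - (lam k i)%:M).
    by rewrite [LHS]mulmxBl [RHS]mulmxBr hh scalar_mxC.
  - exact: vk.
  - exact: vN.
  have sp : taylor_spectrum T (\row_i lam k i).
    apply/(taylor_spectrumE cT); exists w => // i.
    by rewrite (mul_shifted T (lam k)) Hw addr0 mxE.
  move=> s; have := f0 _ sp s.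
  by rewrite (_ : (fun i => _) = lam k)//; apply/funext => i; rewrite mxE.
Qed.

Lemma Lam_eigenvector (lam : 'I_d -> C) (v : 'cV[C]_m) p :
  (forall i, T i *m v = lam i *: v) ->
  Lam T v v p = zzbar_eval p (toR lam) * inner v v.
Proof.
move=> Tv; have Nv i : shifted T lam i *m v = 0.
  by rewrite mulmxBl Tv mul_scalar_mx subrr.
elim/(@mpoly_xvar_ind R d): p => [|a p q IHp IHq|j p IH].
- by rewrite Lam1 zz1 mul1r.
- by rewrite Lam_linear zz_linear IHp IHq; ring.
have := @Lam_xpow_vanish R d m T cT lam [:: j] v v p.
rewrite /xpow big_seq1 mulrBr -scalerAr mulr1 addrC -scaleNr Lam_linear.
rewrite [p * _]mulrC zz_xvar -mulrA -IH => H; apply/eqP; rewrite -subr_eq0 -mulNr addrC; apply/eqP.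
apply: H => -[|a1 [|a2 a]] [|b1 [|b2 b]] //= _; [by right; rewrite Nv|by left; rewrite Nv].
Qed.

End Lam.
End FromJordan.

(** * The support *)

Section Support.
Context {R : realType} {d m : nat}.
Local Notation C := R[i].
Local Notation V := 'rV[R]_(d + d).
Variables (T : 'I_d -> 'M[C]_m) (h : 'cV[C]_m).
Hypothesis hT : cyclic_commuting_tuple T h.
Variable u : (V -> C) -> C.
Hypothesis du : distribution_extending (Lambda T h) u.

Lemma toCd_inj : injective (@toCd R d).
Proof.
move=> x y /rowP xy; apply/rowP => j; rewrite -(splitK j).
by case: (fintype.split j) => i; have := xy i; rewrite !mxE => -[].
Qed.

Lemma partialC_eq0_open (f : V -> C) (U : set V) s x : open U ->
  (forall x, U x -> f x = 0) -> U x -> partialC f s x = 0.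
Proof.
move=> oU f0 Ux; rewrite /partialC.
rewrite (@partial_eq0_open R _ _ U s oU _ x Ux); last by move=> y /f0 ->.
by rewrite (@partial_eq0_open R _ _ U s oU _ x Ux)//; move=> y /f0 ->.
Qed.

(** By density [u] is the distribution of [jordan_distribution], and the
    derivatives of a test function supported away from the spectrum vanish on
    the spectrum. *)
Lemma dsupport_sub_spectrum (x : V) : jordan_tuple T -> dsupport u x ->
  taylor_spectrum T (toCd x).
Proof.
move=> jT ux; apply: contrapT => nsp; apply: ux.
have cT := hT.1.
have [u0 [[du0 eu0] u0v]] := jordan_distribution cT h jT.
pose S := [set y : V | taylor_spectrum T (toCd y)].
have fS : finite_set S.
  by apply: finite_preimage (taylor_spectrum_finite cT) => y z _ _; exact: toCd_inj.
exists (~` S); split => //.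
  have aV : accessible_space V by apply: hausdorff_accessible; exact: norm_hausdorff.
  by rewrite openC; move: aV => /accessible_finite_set_closed; apply.
move=> phi sphi cphi phiS.
(* Both distributions agree on polynomials, so their difference vanishes on
   test functions. *)
have dd : compact_distribution (fun f => (-1) * u0 f + u f).
  by apply: dist_comb => //; exact: du.1.
have := dist_zz_eq0 dd _ sphi cphi.
rewrite u0v ?mulr0 ?add0r.
  by apply => p; rewrite eu0 du.2 mulN1r addNr.
move=> lam sp s; apply: (@partialC_eq0_open _ (~` closure [set y | phi y != 0])).
- by rewrite openC; exact: closed_closure.
- move=> y ny; apply/eqP/negPn/negP => py; apply: ny; exact: subset_closure.
- move=> /phiS; apply; rewrite /S /= toCd_toR.
  have -> : \row_i lam 0 i = lam by apply/rowP => i; rewrite mxE.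
  exact: sp.
Qed.

(** For a joint eigenvector [v], the localization of [u] at (v, v) is |v|^2
    times evaluation at [lam] on polynomials, so by density on test functions;
    a bump function near [lam] shows that it cannot vanish there, hence
    neither can [u]. *)
Lemma spectrum_sub_dsupport (lam : 'rV[C]_d) : taylor_spectrum T lam ->
  dsupport u (toR (fun i => lam 0 i)).
Proof.
have cT := hT.1.
move=> /(taylor_spectrumE cT)[v v0 Tv] [A [oA Ax vA]].
set x := toR _ in Ax.
have [u' [[du' eu'] vu']] := localized_all hT du v v.
have /nbhs_ballP[e /= e0 Be] : nbhs x A by exact: open_nbhs_nbhs.
have e2 : 0 < e / 2 by rewrite divr_gt0.
have [psi [spsi psix psis]] := bump x e2.
pose K : set V := [set y | forall k, `[x 0 k - e / 2, x 0 k + e / 2]%classic (y ord0 k)].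
have cK : compact K.
  apply: (@rV_compact R _ (fun k => `[x 0 k - e / 2, x 0 k + e / 2]%classic)) => k.
  exact: segment_compact.
pose phi : V -> C := fun y => (psi y)%:C.
have sphi : smooth phi by split; [exact: spsi|exact: smooth_cst].
have phiK : closure [set y | phi y != 0] `<=` K.
  have -> : K = closure K.
    by apply/closure_id; apply: compact_closed cK; exact: norm_hausdorff.
  apply: closureS => y /= py k; rewrite /= in_itv /=.
  have : psi y != 0 by apply: contraNN py => /eqP; rewrite /phi => ->.
  by move=> /psis/(_ k); rewrite ltr_norml => /andP[]; lra.
have cphi : compact (closure [set y | phi y != 0]).
  by apply: (subclosed_compact _ cK phiK); exact: closed_closure.
have KA : K `<=` A.
  move=> y Ky; apply: Be; rewrite -ball_normE /ball_ /=.
  have -> : `|x - y| = mx_norm (x - y) by [].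
  rewrite mx_normrE; apply/bigmax_ltP; split=> // -[a b] _ /=.
  have := Ky b; rewrite /= in_itv /= (ord1 a) => /andP[h1 h2].
  have -> : (x - y) 0 b = x 0 b - y 0 b by rewrite mxE [X in _ + X]mxE.
  by rewrite ltr_norml; apply/andP; split; lra.
have up0 : u' phi = 0 by apply: (vu' A vA) => //; exact: subset_trans phiK KA.
(* The localization minus |v|^2 times evaluation vanishes on polynomials. *)
have dd : compact_distribution (fun f => (-1) * u' f + inner v v * partialC f [::] x).
  by apply: dist_comb; [exact: du'|exact: dist_eval].
have E f : partialC f [::] x = f x by apply: ccomplexP.
have := dist_zz_eq0 dd _ sphi cphi.
rewrite up0 mulr0 add0r E => H.
have {}H : inner v v * phi x = 0.
  by apply: H => p; rewrite E eu' (Lam_eigenvector cT _ Tv) mulN1r [inner v v * _]mulrC addNr.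
move/eqP: H; rewrite mulf_eq0 => /orP[|]; last first.
  by rewrite /phi => /eqP[/eqP]; rewrite (negbTE psix).
rewrite /inner psumr_eq0 => [|k _]; last exact: mul_conjC_ge0.
move=> /allP H; move/negP: v0; apply; apply/eqP/matrixP => k j.
have := H k; rewrite mem_index_enum => /(_ isT); rewrite mul_conjC_eq0 ord1 mxE.
by move/eqP.
Qed.

End Support.

Theorem theorem6p2 (R : realType) (d m : nat)
    (T : 'I_d -> 'M[R[i]]_m) (h : 'cV[R[i]]_m)
    (hT : cyclic_commuting_tuple T h) :
  ((exists u : ('rV[R]_(d + d) -> R[i]) -> R[i],
      distribution_extending (Lambda T h) u) <->
   jordan_tuple T) /\
  (forall u : ('rV[R]_(d + d) -> R[i]) -> R[i],
     distribution_extending (Lambda T h) u ->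
     toCd @` dsupport u = taylor_spectrum T /\
     finite_set (taylor_spectrum T)).
Proof.
have cT := hT.1.
have toJ u : distribution_extending (Lambda T h) u -> jordan_tuple T.
  move=> du; apply: (orthogonal_jordan cT) => i x y xy a b v w.
  exact: (gen_eigen_orthogonal cT hT du xy).
split.
  split=> [[u /toJ]//|jT].
  by have [u [du _]] := jordan_distribution cT h jT; exists u.
move=> u du; split; last exact: taylor_spectrum_finite.
apply/seteqP; split=> [_ [x ux <-]|lam sp].
  exact: (dsupport_sub_spectrum hT du (toJ _ du)).
exists (toR (fun i => lam 0 i)); first exact: (spectrum_sub_dsupport hT du).
by rewrite toCd_toR; apply/rowP => i; rewrite mxE.
Qed.
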